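(* Let $d \in \mathbb{N}$, let $\Omega \subset \mathbb{R}^d$ be open with Lipschitz boundary, let $\theta \in [0,\frac{\pi}{2})$ and $p \in (1,\infty)$. Let $c_{kl} \in W^{1,\infty}(\Omega,\mathbb{C})$ for all $k,l \in \{1,\ldots,d\}$, set $C = (c_{kl})_{1 \le k,l \le d}$, and assume that $(C(x)\,\xi,\xi) \in \Sigma_\theta$ for all $x \in \Omega$ and $\xi \in \mathbb{C}^d$. Let $A_p$ be the operator in $L_p(\Omega)$ given by \[ A_p u = -\sum_{k,l=1}^d \partial_l (c_{kl}\, \partial_k u), \qquad D(A_p) = W^{2,p}(\Omega) \cap W^{1,p}_0(\Omega). \] Suppose $|1-\frac{2}{p}| < \cos\theta$ and $B_a = 0$. Then \[ \bigl|\mathrm{Im}\,(A_p u, |u|^{p-2}\, u\, \mathbf{1}_{[u \neq 0]})\bigr| \le K\, \mathrm{Re}\,(A_p u, |u|^{p-2}\, u\, \mathbf{1}_{[u \neq 0]}) \] for all $u \in D(A_p)$, where \[ K = \begin{cases} \tan\bigl(\frac{\pi}{2} - \phi + \theta\bigr) & \text{if } R_a = 0, \\[2mm] \dfrac{\bigl(\frac{2}{\sin\phi} - 1\bigr)\tan\theta + \cot\phi}{1 - (\tan\theta)\cot\phi} & \text{if } R_a \neq 0, \end{cases} \] and $\phi = \arccos|1-\frac{2}{p}|$.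
   Context: $\Sigma_\theta = \{ r e^{i\beta} : r \ge 0 \text{ and } |\beta| \le \theta\} \subset \mathbb{C}$. On $\mathbb{C}^d$, $(\xi,\eta) = \sum_k \xi_k \overline{\eta_k}$. Write $C = R + iB$ where $R$ and $B$ are matrix functions with real entries; $R_a = \frac{R - R^T}{2}$ and $B_a = \frac{B - B^T}{2}$ are the anti-symmetric parts of $R$ and $B$. The conditions $B_a = 0$ and $R_a = 0$ mean that these matrix functions vanish identically on $\Omega$. For $f \in L_p(\Omega)$ and $g \in L_q(\Omega)$ with $\frac1p + \frac1q = 1$, $(f,g) = \int_\Omega f\,\overline{g}$. $\mathbf{1}_{[u\neq 0]}$ is the indicator function of $\{x : u(x) \neq 0\}$. All functions are complex-valued. *)

(* Defs.v *)
From HB Require Import structures.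
From mathcomp Require Import all_boot all_order all_algebra.
From mathcomp Require Import all_classical all_reals all_analysis.
From mathcomp Require Import complex.

Set Implicit Arguments.
Unset Strict Implicit.
Unset Printing Implicit Defensive.

Import Order.TTheory GRing.Theory Num.Theory.
Import numFieldNormedType.Exports.

Local Open Scope classical_set_scope.
Local Open Scope complex_scope.
Local Open Scope ring_scope.

Definition measure_rV_display : measure_display -> measure_display.
Proof. exact. Qed.

(* The product sigma-algebra, generated by the coordinates; over the real
   numbers it is the Borel sigma-algebra of R^n. *)
Section measurable_rV.
Context {d : measure_display} {T : sigmaRingType d}.
Variable n : nat.

Let coors : 'I_n -> 'rV[T]_n -> T := fun i x => x 0 i.

Let rV_set0 : g_sigma_preimage coors set0.
Proof. exact: sigma_algebra0. Qed.

Let rV_setC A : g_sigma_preimage coors A -> g_sigma_preimage coors (~` A).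
Proof. exact: sigma_algebraC. Qed.

Let rV_bigcup (F : _^nat) : (forall i, g_sigma_preimage coors (F i)) ->
  g_sigma_preimage coors (\bigcup_i (F i)).
Proof. exact: sigma_algebra_bigcup. Qed.

HB.instance Definition _ := @isMeasurable.Build (measure_rV_display d)
  'rV[T]_n (g_sigma_preimage coors) rV_set0 rV_setC rV_bigcup.

End measurable_rV.

Lemma measurable_fun_rV d d' (T1 : measurableType d) (T2 : measurableType d')
    n (f : T1 -> 'rV[T2]_n) :
  (forall i, measurable_fun [set: T1] (fun x => f x 0 i)) ->
  measurable_fun [set: T1] f.
Proof.
move=> mf; pose G := \big[setU/set0]_(i < n)
  preimage_set_system [set: 'rV[T2]_n] (fun x => x 0 i) measurable.
apply: (@measurability _ _ _ _ setT f G) => // A [B].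
rewrite /G -bigcup_seq => -[i _ [C mC <-]] <-.
by rewrite !setTI -[X in measurable X]setTI; exact: mf.
Qed.

Lemma measurable_coord_rV d (T : measurableType d) n (i : 'I_n) :
  measurable_fun [set: 'rV[T]_n] (fun x => x 0 i).
Proof.
move=> _ A mA; rewrite setTI; apply: sub_sigma_algebra.
rewrite -bigcup_seq; exists i => /=; first by rewrite mem_index_enum.
by exists A => //; rewrite setTI.
Qed.

Section lebesgue_rV.
Context {R : realType}.

Definition cons_rV n (z : R * 'rV[R]_n) : 'rV[R]_n.+1 :=
  row_mx (z.1%:M : 'M[R]_1) z.2.

Fixpoint lebesgue_rV n : set 'rV[R]_n -> \bar R :=
  match n with
  | 0 => \d_(0 : 'rV[R]_0)
  | m.+1 => pushforward (@lebesgue_measure R \x @lebesgue_rV m)%E (@cons_rV m)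
  end.

Lemma measurable_cons_rV n : measurable_fun [set: R * 'rV[R]_n] (@cons_rV n).
Proof.
apply: measurable_fun_rV => i; case: (@split_ordP 1 n i) => j ->.
  rewrite (_ : (fun _ => _) = fst); first exact: measurable_fst.
  by apply/funext => z; rewrite (row_mxEl (z.1%:M : 'M[R]_1)) mxE !ord1 eqxx.
rewrite (_ : (fun _ => _) = (fun x : 'rV[R]_n => x 0 j) \o snd).
  exact: measurableT_comp (measurable_coord_rV j) measurable_snd.
by apply/funext => z; rewrite (row_mxEr (z.1%:M : 'M[R]_1)).
Qed.

Definition uncons_rV n (x : 'rV[R]_n.+1) : R * 'rV[R]_n :=
  (x 0 0, \row_j x 0 (lift ord0 j)).

Lemma cons_rVK n : cancel (@cons_rV n) (@uncons_rV n).
Proof.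
move=> [t v]; rewrite /uncons_rV /cons_rV; congr pair.
  rewrite (_ : 0 = lshift n (0 : 'I_1)); last exact/val_inj.
  by rewrite (row_mxEl (t%:M : 'M[R]_1)) mxE eqxx.
apply/rowP => j; rewrite mxE (_ : lift ord0 j = rshift 1 j); last exact/val_inj.
by rewrite (row_mxEr (t%:M : 'M[R]_1)).
Qed.

Lemma measurable_uncons_rV n : measurable_fun [set: 'rV[R]_n.+1] (@uncons_rV n).
Proof.
apply/measurable_fun_pairP; split; first exact: (measurable_coord_rV 0).
apply: measurable_fun_rV => i.
rewrite [X in measurable_fun _ X](_ : _ =
  fun x : 'rV[R]_n.+1 => x 0 (lift ord0 i)).
  exact: measurable_coord_rV.
by apply/funext => x; rewrite /= mxE.
Qed.

Section step.
Variables (n : nat) (m : {sigma_finite_measure set 'rV[R]_n -> \bar R}).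

Let step : set 'rV[R]_n.+1 -> \bar R :=
  pushforward (@lebesgue_measure R \x m)%E (@cons_rV n).

Let mpre (A : set 'rV[R]_n.+1) : measurable A -> measurable (@cons_rV n @^-1` A).
Proof. by move=> mA; rewrite -[X in measurable X]setTI; exact: measurable_cons_rV. Qed.

Let step0 : step set0 = 0%E.
Proof. by rewrite /step /pushforward preimage_set0 measure0. Qed.

Let step_ge0 A : (0 <= step A)%E.
Proof. exact: (measure_ge0 (@lebesgue_measure R \x m)%E). Qed.

Let step_sigma_additive : semi_sigma_additive step.
Proof.
move=> F mF tF mUF; rewrite /step /pushforward preimage_bigcup.
apply: measure_semi_sigma_additive.
- by move=> k; exact: mpre.
- apply/trivIsetP => /= i j _ _ ij; rewrite -preimage_setI.
  by move/trivIsetP : tF => /(_ _ _ _ _ ij) ->//; rewrite preimage_set0.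
- by rewrite -preimage_bigcup; exact: mpre.
Qed.

HB.instance Definition _ := isMeasure.Build _ _ _ step
  step0 step_ge0 step_sigma_additive.

Let step_sigma_finite : sigma_finite setT step.
Proof.
have /sigma_finiteP[F [TF ndF Foo]] := sigma_finiteT (@lebesgue_measure R).
have /sigma_finiteP[G [TG ndG Goo]] := sigma_finiteT m.
exists (fun k => @uncons_rV n @^-1` (F k `*` G k)).
  apply/esym; rewrite -subTset => x _.
  have [k _ Fk] : (\bigcup_k F k) (uncons_rV x).1 by rewrite -TF.
  have [l _ Gl] : (\bigcup_k G k) (uncons_rV x).2 by rewrite -TG.
  exists (maxn k l) => //; split.
    by move: Fk; exact/subsetPset/ndF/leq_maxl.
  by move: Gl; exact/subsetPset/ndG/leq_maxr.
move=> k; have [mF Fk] := Foo k; have [mG Gk] := Goo k; split.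
  rewrite -[X in measurable X]setTI; apply: measurable_uncons_rV => //.
  exact: measurableX.
rewrite /step /pushforward -comp_preimage (_ : _ \o _ = id) ?preimage_id.
  by rewrite product_measure1E// lte_mul_pinfty// ge0_fin_numE.
by apply/funext => z; exact: cons_rVK.
Qed.

HB.instance Definition _ := Measure_isSigmaFinite.Build _ _ _ step
  step_sigma_finite.

Lemma lebesgue_rV_step :
  exists m' : {sigma_finite_measure set 'rV[R]_n.+1 -> \bar R},
    m' = pushforward (@lebesgue_measure R \x m)%E (@cons_rV n)
      :> (set 'rV[R]_n.+1 -> \bar R).
Proof. by exists step. Qed.

End step.

Let lebesgue_rV_measure n :
  exists m : {sigma_finite_measure set 'rV[R]_n -> \bar R},
    m = @lebesgue_rV n :> (set 'rV[R]_n -> \bar R).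
Proof.
elim: n => [|n [m mE]] /=; first by exists (\d_(0 : 'rV[R]_0)).
by rewrite -mE; exact: lebesgue_rV_step.
Qed.

Section instances.
Variable n : nat.

Let lebesgue_rV0 : @lebesgue_rV n set0 = 0%E.
Proof. by have [m <-] := lebesgue_rV_measure n; exact: measure0. Qed.

Let lebesgue_rV_ge0 A : (0 <= @lebesgue_rV n A)%E.
Proof. by have [m <-] := lebesgue_rV_measure n; exact: measure_ge0. Qed.

Let lebesgue_rV_sigma_additive : semi_sigma_additive (@lebesgue_rV n).
Proof.
have [m <-] := lebesgue_rV_measure n; exact: measure_semi_sigma_additive.
Qed.

HB.instance Definition _ := isMeasure.Build _ _ _ (@lebesgue_rV n)
  lebesgue_rV0 lebesgue_rV_ge0 lebesgue_rV_sigma_additive.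

Let lebesgue_rV_sigma_finite : sigma_finite setT (@lebesgue_rV n).
Proof. by have [m <-] := lebesgue_rV_measure n; exact: sigma_finiteT. Qed.

HB.instance Definition _ := Measure_isSigmaFinite.Build _ _ _ (@lebesgue_rV n)
  lebesgue_rV_sigma_finite.

End instances.

End lebesgue_rV.

Section complex_functions.
Context {R : realType} {n : nat}.
Local Notation mu := (@lebesgue_rV R n).
Implicit Types (D : set 'rV[R]_n) (f g u : 'rV[R]_n -> R[i]) (p : \bar R).

Definition cmodulus (z : R[i]) : R := Normc.normc z.

Definition cmeasurable D f :=
  measurable_fun D (fun x => complex.Re (f x)) /\
  measurable_fun D (fun x => complex.Im (f x)).

Definition cintegral D f : R[i] :=
  (\int[mu]_(x in D) complex.Re (f x)) +i* (\int[mu]_(x in D) complex.Im (f x)).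

Definition cpairing D f g : R[i] := cintegral D (fun x => f x * conjc (g x)).

(* [u] is cut off to 0 outside [D], so that only its values on [D] matter *)
Definition LpNorm D p u : \bar R :=
  'N[mu]_p [EFin \o ((cmodulus \o u) \_ D)].

Definition memLp D p u := cmeasurable D u /\ (LpNorm D p u < +oo)%E.

Definition memL1loc D u :=
  cmeasurable D u /\ forall K, compact K -> K `<=` D -> memLp K 1%E u.

End complex_functions.

Section sobolev.
Context {R : realType} {n : nat}.
Implicit Types (D : set 'rV[R]_n) (f : 'rV[R]_n -> R) (u v : 'rV[R]_n -> R[i]).

Definition partial (k : 'I_n) f : 'rV[R]_n -> R := 'D_(delta_mx 0 k) f.

(* differentiability of all iterated partial derivatives amounts to C^oo *)
Definition smooth f :=
  forall (s : seq 'I_n) x, differentiable (foldr partial f s) x.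

Definition test_function D f :=
  [/\ smooth f, compact (closure [set x | f x != 0]) &
      closure [set x | f x != 0] `<=` D].

Definition ctest_function D u :=
  test_function D (fun x => complex.Re (u x)) /\
  test_function D (fun x => complex.Im (u x)).

Definition is_weak_partial D k u v :=
  [/\ memL1loc D u, memL1loc D v &
      forall f, test_function D f ->
        cintegral D (fun x => u x * (partial k f x)%:C) =
        - cintegral D (fun x => v x * (f x)%:C)].

(* a weak derivative is unique up to a null set; we pick a representative, and
   return 0 when there is none *)
Definition weak_partial D k u : 'rV[R]_n -> R[i] :=
  xget (fun=> 0) [set v | is_weak_partial D k u v].

(* W^{m,p}(D): iterating over first-order weak derivatives reaches all weak
   derivatives of order at most m, mixed ones included *)
Fixpoint sobolev D (m : nat) (p : \bar R) u : Prop :=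
  memLp D p u /\
  match m with
  | 0 => True
  | m'.+1 => forall k, exists2 v, is_weak_partial D k u v & sobolev D m' p v
  end.

Definition W1pNorm D p u : \bar R :=
  (LpNorm D p u + \sum_(k < n) LpNorm D p (weak_partial D k u))%E.

(* W^{1,p}_0(D): the closure of C_c^oo(D) in W^{1,p}(D) *)
Definition sobolev0 D p u :=
  sobolev D 1 p u /\
  forall e : R, 0 < e ->
    exists2 w, ctest_function D w & (W1pNorm D p (u \- w)%R < e%:E)%E.

(* near each boundary point, after a rotation of the axes, [D] is the strict
   epigraph of a Lipschitz function of the coordinates other than the [j]-th *)
Definition lipschitz_boundary D :=
  forall z, (closure D `\` D°) z ->
    exists (Q : 'M[R]_n) (j : 'I_n) (g : 'rV[R]_n.-1 -> R^o),
      [/\ Q *m Q^T = 1%:M, lipschitz g &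
          \forall x \near z,
            D x <-> g (col' j (x *m Q)) < (x *m Q) 0 j].

End sobolev.

Section operator.
Context {R : realType}.

Definition sector (theta : R) : set R[i] :=
  [set z | exists r b : R, [/\ 0 <= r, `|b| <= theta &
     z = (r * cos b) +i* (r * sin b)]].

Context {d : nat}.
Implicit Types (Omega : set 'rV[R]_d) (C : 'rV[R]_d -> 'M[R[i]]_d)
  (u : 'rV[R]_d -> R[i]) (p : R).

Definition hinner (xi eta : 'cV[R[i]]_d) : R[i] :=
  \sum_k xi k 0 * conjc (eta k 0).

Definition antisym (M : 'M[R]_d) : 'M[R]_d := 2^-1 *: (M - M^T).

Definition Ra C x : 'M[R]_d := antisym (map_mx (@complex.Re R) (C x)).
Definition Ba C x : 'M[R]_d := antisym (map_mx (@complex.Im R) (C x)).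

Definition Ap_domain Omega p u :=
  sobolev Omega 2 p%:E u /\ sobolev0 Omega p%:E u.

Definition Ap Omega C u : 'rV[R]_d -> R[i] := fun x =>
  - \sum_k \sum_l
      weak_partial Omega l (fun y => C y k l * weak_partial Omega k u y) x.

Definition dual_fun p u : 'rV[R]_d -> R[i] := fun x =>
  (cmodulus (u x) `^ (p - 2))%:C * u x * (\1_[set y | u y != 0] x)%:C.

Definition cot (x : R) : R := cos x / sin x.

Definition phi_of p : R := acos `|1 - 2 / p|.

Definition sector_const Omega C (theta p : R) : R :=
  let phi := phi_of p in
  if `[< forall x, Omega x -> Ra C x = 0 >]
  then tan (pi / 2 - phi + theta)
  else ((2 / sin phi - 1) * tan theta + cot phi) / (1 - tan theta * cot phi).

End operator.

(* Main.v *)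
Require Import Defs.
From mathcomp Require Import all_boot all_order all_algebra.
From mathcomp Require Import all_classical all_reals all_analysis.
From mathcomp Require Import measurable_realfun ess_sup_inf simple_functions lebesgue_integral_under.
From mathcomp Require Import complex ring lra.

Set Implicit Arguments.
Unset Strict Implicit.
Unset Printing Implicit Defensive.

Import Order.TTheory GRing.Theory Num.Theory.
Import numFieldNormedType.Exports.

Local Open Scope classical_set_scope.
Local Open Scope ring_scope.

(** Write [g = |u|^(p-2) u].  Formally, an integration by parts turns the pairing
    of [A_p u] with [g] into the integral of
    [\sum_(k, l) c_kl (d_k u) conj (d_l g)], and the estimate already holds for
    this function pointwise.  Indeed, if [conj u d_k u = xi_k + i eta_k], then
    [|u|^2] times it is [|u|^(p-2)] times
    [\sum_(k, l) c_kl (xi_k + i eta_k) ((p - 1) xi_l - i eta_l)].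
    Put [x = sqrt (p - 1) xi], [a = (R x, x) + (R eta, eta)], [t = tan theta]
    and [kappa = cot phi].  Completing the form to the symmetric one in [x] and
    [eta] leaves cross terms, with coefficients bounded by [cot phi] and
    [1 / sin phi].  Since [B] is symmetric, the real part is at least
    [(1 - t kappa) a]; the absolute value of the imaginary part is at most
    [(t + kappa) a] if [R] is symmetric, and at most
    [((2 / sin phi - 1) t + kappa) a] in general ([form_re_ge], [form_im_sym],
    [form_im_gen]).  Dividing gives [K].

    To justify the integration by parts, the power is regularised to
    [(|u|^2 + e)^((p-2)/2) u] with [0 < e] if [p < 2], the function [u] in it is
    replaced by test functions [u_j] that tend to [u] in [W^{1,p}], and the field
    [c_kl d_k u conj g] is multiplied by a cutoff [X], the product of the factors
    [1 / (1 + (c s)^2)] over the real and imaginary parts [s] of the gradient of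
    [u].  The field then has bounded components and compact support, and the
    integral of its divergence vanishes ([flux_test]).  The test functions are
    chosen to converge so fast that they and their gradients have a majorant in
    [L_p] ([sobolev0_approx]), so that [j] can tend to infinity by dominated
    convergence ([flux_integral0]).  As [X] is positive, the terms in which [g]
    is differentiated keep the sign that they have pointwise.  Finally [c] and
    [e] tend to 0: the product of the gradient with the derivative of [X] is
    dominated by the second derivatives of [u] and tends to 0
    ([integral_flux_le0]).

    The product and chain rules used here rest on one fact, [rweak_strong]: the
    difference quotients of a weakly differentiable function converge to its weak
    derivative in mean on compact sets.  It is proved by duality with bump
    functions, the mean value theorem and the continuity of translations in
    mean.  For functions differentiable in this sense the product rule [strongM],
    the chain rule [strong_comp] and the vanishing of the integral of a
    derivative [strong_integral0] are direct. *)

(** * Translation invariance of Lebesgue measure *)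

Section measure_rV.
Context {R : realType}.
Local Notation mu := (@lebesgue_rV R _).

Lemma measurable_shift1 (a : R) :
  measurable_fun [set: measurableTypeR R] (fun t : measurableTypeR R => t + a : measurableTypeR R).
Proof. exact: measurable_funD. Qed.

Lemma lebesgue_measure_shift (a : R) (A : set R) : measurable A ->
  lebesgue_measure ((fun t => t + a) @^-1` A) = lebesgue_measure A.
Proof.
move=> mA; apply/esym.
pose m := measure_function_pushforward__canonical__measure_function_Measure
  (@lebesgue_measure R) (measurable_shift1 a).
rewrite (lebesgue_measure_unique (mu := m))//.
move=> X [[x y]] _ <-; rewrite /pushforward/=.
rewrite [RHS](_ : _ = lebesgue_measure `]x - a, y - a]%classic); last first.
  rewrite /m/= /pushforward; congr (lebesgue_measure _).
  by apply/seteqP; split => t /=; rewrite !in_itv/= ltrBlDr lerBrDr.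
rewrite !lebesgue_measure_itv/= !lte_fin ltrD2r; case: ifP => //= _.
by rewrite -!EFinD; congr EFin; ring.
Qed.

Lemma ge0_integral_shift1 (a : R) (f : R -> \bar R) : measurable_fun setT f ->
  (forall x, 0 <= f x)%E ->
  (\int[lebesgue_measure]_t f (t + a)%R = \int[lebesgue_measure]_t f t)%E.
Proof.
move=> mf f0.
have ms := measurable_shift1 a.
transitivity (\int[measure_function_pushforward__canonical__measure_function_Measure
     (@lebesgue_measure R) ms]_x f x)%E.
  have := @ge0_integral_pushforward _ _ _ _ R _ ms
    (@lebesgue_measure R) setT f measurableT mf (fun x _ => f0 x).
  by move=> ->.
by apply: eq_measure_integral => A mA _; exact: lebesgue_measure_shift.
Qed.

Lemma ge0_integral_pushforward_cons n (m : {sigma_finite_measure set 'rV[R]_n -> \bar R})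
    (m' : {measure set 'rV[R]_n.+1 -> \bar R}) (f : 'rV[R]_n.+1 -> \bar R) :
  (forall A, measurable A -> m' A = (@lebesgue_measure R \x m)%E (@cons_rV R n @^-1` A)) ->
  measurable_fun setT f -> (forall x, 0 <= f x)%E ->
  (\int[m']_x f x = \int[lebesgue_measure]_t \int[m]_y f (cons_rV (t, y)))%E.
Proof.
move=> mm' mf f0; have mc : measurable_fun [set: measurableTypeR R * 'rV[R]_n] (@cons_rV R n : measurableTypeR R * 'rV[R]_n -> _).
  exact: measurable_cons_rV.
transitivity (\int[(@lebesgue_measure R \x m)%E]_x (f \o @cons_rV R n) x)%E.
  transitivity (\int[measure_function_pushforward__canonical__measure_function_Measure
     (@lebesgue_measure R \x m)%E mc]_x f x)%E.
    by apply: eq_measure_integral => A mA _; exact: mm'.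
  have := @ge0_integral_pushforward _ _ _ _ R _ mc
    (@lebesgue_measure R \x m)%E setT f measurableT mf (fun x _ => f0 x).
  by move=> ->.
have mfc : measurable_fun [set: measurableTypeR R * 'rV[R]_n] (f \o @cons_rV R n : measurableTypeR R * 'rV[R]_n -> _).
  exact: (measurableT_comp mf mc).
exact: (fubini_tonelli1 _ mfc (fun x => f0 _)).
Qed.

Lemma ge0_integral_rVS n (f : 'rV[R]_n.+1 -> \bar R) : measurable_fun setT f ->
  (forall x, 0 <= f x)%E ->
  (\int[@lebesgue_rV R n.+1]_x f x =
   \int[lebesgue_measure]_t \int[@lebesgue_rV R n]_y f (cons_rV (t, y)))%E.
Proof. by move=> mf f0; exact: ge0_integral_pushforward_cons. Qed.

Lemma measurable_shift n (a : 'rV[R]_n) : measurable_fun [set: 'rV[R]_n] (fun x => x + a).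
Proof.
apply: measurable_fun_rV => i.
rewrite [X in measurable_fun _ X](_ : _ = (fun x : 'rV[R]_n => x 0 i + a 0 i)).
  by apply: measurable_funD => //; exact: measurable_coord_rV.
by apply/funext => x; rewrite mxE.
Qed.

Lemma cons_rV_shift n (t : R) (y : 'rV[R]_n) (a : 'rV[R]_n.+1) :
  cons_rV (t, y) + a = cons_rV (t + (uncons_rV a).1, y + (uncons_rV a).2).
Proof.
rewrite /cons_rV /=; apply/rowP => i; rewrite mxE; case: (@split_ordP 1 n i) => j ->.
  rewrite (row_mxEl (t%:M : 'M[R]_1)) (row_mxEl ((t + _)%:M : 'M[R]_1)) !mxE ord1.
  by rewrite !eqxx !mulr1n; congr (_ + a _ _); exact/val_inj.
rewrite (row_mxEr (t%:M : 'M[R]_1)) (row_mxEr ((t + _)%:M : 'M[R]_1)) !mxE.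
by congr (_ + a _ _); exact/val_inj.
Qed.

(** By induction on the dimension: Tonelli's theorem splits a translation into
    one of the first coordinate and one of the others. *)
Lemma ge0_integral_shift n (a : 'rV[R]_n) (f : 'rV[R]_n -> \bar R) :
  measurable_fun setT f -> (forall x, 0 <= f x)%E ->
  (\int[mu]_x f (x + a)%R = \int[mu]_x f x)%E.
Proof.
elim: n a f => [|n ih] a f mf f0.
  by apply: eq_integral => x _; congr f; apply/rowP => -[].
have mfs : measurable_fun setT (fun x : 'rV[R]_n.+1 => f (x + a)).
  exact: measurableT_comp mf (@measurable_shift _ a).
rewrite (ge0_integral_rVS mfs (fun x => f0 _)) (ge0_integral_rVS mf f0).
transitivity (\int[lebesgue_measure]_t
   \int[@lebesgue_rV R n]_y f (cons_rV ((t + (uncons_rV a).1)%R, y)))%E.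
  apply: eq_integral => t _.
  rewrite -(ih (uncons_rV a).2 (fun y : 'rV[R]_n => f (cons_rV ((t + (uncons_rV a).1)%R, y))))//.
    by apply: eq_integral => y _; rewrite cons_rV_shift.
  apply: measurableT_comp mf _ => //.
  exact: measurableT_comp (@measurable_cons_rV R n) (measurable_pair1 _).
apply: (@ge0_integral_shift1 (uncons_rV a).1 (fun t : R => \int[@lebesgue_rV R n]_y f (cons_rV (t, y)))%E).
  have mfc : measurable_fun [set: measurableTypeR R * 'rV[R]_n]
      (f \o @cons_rV R n : measurableTypeR R * 'rV[R]_n -> _).
    exact: (measurableT_comp mf (@measurable_cons_rV R n)).
  exact: (measurable_fun_fubini_tonelli_F _ mfc (fun x => f0 _)).
by move=> t; exact: integral_ge0.
Qed.

Lemma ball_rVP n (x : 'rV[R]_n) (r : R) (y : 'rV[R]_n) : 0 < r ->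
  ball x r y <-> forall i, `|x 0 i - y 0 i| < r.
Proof.
move=> r0; split.
  by move=> [_ h] i; have := h 0 i; rewrite /ball/= /ball_.
by move=> h; split => // i j; rewrite ord1; exact: h.
Qed.

Lemma measurable_ball_rV n (x : 'rV[R]_n) r : measurable (ball x r).
Proof.
have [r0|r0] := ltP 0 r; last first.
  rewrite (_ : ball x r = set0)//; apply/seteqP; split => // y [r1].
  by move: (lt_le_trans r1 r0); rewrite ltxx.
rewrite (_ : ball x r = \bigcap_(i in [set: 'I_n]) (fun y : 'rV[R]_n => y 0 i) @^-1` ball (x 0 i) r).
  apply: fin_bigcap_measurable => // i _; rewrite -[X in measurable X]setTI.
  by apply: measurable_coord_rV => //; exact: measurable_ball.
apply/seteqP; split => y.
  by move/(ball_rVP _ _ r0) => h i _; exact: h.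
by move=> h; apply/(ball_rVP _ _ r0) => i; exact: (h i).
Qed.

Lemma cons_rV0 n (t : R) (y : 'rV[R]_n) : cons_rV (t, y) 0 0 = t.
Proof. by have /(congr1 fst) := cons_rVK (t, y). Qed.

Lemma cons_rV_lift n (t : R) (y : 'rV[R]_n) j : cons_rV (t, y) 0 (lift ord0 j) = y 0 j.
Proof. by have /(congr1 snd)/rowP/(_ j) := cons_rVK (t, y); rewrite mxE. Qed.

Lemma mu_ball_rV n (x : 'rV[R]_n) r : (mu (ball x r) < +oo)%E.
Proof.
have [r0|r0] := ltP 0 r; last first.
  rewrite (_ : ball x r = set0) ?measure0//; apply/seteqP; split => // y [r1].
  by move: (lt_le_trans r1 r0); rewrite ltxx.
elim: n x => [|n ih] x.
  by rewrite /lebesgue_rV diracE; case: (_ \in _); rewrite ltry.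
rewrite (_ : mu (ball x r) = (@lebesgue_measure R \x @lebesgue_rV R n)%E
   (ball (uncons_rV x).1 r `*` ball (uncons_rV x).2 r)).
  rewrite product_measure1E; [|exact: measurable_ball|exact: measurable_ball_rV].
  apply: lte_mul_pinfty => //; last exact: ih.
    have := @lebesgue_measure_ball R (uncons_rV x).1 r (ltW r0).
  by move=> /= ->.
rewrite /= /pushforward; congr ((_ \x _)%E _).
apply/seteqP; split => -[t y] /=.
  move/(ball_rVP _ _ r0) => h; split; first by have := h 0; rewrite cons_rV0.
  by apply/(ball_rVP _ _ r0) => i; have := h (lift ord0 i); rewrite cons_rV_lift mxE.
move=> [h1 /(ball_rVP _ _ r0) h2]; apply/(ball_rVP _ _ r0) => i.
case: (unliftP ord0 i) => [j|] ->; last by rewrite cons_rV0.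
by have := h2 j; rewrite mxE cons_rV_lift.
Qed.

End measure_rV.

(** * Cubes, compact sets and open sets *)

Section topology_rV.
Context {R : realType} {n : nat}.
Local Notation T := 'rV[R]_n.
Local Notation mu := (@lebesgue_rV R n).
Implicit Types (D K : set T) (x y : T) (r : R).

Definition cball x r : set T := [set y | `|x - y| <= r].

Lemma cball_closed x r : closed (cball x r).
Proof. exact: closed_closed_ball_. Qed.

Lemma cball_compact x r : compact (cball x r).
Proof.
apply: bounded_closed_compact; last exact: cball_closed.
exists (`|x| + r); split; first exact: num_real.
move=> M lt_M y xy; apply: le_trans (ltW lt_M).
by rewrite -[y](subKr x) (le_trans (ler_normB _ _))// lerD2l.
Qed.

Lemma sub_ball_cball x r : ball x r `<=` cball x r.
Proof. by move=> y; rewrite mx_norm_ball => /ltW. Qed.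

Lemma sub_cball_ball x r s : r < s -> cball x r `<=` ball x s.
Proof. by move=> rs y /= xy; rewrite mx_norm_ball; exact: le_lt_trans xy rs. Qed.

Lemma sub_cball x y r s : `|x - y| + s <= r -> cball y s `<=` cball x r.
Proof.
move=> h z /= yz; apply: le_trans h; rewrite -(subrKA y) (le_trans (ler_normD _ _))//.
by rewrite lerD2l.
Qed.

Lemma open_cball D x : open D -> D x -> exists2 r, 0 < r & cball x r `<=` D.
Proof.
move=> oD Dx; have /nbhs_ballP[e e0 he] := open_nbhs_nbhs (conj oD Dx).
exists (e / 2); first by rewrite divr_gt0//.
apply: subset_trans he; apply: sub_cball_ball; rewrite ltr_pdivrMr//.
by rewrite ltr_pMr// ltr1n.
Qed.

Lemma rat_rV_approx x r : 0 < r ->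
  exists q : 'rV[rat]_n, `|x - map_mx ratr q| < r.
Proof.
move=> r0; have h i : exists q : rat, ratr q \in `](x 0 i - r), (x 0 i + r)[.
  by apply: rat_in_itvoo; rewrite ltrD2l gtrN.
have [q hq] := choice h; exists (\row_i q i).
have : ball x r (map_mx ratr (\row_i q i)).
  apply/(ball_rVP _ _ r0) => i; rewrite !mxE.
  by have := hq i; rewrite in_itv/= => /andP[? ?]; rewrite ltr_norml; apply/andP; split; lra.
by rewrite mx_norm_ball.
Qed.

(** The sigma-algebra is generated by the coordinates, so that open sets are
    measurable because countably many cubes suffice.  The doubled cubes are
    compact subsets of [D], on which local integrability can be used. *)
Lemma open_cubes D : open D ->
  exists (c : nat -> T) (r : nat -> R),
    (forall k, 0 < r k -> cball (c k) (2 * r k) `<=` D) /\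
    D = \bigcup_k ball (c k) (r k).
Proof.
move=> oD.
pose I := ('rV[rat]_n * rat)%type.
pose good (i : I) := 0 < i.2 /\ cball (map_mx ratr i.1) (2 * ratr i.2) `<=` D.
pose g (k : nat) : option I := if (unpickle k : option I) is Some i then
  if `[< good i >] then Some i else None else None.
exists (fun k => if g k is Some i then map_mx ratr i.1 else 0).
exists (fun k => if g k is Some i then ratr i.2 else 0); split.
  move=> k; rewrite /g; case: unpickle => [i|]; last by rewrite ltxx.
  by case: asboolP => [[]|]; rewrite ?ltxx.
apply/seteqP; split => [x Dx|x [k _]]; last first.
  rewrite /g; case: unpickle => [i|]; last by move=> /= -[]; rewrite ltxx.
  case: asboolP => [[i0 h] xi|_]; last by move=> /= -[]; rewrite ltxx.
  apply: h; apply: sub_ball_cball; apply: le_ball xi.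
  by rewrite ler_peMl ?ler1n// ler0q ltW.
have [e e0 he] := open_cball oD Dx.
have [s] : exists s : rat, ratr s \in `]0, (e / 3)[.
  by apply: rat_in_itvoo; rewrite divr_gt0.
rewrite in_itv/= => /andP[s0 se].
have [q hq] := rat_rV_approx x s0.
exists (pickle ((q, s) : I)) => //; rewrite /g pickleK asboolT/=.
  by rewrite mx_norm_ball /ball_/= distrC.
split; first by rewrite -(@ltr0q R).
apply: subset_trans he; apply: sub_cball => /=.
move: hq se; move: (ratr s : R) => t hq; rewrite ltr_pdivlMr// => te.
by lra.
Qed.

Lemma open_measurable_rV D : open D -> measurable D.
Proof.
move=> /open_cubes[c [r [_ ->]]]; apply: bigcup_measurable => k _.
exact: measurable_ball_rV.
Qed.

Lemma closed_measurable_rV D : closed D -> measurable D.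
Proof.
by move=> cD; rewrite -(setCK D); apply: measurableC; apply: open_measurable_rV; exact: closed_openC.
Qed.

Lemma compact_measurable_rV K : compact K -> measurable K.
Proof. by move/(compact_closed (@norm_hausdorff _ _)); exact: closed_measurable_rV. Qed.

Lemma compact_mu_lty K : compact K -> (mu K < +oo)%E.
Proof.
move=> cK; have [M [Mr hM]] := compact_bounded cK.
apply: (@le_lt_trans _ _ (mu (ball 0 (M + 2)))); last exact: mu_ball_rV.
apply: le_measure; rewrite ?inE.
- exact: compact_measurable_rV.
- exact: measurable_ball_rV.
- move=> x Kx; rewrite mx_norm_ball /ball_/= sub0r normrN.
  by apply: (@le_lt_trans _ _ (M + 1)); [apply: hM Kx; rewrite ltrDl|rewrite ltrD2l ltr1n].
Qed.

Lemma compact_in_open K D : compact K -> open D -> K `<=` D ->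
  exists2 e, 0 < e & forall x, K x -> cball x e `<=` D.
Proof.
move=> cK oD KD.
have near_in : \forall e \near 0^'+, K `<=` (fun x => cball x e `<=` D).
  apply: ((compact_near_coveringP K).1 cK R (0^'+) (fun e x => cball x e `<=` D)).
  move=> x Kx; have [e e0 he] := open_cball oD (KD _ Kx).
  exists (ball x (e / 2), [set s | s < e / 2]) => /=.
    split; first by apply: nbhsx_ballx; rewrite divr_gt0.
    by apply: nbhs_right_lt; rewrite divr_gt0.
  move=> [y s]/= [xy se]; apply: subset_trans he; apply: sub_cball.
  by move: xy; rewrite mx_norm_ball /ball_/= => ?; lra.
have [e [e0 he]] := filter_ex (filterI (nbhs_right_gt 0) near_in).
by exists e.
Qed.

Definition thicken K e : set T := [set y | exists2 x, K x & `|x - y| <= e].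

Lemma thicken_compact K e : compact K -> compact (thicken K e).
Proof.
move=> cK.
rewrite (_ : thicken K e = (fun z : T * T => z.1 + z.2) @` (K `*` cball 0 e)).
  apply: continuous_compact; last by apply: compact_setX => //; exact: cball_compact.
  by apply: continuous_subspaceT => z; exact: add_continuous.
apply/seteqP; split => [y [x Kx xy]|y [[x z] [/= Kx]]].
  exists (x, y - x); last by rewrite /= addrC subrK.
  by split => //=; rewrite /cball/= sub0r normrN distrC.
rewrite /cball/= sub0r normrN => ze <-; exists x => //.
by rewrite opprD addNKr normrN.
Qed.

Lemma compact_nbhd K D : compact K -> open D -> K `<=` D ->
  exists2 e, 0 < e & compact (thicken K e) /\ thicken K e `<=` D.
Proof.
move=> cK oD KD; have [e e0 he] := compact_in_open cK oD KD.
exists e => //; split; first exact: thicken_compact.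
by move=> y [x Kx xy]; exact: (he x).
Qed.

(** Compactness as an induction principle, which reduces statements on compact
    sets to statements on small balls. *)
Lemma compact_ball_ind (P : set T -> Prop) K D : compact K -> K `<=` D ->
  P set0 -> (forall A B, P A -> P B -> P (A `|` B)) ->
  (forall x, D x -> exists2 r, 0 < r & P (ball x r)) ->
  exists2 A, K `<=` A & P A.
Proof.
move=> cK KD P0 PU hP.
have h x : exists r, D x -> 0 < r /\ P (ball x r).
  have [Dx|nDx] := pselect (D x); last by exists 0.
  by have [r r0 Pr] := hP x Dx; exists r.
have [r hr] := choice h.
move: cK; rewrite compact_cover => /(_ T K (fun x => ball x (r x))).
case=> [x Kx|x Kx|A AK KA].
- by apply: ball_open; have [] := hr x (KD _ Kx).
- by exists x => //; apply: ballxx; have [] := hr x (KD _ Kx).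
eexists; first exact: KA.
rewrite /cover bigcup_fset big_seq; elim/big_ind : _ => // i iA.
by have /set_mem/KD/hr[] := AK _ iA.
Qed.

End topology_rV.

(** * Smooth functions *)

Section smooth_functions.
Context {R : realType} {n : nat}.
Local Notation T := 'rV[R]_n.
Implicit Types (f g : T -> R) (k : 'I_n).

(** Smoothness quantifies over all iterated partial derivatives; exhibiting a
    class of functions closed under partial derivatives replaces an induction
    on lists of indices. *)
Lemma smooth_coind (S : set (T -> R)) :
  (forall f, S f -> (forall x, differentiable f x) /\ forall k, S (partial k f)) ->
  forall f, S f -> smooth f.
Proof.
move=> hS f Sf s x; have : S (foldr (@partial R n) f s).
  by elim: s => //= k s /hS[].
by case/hS.
Qed.

Lemma smooth_differentiable f x : smooth f -> differentiable f x.
Proof. by move=> /(_ [::] x). Qed.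

Lemma smooth_partial f k : smooth f -> smooth (partial k f).
Proof. by move=> sf s x; have := sf (rcons s k) x; rewrite foldr_rcons. Qed.

Lemma partialD f g k : (forall x, differentiable f x) -> (forall x, differentiable g x) ->
  partial k (fun x => f x + g x) = (fun x => partial k f x + partial k g x).
Proof.
move=> df dg; apply/funext => x; rewrite /partial.
exact: (@deriveD _ _ _ f g x _ (diff_derivable (df x)) (diff_derivable (dg x))).
Qed.

Lemma partialM f g k : (forall x, differentiable f x) -> (forall x, differentiable g x) ->
  partial k (fun x => f x * g x) = (fun x => f x * partial k g x + g x * partial k f x).
Proof.
move=> df dg; apply/funext => x; rewrite /partial.
exact: (@deriveM _ _ f g x _ (diff_derivable (df x)) (diff_derivable (dg x))).
Qed.

(** The derivative of a product is a sum of products, so that products are not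
    closed under derivatives, whereas this class is. *)
Inductive smooth_alg : (T -> R) -> Prop :=
| smooth_alg_base f : smooth f -> smooth_alg f
| smooth_algD f g : smooth_alg f -> smooth_alg g -> smooth_alg (fun x => f x + g x)
| smooth_algM f g : smooth_alg f -> smooth_alg g -> smooth_alg (fun x => f x * g x).

Lemma smooth_alg_smooth f : smooth_alg f -> smooth f.
Proof.
apply: smooth_coind => {}f.
elim=> {f} [f sf|f g sf [df pf] sg [dg pg]|f g sf [df pf] sg [dg pg]].
- split=> [x|k]; first exact: smooth_differentiable.
  by apply: smooth_alg_base; exact: smooth_partial.
- split=> [x|k]; first exact: (differentiableD (df x) (dg x)).
  by rewrite (partialD _ df dg); exact: smooth_algD.
- split=> [x|k]; first exact: (differentiableM (df x) (dg x)).
  by rewrite (partialM _ df dg); apply: smooth_algD; exact: smooth_algM.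
Qed.

Lemma smoothD f g : smooth f -> smooth g -> smooth (fun x => f x + g x).
Proof.
by move=> sf sg; apply: smooth_alg_smooth; apply: smooth_algD; exact: smooth_alg_base.
Qed.

Lemma smoothM f g : smooth f -> smooth g -> smooth (fun x => f x * g x).
Proof.
by move=> sf sg; apply: smooth_alg_smooth; apply: smooth_algM; exact: smooth_alg_base.
Qed.

Lemma smooth_cst (c : R) : smooth (fun _ : T => c).
Proof.
apply: (@smooth_coind [set f | exists c, f = cst c]); last by exists c.
move=> _ [{}c ->]; split => [x|k]; first exact: differentiable_cst.
by exists 0; apply/funext => x; rewrite /partial derive_cst.
Qed.

Lemma smooth_prod (I : Type) (s : seq I) (F : I -> T -> R) :
  (forall i, smooth (F i)) -> smooth (fun x => \prod_(i <- s) F i x).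
Proof.
move=> sF; elim: s => [|i s ih].
  by under eq_fun do rewrite big_nil; exact: smooth_cst.
by under eq_fun do rewrite big_cons; exact: smoothM.
Qed.

Lemma smoothB1 f : smooth f -> smooth (fun x => 1 - f x).
Proof.
move=> sf; rewrite (_ : (fun _ => _) = (fun x => 1 + (-1) * f x)).
  by apply: smoothD; [exact: smooth_cst|apply: smoothM => //; exact: smooth_cst].
by apply/funext => x; rewrite mulN1r.
Qed.

Lemma derivable_line f (a v : T) (s : R) : derivable f (a + s *: v) v ->
  is_derive (s : R) 1 (fun t : R => f (a + t *: v)) ('D_v f (a + s *: v)).
Proof.
rewrite /derivable /derive.
have e : (fun h : R => h^-1 *: (f (h *: v + (a + s *: v)) - f (a + s *: v))) =
   (fun h : R => h^-1 *: (f (a + (h *: 1 + s) *: v) - f (a + s *: v))).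
  by apply/funext => h; rewrite scaler1 scalerDl addrCA.
by move=> h; split; rewrite /derivable /derive -e.
Qed.

Lemma is_derive_line f (a v : T) (s : R) : differentiable f (a + s *: v) ->
  is_derive (s : R) 1 (fun t : R => f (a + t *: v)) ('D_v f (a + s *: v)).
Proof. by move=> df; apply: derivable_line; exact: diff_derivable. Qed.

Lemma smooth_shift f (a : T) : smooth f -> smooth (fun x => f (x + a)).
Proof.
move=> sf; apply: (@smooth_coind [set g | exists2 f, smooth f & g = fun x => f (x + a)]).
  move=> _ [{sf}f sf ->]; split => [x|k].
    have dsh : differentiable (fun x : T => x + a) x by exact: differentiableD.
    exact: (differentiable_comp dsh (smooth_differentiable _ sf)).
  exists (partial k f); first exact: smooth_partial.
  apply/funext => x; rewrite /partial /derive /=.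
  by under [in LHS]eq_fun do rewrite -addrA.
by exists f.
Qed.

Lemma is_derive_coord (x v : T) i : is_derive x v (fun y : T => y 0 i) (v 0 i).
Proof.
have dc : derivable (fun y : T => y 0 i : R) x v.
  exact/diff_derivable/differentiable_coord.
split => //; rewrite /derive; apply: cvg_lim => //.
apply: cvg_near_cst; near=> h.
rewrite /= !mxE addrK /GRing.scale/= mulKf//; near: h; exact: nbhs_dnbhs_neq.
Unshelve. all: by end_near. Qed.

Lemma partial_comp_coord (phi phi' : R -> R) (s b : R) (i k : 'I_n) :
  (forall t : R, is_derive t (1 : R) phi (phi' t)) ->
  (forall x, differentiable (fun x : T => phi (s * x 0 i + b)) x) /\
  partial k (fun x : T => phi (s * x 0 i + b)) =
  (fun x => (s * (i == k)%:R) * phi' (s * x 0 i + b)).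
Proof.
move=> dphi.
have dg (x : T) : differentiable (fun x : T => s * x 0 i + b) x.
  apply: differentiableD => //; apply: differentiableM => //.
  exact: differentiable_coord.
have df (t : R) : differentiable phi t by apply/derivable1_diffP; have [] := dphi t.
split=> [x|]; first exact: (differentiable_comp (dg x) (df _)).
apply/funext => x; rewrite /partial deriveE; last exact: (differentiable_comp (dg x) (df _)).
rewrite (diff_comp (dg x) (df _)) /= deriv1E; last by have [] := dphi (s * x 0 i + b).
rewrite derive1E (@derive_val _ _ _ _ _ _ _ (dphi _)) -deriveE//.
have := is_derive_coord x (delta_mx 0 k) i => dc.
have dsc : is_derive x (delta_mx 0 k) (fun x : T => s * x 0 i + b) (s * (i == k)%:R).
  rewrite (_ : s * (i == k)%:R = s *: ((delta_mx 0 k : T) 0 i) + 0).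
    by apply: is_deriveD.
  by rewrite mxE eqxx addr0.
by rewrite (@derive_val _ _ _ _ _ _ _ dsc).
Qed.

End smooth_functions.

Section flat_function.
Context {R : realType}.
Variable e : R.
Hypothesis e0 : 0 < e.

(** The function [t^-m exp (-e/t)] for [0 < t]; the derivative of each is a
    combination of two others, so that together they are closed under
    derivatives. *)
Definition hexp (m : nat) (t : R) := if 0 < t then t^-1 ^+ m * expR (- (e / t)) else 0.

Lemma hexp_ge0 m t : 0 <= hexp m t.
Proof. by rewrite /hexp; case: ifP => // t0; rewrite mulr_ge0 ?expR_ge0// exprn_ge0// invr_ge0 ltW. Qed.

Lemma hexp0_le1 t : hexp 0 t <= 1.
Proof.
rewrite /hexp; case: ifP => // t0; rewrite expr0 mul1r -[leRHS]expR0 ler_expR oppr_le0.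
by rewrite divr_ge0 ?ltW.
Qed.

(** Quadratic decay at 0 gives a zero derivative there. *)
Lemma hexp_small m : exists C, forall t, hexp m t <= C * t ^+ 2.
Proof.
exists ((m.+2)`!%:R / e ^+ m.+2) => t; rewrite /hexp; case: ifP => t0; last first.
  by rewrite mulr_ge0 ?sqr_ge0// divr_ge0// exprn_ge0// ltW.
have et : 0 <= e / t by rewrite divr_ge0 ?ltW.
have h : (e / t) ^+ m.+2 / (m.+2)`!%:R <= expR (e / t).
  by apply: le_trans (expR_ge1Dxn m.+1 et); rewrite lerDr.
rewrite expRN -(@ler_pM2r _ (expR (e / t))) ?expR_gt0// mulfVK ?gt_eqF ?expR_gt0//.
apply: le_trans (ler_wpM2l _ h); last first.
  by rewrite mulr_ge0 ?sqr_ge0// divr_ge0// exprn_ge0// ltW.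
rewrite exprMn !exprVn (exprS t m.+1) (exprS t m).
have tn : t != 0 by rewrite gt_eqF.
have un : t ^+ m != 0 by rewrite expf_neq0.
have en : e ^+ m.+2 != 0 by rewrite expf_neq0// gt_eqF.
have fn : (m.+2)`!%:R != 0 :> R by rewrite pnatr_eq0 -lt0n fact_gt0.
rewrite le_eqVlt; apply/orP; left; apply/eqP.
move: un en fn; move: (t ^+ m) (e ^+ m.+2) (_%:R) => u v w un en fn.
by field; rewrite tn un en fn.
Qed.

Lemma is_derive_hexp m t :
  is_derive (t : R) (1 : R) (hexp m) (e * hexp m.+2 t - m%:R * hexp m.+1 t).
Proof.
have [t0|t0|t0] := ltgtP t 0.
- apply: (@near_eq_is_derive _ _ _ (cst 0)).
    near=> s; rewrite /hexp ltNge ltW//.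
    by near: s; exact: lt_nbhsl.
  rewrite /hexp !ltNge (ltW t0)/= !mulr0 subr0; exact: is_derive_cst.
- apply: (@near_eq_is_derive _ _ _ (fun t : R => t^-1 ^+ m * expR (- (e * t^-1)))).
    by near=> s; rewrite /hexp (_ : 0 < s)//; near: s; exact: lt_nbhsr.
  have tn : t != 0 by rewrite gt_eqF.
  have dV : is_derive (t : R) (1 : R) (fun t : R => t^-1) (- t^-1 ^+ 2).
    have di := @is_derive_id R R t 1.
    split; first by apply: (@derivableV _ _ id) => //; have [] := di.
    by rewrite (@deriveV _ _ id)// derive_val /GRing.scale/= mulr1 exprVn.
  pose i := fun t : R => t^-1.
  have dX : is_derive (t : R) (1 : R) (i ^+ m) ((m%:R * i t ^+ m.-1) *: (- t^-1 ^+ 2)).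
    exact: is_deriveX.
  have dE : is_derive (t : R) (1 : R) (expR \o (fun t : R => - (e * i t)))
      (expR (- (e * t^-1)) * - (e * - t^-1 ^+ 2)).
    exact: (is_derive1_comp (is_derive_expR _) (is_deriveN (is_deriveZ e dV))).
  have := is_deriveM dX dE.
  rewrite (_ : _ * _ = (fun t0 : R => t0^-1 ^+ m * expR (- (e * t0^-1)))); last first.
    by apply/funext => s; rewrite /GRing.mul/= fctE.
  move=> H; apply: (is_derive_eq H).
  rewrite /hexp t0 /= /GRing.scale/= fctE /i.
  case: (m) => [|k] /=.
    by rewrite !expr0 !mul0r; ring.
  rewrite !exprS; ring.
- rewrite t0 /hexp !ltxx !mulr0 subr0.
  have [C hC] := hexp_small m.
  have dlim : (fun h : R => h^-1 *: (hexp m (h *: 1 + 0) - hexp m 0)) @ 0^' --> 0.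
    apply/cvgrPdist_lt => /= eps eps0; near=> h.
    rewrite sub0r normrN scaler1 addr0 {2}/hexp ltxx subr0 /GRing.scale/= normrM.
    have h0 : h != 0 by near: h; exact: nbhs_dnbhs_neq.
    rewrite normfV ger0_norm ?hexp_ge0// ltr_pdivrMl ?normr_gt0//.
    apply: (le_lt_trans (hC h)).
    apply: (@le_lt_trans _ _ (`|h| * (`|C| * `|h|))).
      rewrite [leRHS]mulrCA -[in leRHS]expr2 real_normK ?num_real//.
      by rewrite ler_wpM2r ?sqr_ge0// ler_norm.
    rewrite ltr_pM2l ?normr_gt0//.
    apply: (@le_lt_trans _ _ ((`|C| + 1) * `|h|)); first by rewrite ler_wpM2r// lerDl.
    rewrite -ltr_pdivlMl ?ltr_wpDl//; near: h; apply: dnbhs0_lt.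
    by rewrite mulr_gt0// invr_gt0 ltr_wpDl.
  split; first by rewrite /derivable; apply/cvg_ex; exists 0.
  by rewrite /derive; apply: cvg_lim => //.
Unshelve. all: by end_near. Qed.

End flat_function.

(** * Bump functions *)

Section bumps.
Context {R : realType} {n : nat}.
Local Notation T := 'rV[R]_n.
Local Notation mu := (@lebesgue_rV R n).
Implicit Types (i k : 'I_n).

(** A class closed under partial derivatives, as needed for [smooth_coind]. *)
Inductive hspan (e s b : R) i : (T -> R) -> Prop :=
| hspan0 : hspan e s b i (fun _ => 0)
| hspan_lin (c : R) m g : hspan e s b i g ->
    hspan e s b i (fun x : T => c * hexp e m (s * x 0 i + b) + g x).

Lemma hspanD e s b i f g : hspan e s b i f -> hspan e s b i g ->
  hspan e s b i (fun x : T => f x + g x).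
Proof.
move=> hf hg; elim: hf => {f} [|c m f hf ih].
  by rewrite (_ : (fun _ => _) = g)//; apply/funext => x; rewrite add0r.
rewrite (_ : (fun _ => _) = (fun x : T => c * hexp e m (s * x 0 i + b) + (f x + g x))).
  exact: hspan_lin.
by apply/funext => x; rewrite addrA.
Qed.

Lemma smooth_hexp (e s b : R) i : 0 < e ->
  smooth (fun x : T => hexp e 0 (s * x 0 i + b)).
Proof.
move=> e0; apply: (@smooth_coind _ _ (hspan e s b i)); last first.
  rewrite (_ : (fun _ => _) = (fun x : T => 1 * hexp e 0 (s * x 0 i + b) + 0)).
    by apply: hspan_lin; exact: hspan0.
  by apply/funext => x; rewrite mul1r addr0.
move=> f; elim=> {f} [|c m g hg [dg pg]].
  split => [x|k]; first exact: differentiable_cst.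
  rewrite (_ : partial _ _ = (fun _ => 0)); first exact: hspan0.
  by apply/funext => x; rewrite /partial derive_cst.
have [dh _] := partial_comp_coord s b i i (is_derive_hexp e0 m).
have dch x : differentiable (fun x : T => c * hexp e m (s * x 0 i + b)) x.
  by apply: differentiableM => //; exact: differentiable_cst.
split => [x|k]; first exact: (differentiableD (dch x) (dg x)).
rewrite (partialD _ dch dg); apply: hspanD => //.
rewrite (@partialM _ _ (fun _ : T => c) _ k (fun x : T => differentiable_cst c x) dh).
have [_ ->] := partial_comp_coord s b i k (is_derive_hexp e0 m).
rewrite [X in hspan _ _ _ _ X](_ : _ = (fun x : T => (c * (s * (i == k)%:R) * e) * hexp e m.+2 (s * x 0 i + b) +
    (- (c * (s * (i == k)%:R) * m%:R) * hexp e m.+1 (s * x 0 i + b) + 0))).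
  by apply: hspan_lin; apply: hspan_lin; exact: hspan0.
apply/funext => x; rewrite /partial (_ : (fun=> c) = cst c)// derive_cst; ring.
Qed.

Definition bump_in (c : T) (r : R) (eta : T -> R) :=
  [/\ smooth eta, forall x, 0 <= eta x <= 1 & forall x, ~ ball c r x -> eta x = 0].

(** A product of one flat function per face of the cube; it converges to the
    indicator function of the cube as [e] tends to 0. *)
Definition box_bump (c : T) (r : R) (e : R) (x : T) : R :=
  \prod_(i < n) (hexp e 0 (1 * x 0 i + (r - c 0 i)) * hexp e 0 ((-1) * x 0 i + (r + c 0 i))).

Lemma hexp0_out (e t : R) : t <= 0 -> hexp e 0 t = 0.
Proof. by move=> t0; rewrite /hexp ltNge t0. Qed.

Lemma hexp0_cvg (t : R) : 0 < t -> hexp j.+1%:R^-1 0 t @[j --> \oo] --> (1 : R).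
Proof.
move=> t0; rewrite /hexp t0.
rewrite (_ : (fun _ => _) = (fun j => expR (- (j.+1%:R^-1 / t)))); last first.
  by apply/funext => j; rewrite expr0 mul1r.
rewrite -[X in _ --> X]expR0; apply: continuous_cvg; first exact: continuous_expR.
rewrite -oppr0; apply: cvgN; rewrite -(mul0r t^-1); apply: cvgMl.
exact: cvg_harmonic.
Qed.

Lemma box_bump_in (c : T) (r e : R) : 0 < r -> 0 < e -> bump_in c r (box_bump c r e).
Proof.
move=> r0 e0; split.
- by apply: smooth_prod => i; apply: smoothM; exact: smooth_hexp.
- move=> x; apply/andP; split.
    by apply: prodr_ge0 => i _; rewrite mulr_ge0// hexp_ge0.
  apply: prodr_ile1 => i _; rewrite mulr_ge0 ?hexp_ge0//=.
  by rewrite mulr_ile1// ?hexp_ge0// hexp0_le1.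
- move=> x nx; rewrite /box_bump.
  have [i hi] : exists i, r <= `|c 0 i - x 0 i|.
    apply: contrapT => h; apply: nx; apply/(ball_rVP _ _ r0) => i.
    by rewrite ltNge; apply/negP => hi; apply: h; exists i.
  rewrite (bigD1 i)//=; move: hi; rewrite ler_normr => /orP[h|h].
    by rewrite hexp0_out ?mul0r//; lra.
  by rewrite [X in _ * X * _]hexp0_out ?mulr0 ?mul0r//; lra.
Qed.

Lemma cvg_prod1 (I : Type) (s : seq I) (F : I -> nat -> R) :
  (forall i : I, F i j @[j --> \oo] --> (1 : R)) ->
  \prod_(i <- s) F i j @[j --> \oo] --> (1 : R).
Proof.
move=> hF; elim: s => [|k s ih].
  by under eq_fun do rewrite big_nil; exact: cvg_cst.
under eq_fun do rewrite big_cons.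
by have := cvgM (hF k) ih; rewrite mulr1; apply.
Qed.

Lemma box_bump_cvg (c : T) (r : R) (x : T) : 0 < r -> ball c r x ->
  box_bump c r j.+1%:R^-1 x @[j --> \oo] --> (1 : R).
Proof.
move=> r0 /(ball_rVP _ _ r0) cx.
rewrite /box_bump; apply: (@cvg_prod1 'I_n _ (fun i j => hexp j.+1%:R^-1 0 (1 * x 0 i + (r - c 0 i)) *
   hexp j.+1%:R^-1 0 ((-1) * x 0 i + (r + c 0 i)))) => i.
have := cx i; rewrite ltr_norml => /andP[h1 h2].
have h3 : 0 < 1 * x 0 i + (r - c 0 i) by lra.
have h4 : 0 < -1 * x 0 i + (r + c 0 i) by lra.
by have := cvgM (hexp0_cvg h3) (hexp0_cvg h4); rewrite mulr1; apply.
Qed.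

Lemma continuous_measurable_rV (f : T -> R) : continuous f -> measurable_fun setT f.
Proof.
move=> cf; apply: (measurability _ (RGenOInfty.measurableE R)).
move=> _ [_ [a ->] <-]; rewrite setTI; apply: open_measurable_rV.
by apply: open_comp => //; exact: interval_open.
Qed.

Lemma smooth_continuous (f : T -> R) : smooth f -> continuous f.
Proof. by move=> sf x; exact/differentiable_continuous/smooth_differentiable. Qed.

Lemma smooth_measurable (f : T -> R) : smooth f -> measurable_fun setT f.
Proof. by move/smooth_continuous; exact: continuous_measurable_rV. Qed.

End bumps.

(** * Convergence to zero in mean *)

Section L1_convergence.
Context d (T : measurableType d) (R : realType).
Variable m : {measure set T -> \bar R}.
Implicit Types (D : set T) (f g h : T -> R) (F G : nat -> T -> R).

Definition N1 D f : \bar R := (\int[m]_(x in D) (`|f x|)%:E)%E.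

Lemma N1_ge0 D f : (0 <= N1 D f)%E.
Proof. by apply: integral_ge0 => x _; rewrite lee_fin. Qed.

Lemma measurable_normE D f : measurable_fun setT f -> measurable_fun D (fun x => (`|f x|)%:E).
Proof. by move=> mf; apply: measurable_funTS; apply/measurable_EFinP; exact: measurableT_comp. Qed.
Hint Resolve measurable_normE : core.

Lemma le_N1 D f g : measurable D -> measurable_fun setT f -> measurable_fun setT g ->
  (forall x, D x -> `|f x| <= `|g x|) -> (N1 D f <= N1 D g)%E.
Proof.
by move=> mD mf mg fg; apply: ge0_le_integral => //; exact: measurable_normE.
Qed.

Lemma le_N1D D f g h : measurable D -> measurable_fun setT f -> measurable_fun setT g ->
  measurable_fun setT h ->
  (forall x, D x -> `|f x| <= `|g x| + `|h x|) -> (N1 D f <= N1 D g + N1 D h)%E.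
Proof.
move=> mD mf mg mh fgh; rewrite /N1 -ge0_integralD//; try exact: measurable_normE.
apply: ge0_le_integral => //; try exact: measurable_normE.
by apply: emeasurable_funD; exact: measurable_normE.
Qed.

Lemma N1Z D (c : R) f : measurable D -> measurable_fun setT f ->
  N1 D (fun x => c * f x) = (`|c|%:E * N1 D f)%E.
Proof.
move=> mD mf; rewrite /N1 -ge0_integralZl//; last exact: measurable_normE.
by apply: eq_integral => x _; rewrite normrM EFinM.
Qed.

Lemma le_N1_set D E f : measurable D -> measurable E -> measurable_fun setT f ->
  D `<=` E -> (N1 D f <= N1 E f)%E.
Proof.
by move=> mD mE mf DE; apply: ge0_subset_integral => //; exact: measurable_normE.
Qed.

Lemma N1U D E f : measurable D -> measurable E -> measurable_fun setT f ->
  (N1 (D `|` E) f <= N1 D f + N1 E f)%E.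
Proof.
move=> mD mE mf; rewrite (_ : D `|` E = D `|` (E `\` D)); last first.
  apply/seteqP; split => x [?|]; [by left| |by left|by case=> ? _; right].
  by have [?|?] := pselect (D x); [left|right].
have mED : measurable (E `\` D) by exact: measurableD.
rewrite {1}/N1 ge0_integral_setU//; last 2 first.
- exact: measurable_normE.
- by apply/disj_setPS => x [? []].
by rewrite leeD2l//; apply: le_N1_set => // x [].
Qed.

Lemma integrable_N1 D f : measurable D -> measurable_fun setT f ->
  m.-integrable D (EFin \o f) <-> (N1 D f < +oo)%E.
Proof.
move=> mD mf; split => [/integrableP[_]//|h].
by apply/integrableP; split => //; apply: measurable_funTS; exact/measurable_EFinP.
Qed.

(** A one-sided form of convergence to 0: it passes to smaller sequences, and
    does not ask the terms to be finite. *)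
Definition to0 (a : nat -> \bar R) :=
  forall e : R, 0 < e -> \forall j \near \oo, (a j <= e%:E)%E.

Lemma cvg_to0 (a : nat -> \bar R) : a @ \oo --> 0%E -> to0 a.
Proof.
move=> /fine_cvgP[fa /cvgrPdist_le h] e e0; have := h e e0.
apply: filterS2 fa => j fj; rewrite sub0r normrN => hj.
by rewrite -(fineK fj) lee_fin (le_trans (ler_norm _)).
Qed.

Lemma to0_le (a b : nat -> \bar R) : (\forall j \near \oo, (a j <= b j)%E) -> to0 b -> to0 a.
Proof.
by move=> ab hb e e0; have := hb e e0; apply: filterS2 ab => j; exact: le_trans.
Qed.

Lemma to0D (a b : nat -> \bar R) : to0 a -> to0 b -> to0 (fun j => a j + b j)%E.
Proof.
move=> ha hb e e0; have e20 : 0 < e / 2 by rewrite divr_gt0.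
have := ha _ e20; apply: filterS2 (hb _ e20) => j h1 h2.
by rewrite [e]splitr EFinD leeD.
Qed.

Lemma to0Z (c : R) (a : nat -> \bar R) : 0 <= c -> to0 a -> to0 (fun j => c%:E * a j)%E.
Proof.
move=> c0 ha e e0; have c1 : 0 < c + 1 by rewrite ltr_wpDl.
have ec : 0 < e / (c + 1) by rewrite divr_gt0.
have := ha _ ec; apply: filterS => j h.
apply: le_trans (lee_wpmul2l _ h) _; first by rewrite lee_fin.
by rewrite -EFinM lee_fin mulrA ler_pdivrMr// mulrC ler_wpM2l ?ltW// ltrDl.
Qed.

Lemma to0_cst (c : \bar R) : (0 <= c)%E -> to0 (fun _ => c) -> c = 0%E.
Proof.
move=> c0 h; apply/eqP; rewrite eq_le c0 andbT; apply/lee_addgt0Pr => e e0.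
by rewrite add0e; have [j] := filter_ex (h e e0).
Qed.

Definition L1to0 D F := (forall j, measurable_fun setT (F j)) /\ to0 (fun j => N1 D (F j)).

Lemma L1to0_le D F G : measurable D -> (forall j, measurable_fun setT (F j)) ->
  (\forall j \near \oo, forall x, D x -> `|F j x| <= `|G j x|) -> L1to0 D G -> L1to0 D F.
Proof.
move=> mD mF FG [mG hG]; split => //; apply: to0_le hG.
by apply: filterS FG => j; exact: le_N1.
Qed.

Lemma L1to0D D F G : measurable D -> L1to0 D F -> L1to0 D G ->
  L1to0 D (fun j x => F j x + G j x).
Proof.
move=> mD [mF hF] [mG hG]; split => [j|]; first exact: measurable_funD.
apply: to0_le (to0D hF hG); apply: nearW => j; apply: le_N1D => //.
  exact: measurable_funD.
by move=> x _; exact: ler_normD.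
Qed.

Lemma L1to0Z D (c : R) F : measurable D -> L1to0 D F -> L1to0 D (fun j x => c * F j x).
Proof.
move=> mD [mF hF]; split => [j|]; first exact: measurable_funM.
apply: to0_le (to0Z (normr_ge0 c) hF); apply: nearW => j.
by rewrite N1Z.
Qed.

Lemma L1to0_dct D F g : measurable D -> (forall j, measurable_fun setT (F j)) ->
  m.-integrable D (EFin \o g) ->
  {ae m, forall x, D x -> F ^~ x @ \oo --> (0 : R)} ->
  {ae m, forall x j, D x -> `|F j x| <= g x} -> L1to0 D F.
Proof.
move=> mD mF ig F0 Fg; split => //; apply: cvg_to0.
have mFE j : measurable_fun D (EFin \o F j).
  by apply: measurable_funTS; exact/measurable_EFinP.
have F0' : {ae m, forall x, D x -> (fun j => (F j x)%:E) @ \oo --> 0%E}.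
  by apply: filterS F0 => x h Dx; apply: cvg_EFin => //; [exact: nearW|exact: h].
have Fg' : {ae m, forall x j, D x -> (`|(F j x)%:E| <= (EFin \o g) x)%E}.
  by apply: filterS Fg => x h j Dx; rewrite /= lee_fin h.
have [_ + _] := dominated_convergence mD mFE (measurable_cst _) F0' ig Fg'.
apply: cvg_trans; rewrite (_ : [sequence _]_n = (fun j => N1 D (F j)))//.
by apply/funext => j; apply: eq_integral => x _; rewrite sube0.
Qed.

(** The weight is split at a high level: below it the weight is bounded, and
    above it the weight has a small integral. *)
Lemma L1to0_weight D F w (M : R) : measurable D -> measurable_fun setT w ->
  m.-integrable D (EFin \o w) -> (forall j x, D x -> `|F j x| <= M) ->
  L1to0 D F -> L1to0 D (fun j x => w x * F j x).
Proof.
move=> mD mw iw FM [mF hF]; split => [j|]; first exact: measurable_funM.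
pose r (k : nat) x := `|w x| - Num.min `|w x| k%:R.
have r_ge0 k x : 0 <= r k x by rewrite subr_ge0 ge_min lexx.
have mr k : measurable_fun setT (r k).
  by apply: measurable_funB; [exact: measurableT_comp|apply: measurable_minr => //; exact: measurableT_comp].
have [_ hr] : L1to0 D r.
  apply: (@L1to0_dct D r (fun x => `|w x|)) => //.
  - exact: integrable_norm.
  - apply: aeW => x _; apply: cvg_near_cst; near=> k.
    rewrite /r min_l ?subrr//; near: k; exact: nbhs_infty_ger.
  - apply: aeW => x k _; rewrite ger0_norm// /r gerBl le_min normr_ge0/=.
    by rewrite ler0n.
move=> e e0.
have M1 : 0 < `|M| + 1 by rewrite ltr_wpDl.
have ec : 0 < e / 2 / (`|M| + 1) by rewrite !divr_gt0.
have [k hk] := filter_ex (hr _ ec).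
have h2 : to0 (fun j => k%:R%:E * N1 D (F j))%E by exact: to0Z.
have e20 : 0 < e / 2 by rewrite divr_gt0.
have := h2 _ e20; apply: filterS => j hj.
apply: (@le_trans _ _ (N1 D (fun x => k%:R * F j x)%R + N1 D (fun x => (`|M| + 1) * r k x)%R)%E).
  apply: le_N1D => //; try exact: measurable_funM.
  move=> x Dx; rewrite !normrM (ger0_norm (r_ge0 _ _)) (ger0_norm (ltW M1)) (ger0_norm (ler0n R k)).
  have := FM j x Dx => h; have := normr_ge0 (F j x); rewrite /r; set t := `|F j x| in h *.
  have tM : t <= `|M| + 1 by rewrite (le_trans h)// (le_trans (ler_norm _))// lerDl.
  have [wk|wk] := leP `|w x| k%:R => t0; first by rewrite subrr mulr0 addr0 ler_wpM2r.
  rewrite -lerBlDl -mulrBl mulrC ler_wpM2r// subr_ge0 ltW//.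
rewrite !N1Z// (ger0_norm (ler0n R k)) (ger0_norm (ltW M1)) [e]splitr [leRHS]EFinD leeD//.
apply: le_trans (lee_wpmul2l _ hk) _; first by rewrite lee_fin ltW.
by rewrite -EFinM mulrC divfK// gt_eqF.
Unshelve. all: by end_near. Qed.

End L1_convergence.
Arguments N1 {d T R} m D f.
Arguments L1to0 {d T R} m D F.

(** * Density of bump functions *)

Section approximation_by_bumps.
Context {R : realType} {n : nat}.
Local Notation T := 'rV[R]_n.
Local Notation mu := (@lebesgue_rV R n).
Variables (c : T) (r : R) (w : T -> R).
Hypotheses (r0 : 0 < r) (mw : measurable_fun [set: T] w).
Let Q := ball c r.
Hypothesis iw : mu.-integrable Q (EFin \o w).

Let mQ : measurable Q. Proof. exact: measurable_ball_rV. Qed.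

(** These sets form a sigma-algebra that contains the half-spaces orthogonal to
    the axes, hence they are all the measurable sets. *)
Let bumpable (A : set T) := measurable A /\ forall e : R, 0 < e ->
  exists2 eta, bump_in c r eta &
    (N1 mu Q (fun x => w x * (eta x - \1_A x))%R <= e%:E)%E.

Let mwB (f g : T -> R) : measurable_fun setT f -> measurable_fun setT g ->
  measurable_fun setT (fun x => w x * (f x - g x)).
Proof. by move=> mf mg; apply: measurable_funM => //; exact: measurable_funB. Qed.

Let bump_measurable eta : bump_in c r eta -> measurable_fun setT eta.
Proof. by move=> [/smooth_measurable]. Qed.

Let m1 (A : set T) : measurable A -> measurable_fun setT (\1_A : T -> R).
Proof. by move=> mA; exact: measurable_indic. Qed.

Let ind01 (A : set T) x : 0 <= (\1_A x : R) <= 1.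
Proof. by rewrite indicE; case: (_ \in _); rewrite /= ?lexx ?ler01. Qed.

Let cvg_to0_dist (F G : nat -> T -> R) :
  (forall j, measurable_fun setT (F j)) -> (forall j, measurable_fun setT (G j)) ->
  (forall j x, 0 <= F j x <= 1) -> (forall j x, 0 <= G j x <= 1) ->
  (forall x, Q x -> F j x - G j x @[j --> \oo] --> (0 : R)) ->
  L1to0 mu Q (fun j x => w x * (F j x - G j x)).
Proof.
move=> mF mG F01 G01 FG.
apply: (@L1to0_dct _ _ _ _ _ _ (fun x => `|w x|)) => //.
- by move=> j; exact: mwB.
- exact: integrable_norm.
- apply: aeW => x Qx; rewrite -(mulr0 (w x)); apply: cvgMr; exact: FG.
- apply: aeW => x j Qx; rewrite normrM ler_piMr//.
  by have := F01 j x; have := G01 j x; rewrite ler_norml => /andP[? ?] /andP[? ?]; lra.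
Qed.

Let bumpable_seq (A : set T) (eta : nat -> T -> R) : measurable A ->
  (forall j, bump_in c r (eta j)) ->
  (forall x, Q x -> eta j x @[j --> \oo] --> (\1_A x : R)) -> bumpable A.
Proof.
move=> mA heta cvg; split => // e e0.
have [||||x Qx|_ h] := @cvg_to0_dist eta (fun _ => \1_A).
- by move=> j; exact: bump_measurable.
- by move=> j; exact: m1.
- by move=> j x; have [_ h _] := heta j; exact: h.
- by move=> j x; exact: ind01.
- by apply/subr_cvg0; exact: cvg.
by have [j hj] := filter_ex (h e e0); exists (eta j).
Qed.

Let invS_gt0 j : 0 < j.+1%:R^-1 :> R. Proof. by rewrite invr_gt0. Qed.

Let bumpable_halfspace (i : 'I_n) (a : R) :
  bumpable ((fun x : T => x 0 i) @^-1` `]a, +oo[%classic).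
Proof.
apply: (@bumpable_seq _ (fun j x => box_bump c r j.+1%:R^-1 x *
   hexp j.+1%:R^-1 0 (1 * x 0 i + (- a)))).
- by rewrite -[X in measurable X]setTI; apply: measurable_coord_rV.
- move=> j; have [h1 h2 h3] := @box_bump_in R n c r _ r0 (invS_gt0 j); split.
  + by apply: smoothM => //; exact: smooth_hexp.
  + move=> x; have /andP[h4 h5] := h2 x; rewrite mulr_ge0 ?hexp_ge0//=.
    by rewrite mulr_ile1// ?hexp_ge0// hexp0_le1.
  + by move=> x /h3 ->; rewrite mul0r.
- move=> x Qx; have h1 := box_bump_cvg r0 Qx; rewrite indicE.
  have [xa|xa] := ltP a (x 0 i).
    rewrite mem_set/=; last by rewrite in_itv/= xa.
    have h2 : 0 < 1 * x 0 i + (- a) by rewrite mul1r subr_gt0.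
    by have := cvgM h1 (hexp0_cvg h2); rewrite mulr1; apply.
  rewrite memNset/=; last by rewrite in_itv/= ltNge xa.
  apply: cvg_near_cst; apply: nearW => j; rewrite [X in _ * X]hexp0_out ?mulr0//.
  by rewrite mul1r subr_le0.
Qed.

Let bumpable0 : bumpable set0.
Proof.
split => // e e0; exists (fun _ => 0).
  by split => [|x|//]; [exact: smooth_cst|rewrite lexx ler01].
rewrite /N1 integral0_eq ?lee_fin ?ltW// => x _.
by rewrite indicE in_set0 subrr mulr0 normr0.
Qed.

Let bumpableC A : bumpable A -> bumpable (~` A).
Proof.
move=> [mA hA]; split; first exact: measurableC.
move=> e e0; have e20 : 0 < e / 2 by rewrite divr_gt0.
have [eta [e1 e2 e3] he] := hA _ e20.
have [||||x Qx|_ h] := @cvg_to0_dist (fun j => box_bump c r j.+1%:R^-1) (fun _ => cst 1).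
- by move=> j; apply: bump_measurable; exact: box_bump_in.
- by move=> j; exact: measurable_cst.
- by move=> j x; have [] := @box_bump_in R n c r _ r0 (invS_gt0 j).
- by move=> j x; rewrite /= ler01 lexx.
- by apply/subr_cvg0; exact: box_bump_cvg.
have [j hj] := filter_ex (h _ e20).
have [b1 b2 b3] := @box_bump_in R n c r _ r0 (invS_gt0 j).
exists (fun x => box_bump c r j.+1%:R^-1 x * (1 - eta x)).
  split; first by apply: smoothM => //; exact: smoothB1.
    move=> x; have /andP[h1 h2] := b2 x; have /andP[h3 h4] := e2 x.
    by rewrite mulr_ge0 ?subr_ge0//= mulr_ile1 ?subr_ge0// gerBl.
  by move=> x /b3 ->; rewrite mul0r.
rewrite [e]splitr EFinD; apply: le_trans (leeD he hj).
apply: le_N1D => //.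
- apply: mwB; last by apply: m1; exact: measurableC.
  by apply: smooth_measurable; apply: smoothM => //; exact: smoothB1.
- by apply: mwB; [exact: smooth_measurable|exact: m1].
- by apply: mwB => //; exact: smooth_measurable.
move=> x Qx; rewrite !normrM -mulrDr ler_wpM2l//.
have -> : \1_(~` A) x = 1 - \1_A x :> R.
  by rewrite !indicE in_setC; case: (_ \in _); rewrite /= ?subrr ?subr0.
have /andP[h1 h2] := b2 x; have /andP[h3 h4] := e2 x; have /andP[h5 h6] := ind01 A x.
set b := box_bump _ _ _ _ in h1 h2 *; set s := eta x in h3 h4 *; set t := \1_A x in h5 h6 *.
rewrite (_ : b * (1 - s) - (1 - t) = (1 - s) * (b - 1) - (s - t)); last by ring.
rewrite (le_trans (ler_normB _ _))// addrC lerD2l normrM ler_piMl//.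
by rewrite ler_norml; apply/andP; split; lra.
Qed.

Let bumpableU A B : bumpable A -> bumpable B -> bumpable (A `|` B).
Proof.
move=> [mA hA] [mB hB]; split; first exact: measurableU.
move=> e e0; have e20 : 0 < e / 2 by rewrite divr_gt0.
have [f [f1 f2 f3] hf] := hA _ e20; have [g [g1 g2 g3] hg] := hB _ e20.
have sfg : smooth (fun x => 1 - (1 - f x) * (1 - g x)).
  by apply: smoothB1; apply: smoothM; exact: smoothB1.
exists (fun x => 1 - (1 - f x) * (1 - g x)).
  split => // x; last by move=> Qx; rewrite f3// g3// !subr0 mulr1 subrr.
  have /andP[h1 h2] := f2 x; have /andP[h3 h4] := g2 x.
  by rewrite subr_ge0 gerBl mulr_ile1 ?subr_ge0 ?gerBl//= mulr_ge0// subr_ge0.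
rewrite [e]splitr EFinD; apply: le_trans (leeD hf hg).
apply: le_N1D => //.
- apply: mwB; first exact: smooth_measurable.
  by apply: m1; exact: measurableU.
- by apply: mwB; [exact: smooth_measurable|exact: m1].
- by apply: mwB; [exact: smooth_measurable|exact: m1].
move=> x Qx; rewrite !normrM -mulrDr ler_wpM2l//.
have -> : \1_(A `|` B) x = 1 - (1 - \1_A x) * (1 - \1_B x) :> R.
  by rewrite !indicE in_setU; do 2 case: (_ \in _); rewrite /= ?subrr ?subr0 ?mulr0 ?mul0r ?mulr1 ?subr0 ?subrr.
have /andP[h1 h2] := f2 x; have /andP[h3 h4] := g2 x.
have /andP[h5 h6] := ind01 A x; have /andP[h7 h8] := ind01 B x.
set u := f x in h1 h2 *; set v := g x in h3 h4 *.
set a := \1_A x in h5 h6 *; set b := \1_B x in h7 h8 *.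
rewrite (_ : _ - _ = (u - a) * (1 - v) + (v - b) * (1 - a)); last by ring.
rewrite (le_trans (ler_normD _ _))// lerD// normrM ler_piMr// ler_norml; apply/andP; split; lra.
Qed.

Let bumpable_bigcup (A : nat -> set T) : (forall k, bumpable (A k)) -> bumpable (\bigcup_k A k).
Proof.
move=> hA; have mA : measurable (\bigcup_k A k).
  by apply: bigcup_measurable => k _; have [] := hA k.
pose B k := \big[setU/set0]_(i < k) A i.
have hB k : bumpable (B k).
  by rewrite /B; elim/big_ind : _ => //; exact: bumpableU.
split => // e e0; have e20 : 0 < e / 2 by rewrite divr_gt0.
have [||||x Qx|_ h] := @cvg_to0_dist (fun k => \1_(B k)) (fun _ => \1_(\bigcup_k A k)).
- by move=> j; apply: m1; have [] := hB j.
- by move=> j; exact: m1.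
- by move=> j x; exact: ind01.
- by move=> j x; exact: ind01.
- apply: cvg_near_cst; rewrite !indicE.
  have [[k _ Akx]|nA] := pselect ((\bigcup_k A k) x).
    near=> j; rewrite !indicE (mem_set (A := \bigcup_k A k)); last by exists k.
    rewrite mem_set ?subrr// /B -bigcup_mkord; exists k => //=.
    by near: j; exact: nbhs_infty_gt.
  apply: nearW => j; rewrite !indicE (memNset (A := \bigcup_k A k))// memNset ?subrr//.
  by rewrite /B -bigcup_mkord => -[k _ Akx]; apply: nA; exists k.
have [k hk] := filter_ex (h _ e20).
have [mBk hBk] := hB k.
have [eta beta heta] := hBk _ e20; exists eta => //.
rewrite [e]splitr EFinD; apply: le_trans (leeD heta hk).
have meta := bump_measurable beta.
apply: le_N1D => //; try by apply: mwB => //; exact: m1.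
move=> x Qx; rewrite !normrM -mulrDr ler_wpM2l//.
by rewrite -(subrKA (\1_(B k) x)) ler_normD.
Unshelve. all: by end_near. Qed.

(** The weight [w] serves to approximate the sign of an integrable function
    within the pairing with that function; see [L1_duality]. *)
Lemma bump_approx (A : set T) (e : R) : measurable A -> 0 < e ->
  exists2 eta, bump_in c r eta &
    (N1 mu Q (fun x => w x * (eta x - \1_A x))%R <= e%:E)%E.
Proof.
suff h : (@measurable _ T) `<=` bumpable by move=> mA e0; have [_] := h _ mA; apply.
apply: smallest_sub.
  split => //; first by move=> B hB; rewrite setTD; exact: bumpableC.
rewrite -bigcup_seq => B [i _ [C mC <-]]; rewrite setTI.
suff : (@measurable _ (measurableTypeR R)) `<=` (fun C => bumpable ((fun x : T => x 0 i) @^-1` C)).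
  by apply.
rewrite (RGenOInfty.measurableE R); apply: smallest_sub; last first.
  by move=> _ [a ->]; exact: bumpable_halfspace.
split => //.
- by move=> D hD; rewrite setTD preimage_setC; exact: bumpableC.
- by move=> F hF; rewrite preimage_bigcup; exact: bumpable_bigcup.
Qed.

End approximation_by_bumps.

(** * Duality and continuity of translations in mean *)

Section duality.
Context {R : realType} {n : nat}.
Local Notation T := 'rV[R]_n.
Local Notation mu := (@lebesgue_rV R n).

Definition signed_bump (c : T) (r : R) (eta : T -> R) :=
  [/\ smooth eta, forall x, `|eta x| <= 1 & forall x, ~ ball c r x -> eta x = 0].

Lemma integrable_mul_bounded D (f g : T -> R) (M : R) : measurable D ->
  measurable_fun setT f -> measurable_fun setT g -> (forall x, D x -> `|g x| <= M) ->
  mu.-integrable D (EFin \o f) -> mu.-integrable D (fun x => (f x * g x)%:E).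
Proof.
move=> mD mf mg gM fi.
have h : mu.-integrable D (fun x => (M * `|f x|)%:E).
  under eq_fun do rewrite EFinM; apply: integrableZl => //.
  exact: integrable_norm.
apply: le_integrable h => //.
  by apply: measurable_funTS; apply/measurable_EFinP; exact: measurable_funM.
move=> x Dx; rewrite /= lee_fin normrM mulrC; apply: le_trans (ler_norm _).
by rewrite ler_wpM2r// gM.
Qed.

(** The norm is the pairing with the sign of [f], and bumps approximate this
    sign. *)
Lemma L1_duality (c : T) (r w : R) (f : T -> R) : 0 < r -> measurable_fun setT f ->
  mu.-integrable (ball c r) (EFin \o f) ->
  (forall eta, signed_bump c r eta -> (\int[mu]_(x in ball c r) (f x * eta x)%:E <= w%:E)%E) ->
  (N1 mu (ball c r) f <= w%:E)%E.
Proof.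
move=> r0 mf fi hw; have mQ := measurable_ball_rV c r.
apply/lee_addgt0Pr => e e0; have e20 : 0 < e / 2 by rewrite divr_gt0.
have mP : measurable [set x | 0 < f x].
  by rewrite -[X in measurable X]setTI -preimage_itvoy; apply: mf => //.
have mN : measurable [set x | 0 < - f x].
  rewrite -[X in measurable X]setTI -(preimage_itvoy (fun x => - f x)).
  by apply: (measurable_funN mf) => //.
have [a [a1 a2 a3] ha] := bump_approx r0 mf fi mP e20.
have [b [b1 b2 b3] hb] := bump_approx r0 mf fi mN e20.
pose eta x := a x + (-1) * b x.
have beta : signed_bump c r eta.
  split.
  - by apply: smoothD => //; apply: smoothM => //; exact: smooth_cst.
  - move=> x; have /andP[? ?] := a2 x; have /andP[? ?] := b2 x.
    by rewrite /eta ler_norml; apply/andP; split; lra.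
  - by move=> x nx; rewrite /eta a3// b3// mulr0 addr0.
have meta : measurable_fun setT eta by case: beta => /smooth_measurable.
have fie : mu.-integrable (ball c r) (fun x => (f x * eta x)%:E).
  by apply: (@integrable_mul_bounded _ _ _ 1) => //; case: beta => _ h _ x _; exact: h.
pose ga x := f x * (a x - \1_[set x | 0 < f x] x).
pose gb x := f x * (b x - \1_[set x | 0 < - f x] x).
have mga : measurable_fun setT ga.
  apply: measurable_funM => //; apply: measurable_funB; first exact: smooth_measurable.
  exact: measurable_indic.
have mgb : measurable_fun setT gb.
  apply: measurable_funM => //; apply: measurable_funB; first exact: smooth_measurable.
  exact: measurable_indic.
have iga : mu.-integrable (ball c r) (EFin \o ga).
  by apply/integrable_N1 => //; rewrite (le_lt_trans ha)// ltry.
have igb : mu.-integrable (ball c r) (EFin \o gb).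
  by apply/integrable_N1 => //; rewrite (le_lt_trans hb)// ltry.
have ina : mu.-integrable (ball c r) (fun x => (`|ga x|)%:E) by exact: integrable_norm.
have inb : mu.-integrable (ball c r) (fun x => (`|gb x|)%:E) by exact: integrable_norm.
have inab : mu.-integrable (ball c r) (fun x => (`|ga x|)%:E + (`|gb x|)%:E)%E.
  exact: integrableD.
apply: (@le_trans _ _ (\int[mu]_(x in ball c r)
    ((f x * eta x)%:E + ((`|ga x|)%:E + (`|gb x|)%:E)))%E).
  apply: le_integral => //; first exact: integrable_norm.
    exact: integrableD.
  move=> x _; rewrite -!EFinD lee_fin.
  have -> : `|f x| = f x * (\1_[set x | 0 < f x] x - \1_[set x | 0 < - f x] x).
    rewrite !indicE; have [h|h|h] := ltgtP (f x) 0.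
    - rewrite memNset/=; last by apply/negP; rewrite -leNgt ltW.
      by rewrite mem_set/= ?oppr_gt0// sub0r mulrN1 ltr0_norm.
    - rewrite mem_set//= memNset/=; last by apply/negP; rewrite oppr_gt0 -leNgt ltW.
      by rewrite subr0 mulr1 gtr0_norm.
    - by rewrite h mul0r normr0.
  rewrite -lerBlDl [leLHS](_ : _ = - ga x + gb x); last by rewrite /ga /gb /eta; ring.
  by apply: lerD; rewrite ?ler_norm// -normrN ler_norm.
rewrite integralD// integralD//; apply: leeD; first exact: hw.
by rewrite [e]splitr EFinD; apply: leeD.
Qed.

End duality.

Section translation_continuity.
Context {R : realType} {n : nat}.
Local Notation T := 'rV[R]_n.
Local Notation mu := (@lebesgue_rV R n).
Implicit Types (f g : T -> R) (l : 'I_n).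

Local Notation e_ l := (delta_mx 0 l : T).

Lemma N1_supp D f : measurable D -> (forall x, ~ D x -> f x = 0) ->
  N1 mu setT f = N1 mu D f.
Proof.
move=> mD fD; rewrite /N1 [RHS]integral_mkcond; apply: eq_integral => x _.
rewrite patchE; case: ifPn => //; rewrite notin_setE => /fD ->.
by rewrite normr0.
Qed.

Lemma measurable_fun_shift (a : T) f : measurable_fun setT f ->
  measurable_fun setT (fun x : T => f (x + a)).
Proof. by move=> mf; exact: (measurableT_comp mf (measurable_shift a)). Qed.

Lemma N1_shift (a : T) f : measurable_fun setT f ->
  N1 mu setT (fun x : T => f (x + a)) = N1 mu setT f.
Proof.
move=> mf; rewrite /N1 -(ge0_integral_shift a (f := fun x => (`|f x|)%:E))//.
by apply/measurable_EFinP; exact: measurableT_comp.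
Qed.

Lemma partial_supp K f l : closed K -> (forall x, ~ K x -> f x = 0) ->
  forall x, ~ K x -> partial l f x = 0.
Proof.
move=> cK f0 x nKx.
have oK : open (~` K) by exact: closed_openC.
have h : \forall y \near x, f y = cst 0 y.
  by apply: filterS (open_nbhs_nbhs (conj oK nKx)) => y; exact: f0.
by rewrite /partial (near_eq_derive _ h) derive_cst.
Qed.

Lemma continuous_supp_bounded K f : compact K -> continuous f ->
  (forall x, ~ K x -> f x = 0) -> exists2 M, 0 <= M & forall x, `|f x| <= M.
Proof.
move=> cK cf f0.
have /compact_bounded [M [_ hM]] : compact (f @` K).
  by apply: continuous_compact => //; apply: continuous_subspaceT => x; exact: cf.
exists (`|M| + 1); first by rewrite addr_ge0.
move=> x; have [Kx|nKx] := pselect (K x); last by rewrite f0// normr0 addr_ge0.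
by apply: hM; [rewrite (le_lt_trans (ler_norm _))// ltrDl|exists x].
Qed.

Lemma line_lipschitz f l (M : R) : (forall x, derivable f x (e_ l)) ->
  (forall x, `|partial l f x| <= M) ->
  forall x (s : R), `|f (x + s *: e_ l) - f x| <= M * `|s|.
Proof.
move=> df fM.
suff h x (s : R) : 0 <= s -> `|f (x + s *: e_ l) - f x| <= M * s.
  move=> x s; have [s0|s0] := leP 0 s; first by rewrite (ger0_norm s0) h.
  have := h (x + s *: e_ l) (- s); rewrite oppr_ge0 => /(_ (ltW s0)).
  by rewrite -addrA -scalerDl subrr scale0r addr0 distrC (ltr0_norm s0).
move=> s0.
have [t _ ->] : exists2 t, t \in `[0, s]%R & f (x + s *: e_ l) - f x =
     'D_(e_ l) f (x + t *: e_ l) * (s - 0).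
  have -> : f x = f (x + 0 *: e_ l) by rewrite scale0r addr0.
  apply: (@MVT_segment R (fun t : R => f (x + t *: e_ l))
     (fun t : R => 'D_(e_ l) f (x + t *: e_ l)) 0 s s0).
    by move=> t _; apply: derivable_line; exact: df.
  apply: derivable_within_continuous => t _.
  by have [] := @derivable_line R n f x (e_ l) t (df _).
by rewrite subr0 normrM (ger0_norm s0) ler_wpM2r// fM.
Qed.

Lemma smooth_supp_lipschitz K f l : compact K -> smooth f ->
  (forall x, ~ K x -> f x = 0) ->
  exists2 M, 0 <= M & forall x (s : R), `|f (x + s *: e_ l) - f x| <= M * `|s|.
Proof.
move=> cK sf f0.
have [M M0 hM] := continuous_supp_bounded cK (smooth_continuous (smooth_partial l sf))
  (partial_supp l (compact_closed (@norm_hausdorff _ _) cK) f0).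
by exists M => //; apply: line_lipschitz => // x; exact/diff_derivable/smooth_differentiable.
Qed.

Lemma bump_approx_sum (c : T) (r : R) (A : R -> set T) (s : seq R) (e : R) :
  0 < r -> (forall y, measurable (A y)) -> 0 < e ->
  exists phi, [/\ smooth phi, forall x, ~ ball c r x -> phi x = 0 &
   (N1 mu (ball c r) (fun x : T => phi x - \sum_(y <- s) y * \1_(A y) x)%R <= e%:E)%E].
Proof.
move=> r0 mA; have mQ := measurable_ball_rV c r.
have m1 y : measurable_fun setT (\1_(A y) : T -> R) by exact: measurable_indic.
have ms (t : seq R) : measurable_fun setT (fun x : T => \sum_(y <- t) y * \1_(A y) x).
  by apply: measurable_sum => y; exact: measurable_funM.
elim: s e => [|y s ih] e e0.
  exists (fun _ => 0); split => //; first exact: smooth_cst.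
  rewrite /N1 integral0_eq ?lee_fin ?ltW// => x _.
  by rewrite big_nil subrr normr0.
have e20 : 0 < e / 2 by rewrite divr_gt0.
have y1 : 0 < `|y| + 1 by rewrite ltr_wpDl.
have ey : 0 < e / 2 / (`|y| + 1) by rewrite divr_gt0.
have [phi [p1 p2 p3]] := ih _ e20.
have i1 : mu.-integrable (ball c r) (EFin \o (fun _ : T => 1 : R)).
  apply/integrable_N1 => //; rewrite /N1 (eq_integral (cst 1%E)) ?integral_cst//.
    by rewrite mul1e mu_ball_rV.
  by move=> x _; rewrite normr1.
have [eta [e1 e2 e3] he] := bump_approx r0 (measurable_cst _) i1 (mA y) ey.
have sy : smooth (fun x : T => y * eta x) by apply: smoothM => //; exact: smooth_cst.
exists (fun x : T => y * eta x + phi x); split.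
- exact: smoothD.
- by move=> x nx; rewrite e3// p2// mulr0 addr0.
apply: (@le_trans _ _ ((N1 mu (ball c r) (fun x : T => y * (1 * (eta x - \1_(A y) x)))%R) +
   N1 mu (ball c r) (fun x : T => phi x - \sum_(y <- s) y * \1_(A y) x)%R)%E).
  apply: le_N1D => //.
  - apply: measurable_funB; last exact: ms.
    by apply: smooth_measurable; exact: smoothD.
  - apply: measurable_funM => //; apply: measurable_funM => //.
    by apply: measurable_funB => //; exact: smooth_measurable.
  - by apply: measurable_funB => //; exact: smooth_measurable.
  move=> x _; rewrite big_cons; apply: le_trans (ler_normD _ _).
  by rewrite le_eqVlt; apply/orP; left; apply/eqP; congr `|_|; ring.
rewrite [e]splitr EFinD; apply: leeD => //.
rewrite N1Z//; last first.
  apply: measurable_funM => //; apply: measurable_funB => //; exact: smooth_measurable.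
apply: le_trans (lee_wpmul2l _ he) _; first by rewrite lee_fin.
by rewrite -EFinM lee_fin mulrCA ger_pMr ?divr_gt0// ler_pdivrMr// mul1r lerDl.
Qed.

Import HBSimple.

Lemma bump_dense (c : T) (r : R) f (e : R) : 0 < r -> measurable_fun setT f ->
  mu.-integrable (ball c r) (EFin \o f) -> 0 < e ->
  exists phi, [/\ smooth phi, forall x, ~ ball c r x -> phi x = 0 &
   (N1 mu (ball c r) (fun x : T => phi x - f x)%R <= e%:E)%E].
Proof.
move=> r0 mf fi e0; have mQ := measurable_ball_rV c r.
have e20 : 0 < e / 2 by rewrite divr_gt0.
have [g [_ _ /cvg_to0 hg]] := approximation_sfun_integrable mQ fi.
have [j hj] := filter_ex (hg _ e20).
have mg y : measurable (g j @^-1` [set y]) by exact: measurable_sfunP.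
have [phi [p1 p2 p3]] := @bump_approx_sum c r (fun y => g j @^-1` [set y])
  (finmap.enum_fset (fset_set (range (g j)))) _ r0 mg e20.
exists phi; split => //.
have {}p3 : (N1 mu (ball c r) (fun x : T => phi x - g j x)%R <= (e / 2)%:E)%E.
  apply: le_trans p3; rewrite le_eqVlt; apply/orP; left; apply/eqP.
  by apply: eq_integral => x _; rewrite [in LHS]fimfunE fsbig_finite.
rewrite [e]splitr EFinD; apply: le_trans (leeD p3 hj).
have mgj : measurable_fun setT (g j) by exact: measurable_funPT.
apply: (@le_N1D _ _ _ _ _ _ (fun x : T => phi x - g j x) (fun x : T => f x - g j x)) => //;
  try (apply: measurable_funB => //; exact: smooth_measurable).
by move=> x _; rewrite -(subrKA (g j x)) (le_trans (ler_normD _ _))// lerD2l distrC.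
Qed.

(** Clear for Lipschitz functions with bounded support, and these are dense. *)
Lemma translation_continuity (c : T) (r : R) f l (e : R) : 0 < r ->
  measurable_fun setT f -> mu.-integrable (ball c r) (EFin \o f) ->
  (forall x, ~ ball c r x -> f x = 0) -> 0 < e ->
  exists2 d, 0 < d & forall s : R, `|s| <= d ->
    (N1 mu setT (fun x : T => f (x + s *: e_ l) - f x)%R <= e%:E)%E.
Proof.
move=> r0 mf fi f0 e0; have mQ := measurable_ball_rV c r.
have e30 : 0 < e / 3 by rewrite divr_gt0.
have [phi [p1 p2 p3]] := bump_dense r0 mf fi e30.
have [|M M0 hM] := @smooth_supp_lipschitz (cball c r) phi l (@cball_compact _ _ c r) p1.
  by move=> x nx; apply: p2 => /sub_ball_cball.
have mphi := smooth_measurable p1.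
pose B := ball c (r + 1).
have mB : measurable B by exact: measurable_ball_rV.
have fB : mu B \is a fin_num by rewrite ge0_fin_numE// mu_ball_rV.
pose N : R := `|e_ l : T|.
pose m := fine (mu B).
have m0 : 0 <= m by exact: fine_ge0.
have d1 : 0 < M * m + 1 by rewrite ltr_wpDl// mulr_ge0.
have N0 : 0 <= N by exact: normr_ge0.
have N1_ : 0 < N + 1 by exact: (ltr_wpDl N0 ltr01).
exists (Num.min (e / 3 / (M * m + 1)) (N + 1)^-1); first by rewrite lt_min divr_gt0//= invr_gt0.
move=> s; rewrite le_min => /andP[sd sN].
pose df x := phi x - f x.
have mdf : measurable_fun setT df by exact: measurable_funB.
have hdf : (N1 mu setT df <= (e / 3)%:E)%E.
  by rewrite (N1_supp mQ)// => x nx; rewrite /df p2// f0// subrr.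
have hphi : (N1 mu setT (fun x : T => phi (x + s *: e_ l) - phi x)%R <= (e / 3)%:E)%E.
  rewrite (N1_supp mB); last first.
    move=> x nx; rewrite !p2 ?subrr//.
      by move=> h; apply: nx; apply: le_ball h; rewrite lerDl.
    move=> h; apply: nx; rewrite /B mx_norm_ball /ball_/=.
    move: h; rewrite mx_norm_ball /ball_/= => h.
    rewrite -(subrKA (x + s *: e_ l)) (le_lt_trans (ler_normD _ _))//.
    rewrite ltr_leD// addrAC subrr add0r normrZ -/N.
    apply: (@le_trans _ _ ((N + 1)^-1 * N)); first by rewrite ler_wpM2r.
    by rewrite mulrC ler_pdivrMr// mul1r lerDl.
  apply: (@le_trans _ _ (N1 mu B (fun _ => M * `|s|))).
    apply: le_N1 => //.
      by apply: measurable_funB => //; exact: measurable_fun_shift.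
    by move=> x _; rewrite [leRHS]ger0_norm ?mulr_ge0.
  rewrite /N1 (eq_integral (cst (M * `|s|)%:E)); last by move=> x _; rewrite ger0_norm ?mulr_ge0.
  rewrite integral_cst// [X in (_ * X <= _)%E](_ : _ = m%:E); last by rewrite /m fineK.
  rewrite -EFinM lee_fin.
  rewrite mulrAC; apply: le_trans (ler_wpM2l _ sd) _; first by rewrite mulr_ge0.
  by rewrite mulrA ler_pdivrMr// [leLHS]mulrC; apply: ler_wpM2l; [exact: ltW|rewrite lerDl].
rewrite (_ : e = e / 3 + (e / 3 + e / 3)); last by field.
rewrite !EFinD.
have hs : (N1 mu setT (fun x : T => df (x + s *: e_ l)%R) <= (e / 3)%:E)%E by rewrite N1_shift.
have hsum : (N1 mu setT (fun x : T => (phi (x + s *: e_ l) - phi x) + df x)%R <= (e / 3)%:E + (e / 3)%:E)%E.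
  apply: le_trans (leeD hphi hdf); apply: le_N1D => //.
  - apply: measurable_funD => //; apply: measurable_funB => //; exact: measurable_fun_shift.
  - by apply: measurable_funB => //; exact: measurable_fun_shift.
  - by move=> x _; exact: ler_normD.
apply: le_trans (leeD hs hsum); apply: le_N1D => //.
- by apply: measurable_funB => //; exact: measurable_fun_shift.
- exact: measurable_fun_shift.
- apply: measurable_funD => //; apply: measurable_funB => //; exact: measurable_fun_shift.
- move=> x _; rewrite -normrN; apply: le_trans (ler_normB _ _).
  by rewrite le_eqVlt; apply/orP; left; apply/eqP; congr `|_|; rewrite /df; ring.
Qed.

End translation_continuity.

(** * Weak derivatives as limits of difference quotients *)

Section weak_to_strong.
Context {R : realType} {n : nat}.
Local Notation T := 'rV[R]_n.
Local Notation mu := (@lebesgue_rV R n).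
Implicit Types (D : set T) (f g a b : T -> R) (l : 'I_n).

Local Notation e_ l := (delta_mx 0 l : T).

Lemma Rintegral_shift (s : T) g : measurable_fun setT g ->
  \int[mu]_x g (x + s) = \int[mu]_x g x.
Proof.
move=> mg; have mE : measurable_fun setT (EFin \o g) by exact/measurable_EFinP.
pose gE := EFin \o g.
have ep := ge0_integral_shift s (measurable_funepos mE) (fun x => funepos_ge0 _ _).
have en := ge0_integral_shift s (measurable_funeneg mE) (fun x => funeneg_ge0 _ _).
rewrite /Rintegral; congr fine.
rewrite [LHS]integralE [RHS]integralE; congr (_ - _)%E; [rewrite -ep|rewrite -en];
  by apply: eq_integral => x _; rewrite ?funeposE ?funenegE.
Qed.

Lemma RintegralN D g : measurable D -> mu.-integrable D (EFin \o g) ->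
  \int[mu]_(x in D) - g x = - \int[mu]_(x in D) g x.
Proof.
move=> mD ig; rewrite -mulN1r -RintegralZl//.
by apply: eq_Rintegral => x _; rewrite mulN1r.
Qed.

Lemma Rintegral_supp D K g : K `<=` D -> (forall x, ~ K x -> g x = 0) ->
  \int[mu]_(x in D) g x = \int[mu]_(x in K) g x.
Proof.
move=> KD g0; rewrite Rintegral_mkcond [RHS]Rintegral_mkcond.
apply: eq_Rintegral => x _; rewrite !patchE.
have [xK|xK] := boolP (x \in K); first by rewrite mem_set//; apply: KD; rewrite inE in xK.
by rewrite notin_setE in xK; rewrite g0//; case: ifP.
Qed.

Lemma integrable_supp D K g : measurable D -> measurable K -> K `<=` D ->
  (forall x, ~ K x -> g x = 0) ->
  mu.-integrable K (EFin \o g) -> mu.-integrable D (EFin \o g).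
Proof.
move=> mD mK KD g0 ig; apply/(integrable_mkcond _ mD).
move/(integrable_mkcond _ mK) : ig.
rewrite (_ : (EFin \o g) \_ K = (EFin \o g) \_ D)//.
apply/funext => x; rewrite !patchE.
have [xK|xK] := boolP (x \in K); first by rewrite mem_set//; apply: KD; rewrite inE in xK.
by rewrite notin_setE in xK; rewrite /= g0//; case: ifP.
Qed.

Definition L1loc D f := measurable_fun setT f /\
  forall K, compact K -> K `<=` D -> mu.-integrable K (EFin \o f).

Definition rweak D l a b := [/\ L1loc D a, L1loc D b &
  forall f, test_function D f ->
    \int[mu]_(x in D) (a x * partial l f x) = - \int[mu]_(x in D) (b x * f x)].

Definition dquot l f (j : nat) x : R := j.+1%:R * (f (x + j.+1%:R^-1 *: e_ l) - f x).

(** Differentiation in the mean.  Test functions do not occur here, so that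
    products and compositions can be differentiated as for functions. *)
Definition strong D l a b := [/\ L1loc D a, L1loc D b &
  forall K, compact K -> K `<=` D -> L1to0 mu K (fun j x => dquot l a j x - b x)].

Lemma test_functionP D K f : smooth f -> compact K -> K `<=` D ->
  (forall x, ~ K x -> f x = 0) -> test_function D f.
Proof.
move=> sf cK KD f0; have clK : closed K by exact: (compact_closed (@norm_hausdorff _ _)).
have sub : closure [set x | f x != 0] `<=` K.
  rewrite closureE; apply: smallest_sub => // x /= fx.
  by apply: contrapT => /f0 /eqP; rewrite (negbTE fx).
split => //; last exact: subset_trans KD.
by apply: subclosed_compact sub => //; exact: closed_closure.
Qed.

Lemma partial_shift f (s : T) l : partial l (fun x : T => f (x + s)) = fun x : T => partial l f (x + s).
Proof.
apply/funext => x; rewrite /partial /derive /=.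
by under [in LHS]eq_fun do rewrite -addrA.
Qed.

Lemma measurable_dquot l f j : measurable_fun setT f -> measurable_fun setT (dquot l f j).
Proof.
move=> mf; apply: measurable_funM => //; apply: measurable_funB => //.
exact: measurable_fun_shift.
Qed.

Section cube.
Variables (D : set T) (l : 'I_n) (a b : T -> R) (c : T) (r : R).
Hypotheses (r0 : 0 < r) (ab : rweak D l a b) (cD : cball c (2 * r) `<=` D).

Let Q : set T := ball c r.
Let Q2 : set T := ball c (2 * r).
Let a2 : T -> R := a \_ Q2.
Let b2 : T -> R := b \_ Q2.

Let mQ2 : measurable Q2. Proof. exact: measurable_ball_rV. Qed.

Let Q2D : Q2 `<=` D.
Proof. by apply: subset_trans cD; exact: sub_ball_cball. Qed.

Let ma : measurable_fun setT a. Proof. by case: ab => -[]. Qed.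
Let mb : measurable_fun setT b. Proof. by case: ab => _ []. Qed.

Let mpatch f : measurable_fun setT f -> measurable_fun setT (f \_ Q2).
Proof.
move=> mf; apply: (measurable_restrictT f mQ2).1.
exact: measurable_funTS. Qed.

Let iQ2 f : L1loc D f -> mu.-integrable Q2 (EFin \o f).
Proof.
move=> [mf hf]; apply: (@integrableS _ _ _ _ (cball c (2 * r))) => //.
- by apply: compact_measurable_rV; exact: cball_compact.
- exact: sub_ball_cball.
- by apply: hf => //; exact: cball_compact.
Qed.

Let ipatch f : L1loc D f -> mu.-integrable setT (EFin \o (f \_ Q2)).
Proof.
move=> hf; rewrite (_ : _ \o _ = (EFin \o f) \_ Q2); last first.
  by apply/funext => x; rewrite /= !patchE; case: ifP.
by apply: (integrable_mkcond _ mQ2).1; exact: iQ2.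
Qed.

Variable eta : T -> R.
Hypothesis beta : signed_bump c r eta.

Let seta : smooth eta. Proof. by case: beta. Qed.
Let eta0 x : ~ Q x -> eta x = 0. Proof. by case: beta => _ _ h nQ; exact: h. Qed.

(* pairing of [a] with the translates of [eta]: differentiable in [s], with
   the pairing of [b] with these translates as derivative *)
Let A (s : R) : R := \int[mu]_y (a2 y * eta (y - s *: e_ l)).

Let QQ2 : Q `<=` Q2.
Proof. by apply: le_ball; rewrite ler_peMl ?ler1n// ltW. Qed.

Let partial_bounded : exists2 M, 0 <= M & forall x, `|partial l eta x| <= M.
Proof.
apply: (@continuous_supp_bounded _ _ (cball c r)); first exact: cball_compact.
- exact/smooth_continuous/smooth_partial.
- apply: partial_supp; first exact: cball_closed.
  by move=> x nx; apply: eta0 => /sub_ball_cball.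
Qed.

Let shift_ball (s : R) x : `|s| * `|e_ l : T| < r -> cball c r (x - s *: e_ l) -> Q2 x.
Proof.
move=> sr h; rewrite /Q2 mx_norm_ball /ball_/=.
rewrite -(subrKA (x - s *: e_ l)) (le_lt_trans (ler_normD _ _))//.
rewrite [X in _ + X](_ : _ = `|s| * `|e_ l : T|); last first.
  by rewrite addrAC subrr add0r normrN normrZ.
by rewrite mulrDl mul1r ler_ltD.
Qed.

Let shift_out (s : R) x : `|s| * `|e_ l : T| < r -> ~ Q2 x -> eta (x - s *: e_ l) = 0.
Proof.
by move=> sr nx; apply: eta0 => /sub_ball_cball h; apply: nx; exact: shift_ball h.
Qed.

Let partial_out (s : R) x : `|s| * `|e_ l : T| < r -> ~ Q2 x -> partial l eta (x - s *: e_ l) = 0.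
Proof.
move=> sr nx; apply: (@partial_supp _ _ (cball c r)); first exact: cball_closed.
  by move=> y ny; apply: eta0 => /sub_ball_cball.
by move=> h; apply: nx; exact: shift_ball h.
Qed.

Let ia2 : mu.-integrable setT (EFin \o a2).
Proof. by apply: ipatch; case: ab. Qed.

Let ib2 : mu.-integrable setT (EFin \o b2).
Proof. by apply: ipatch; case: ab. Qed.

Let meta (s : T) : measurable_fun setT (fun x : T => eta (x + s)).
Proof. by apply: measurable_fun_shift; exact: smooth_measurable. Qed.

Let eta1 x : `|eta x| <= 1. Proof. by case: beta. Qed.

Let dpair (s : R) y : is_derive (s : R) (1 : R) (fun t : R => a2 y * eta (y - t *: e_ l))
   (- (a2 y * partial l eta (y - s *: e_ l))).
Proof.
have h (t : R) : is_derive (t : R) (1 : R) (fun t : R => eta (y + t *: e_ l)) (partial l eta (y + t *: e_ l)).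
  exact/is_derive_line/smooth_differentiable.
have hN : is_derive (s : R) (1 : R) (fun t : R => - t) (- 1).
  exact: (is_deriveN (is_derive_id _ _)).
have := is_derive1_comp (h (- s)) hN => h2.
have := is_deriveZ (a2 y) h2.
rewrite (_ : _ *: _ = - (a2 y * partial l eta (y - s *: e_ l))); last first.
  by rewrite scaleNr mulrN1 -[LHS]/(_ * _) mulrN.
rewrite (_ : _ \*: _ = (fun t : R => a2 y * eta (y - t *: e_ l)))//.
by apply/funext => t /=; rewrite scaleNr.
Qed.

Let dA (s : R) : is_derive (s : R) (1 : R) A (- \int[mu]_y (a2 y * partial l eta (y - s *: e_ l))).
Proof.
have [M M0 hM] := partial_bounded.
have sI : (`](s - 1), (s + 1)[%classic : set R) s by rewrite /= in_itv/= ltrBlDr ltrDl ltr01.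
have iA (t : R) : (`](s - 1), (s + 1)[%classic : set R) t ->
    mu.-integrable setT (EFin \o (fun y : T => a2 y * eta (y - t *: e_ l))).
  move=> _; apply: (@integrable_mul_bounded _ _ _ _ _ 1) => //; exact: mpatch.
have dd (t : R) y : (`](s - 1), (s + 1)[%classic : set R) t -> [set: T] y ->
    derivable (fun t : R => a2 y * eta (y - t *: e_ l)) t 1.
  by move=> _ _; have [] := dpair t y.
have iG : mu.-integrable setT (EFin \o (fun y : T => M * `|a2 y|)).
  under [_ \o _]eq_fun do rewrite /= EFinM.
  by apply: integrableZl => //; exact: integrable_norm.
have hG (t : R) y : (`](s - 1), (s + 1)[%classic : set R) t -> [set: T] y ->
    `|partial1of2 (fun t y => a2 y * eta (y - t *: e_ l)) t y| <= M * `|a2 y|.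
  move=> _ _; rewrite partial1of2E (@derive_val _ _ _ _ _ _ _ (dpair t y)) normrN normrM mulrC.
  by rewrite ler_wpM2r.
have G0 y : 0 <= M * `|a2 y| by rewrite mulr_ge0.
have h1 := @derivable_under_integral R _ _ mu _ _ measurableT _ _ _ sI iA dd _ G0 iG hG.
have h2 := @differentiation_under_integral R _ _ mu _ _ measurableT _ _ _ sI iA dd _ G0 iG hG.
split => //; rewrite -derive1E h2 -RintegralN//.
  by apply: eq_Rintegral => y _; rewrite partial1of2E (@derive_val _ _ _ _ _ _ _ (dpair s y)).
apply: (@integrable_mul_bounded _ _ _ _ _ M) => //; first exact: mpatch.
apply: measurable_fun_shift; apply: smooth_measurable; exact: smooth_partial.
Qed.

Let patch_int f g : (forall x, ~ Q2 x -> g x = 0) ->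
  \int[mu]_(x in D) (f x * g x) = \int[mu]_x ((f \_ Q2) x * g x).
Proof.
move=> g0; rewrite (@Rintegral_supp _ Q2)//; last by move=> x /g0 ->; rewrite mulr0.
rewrite (@Rintegral_supp setT Q2)//; last by move=> x /g0 ->; rewrite mulr0.
by apply: eq_Rintegral => x xQ; rewrite patchE xQ.
Qed.

Let dAE (s : R) : `|s| * `|e_ l : T| < r ->
  - (\int[mu]_y (a2 y * partial l eta (y - s *: e_ l))) =
  \int[mu]_y (b2 (y + s *: e_ l) * eta y).
Proof.
move=> sr; have [_ _ /(_ (fun x => eta (x - s *: e_ l)))] := ab.
have tf : test_function D (fun x : T => eta (x - s *: e_ l)).
  apply: (@test_functionP D (cball c (2 * r))) => //.
  - exact: smooth_shift.
  - exact: cball_compact.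
  - by move=> x nx; apply: shift_out => // /sub_ball_cball.
move=> /(_ tf); rewrite partial_shift patch_int; last by move=> x; exact: partial_out.
rewrite -/a2 => ->; rewrite opprK patch_int; last by move=> x; exact: shift_out.
rewrite -(@Rintegral_shift (s *: e_ l)); last by apply: measurable_funM => //; exact: mpatch.
by apply: eq_Rintegral => x _; rewrite addrK.
Qed.

Let imul f (s : T) : mu.-integrable setT (EFin \o f) -> measurable_fun setT f ->
  mu.-integrable setT (EFin \o (fun x : T => f (x + s) * eta x)).
Proof.
move=> fi mf; apply: (@integrable_mul_bounded _ _ _ _ _ 1) => //.
- exact: measurable_fun_shift.
- exact: smooth_measurable.
- apply/integrable_N1 => //; first exact: measurable_fun_shift.
  by rewrite N1_shift//; exact/integrable_N1.
Qed.

Let mb2 : measurable_fun setT b2. Proof. exact: mpatch. Qed.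
Let ma2 : measurable_fun setT a2. Proof. exact: mpatch. Qed.

Let imul0 f : mu.-integrable setT (EFin \o f) -> measurable_fun setT f ->
  mu.-integrable setT (EFin \o (fun x : T => f x * eta x)).
Proof.
by move=> fi mf; have := imul 0 fi mf; under [_ \o _]eq_fun do rewrite /= addr0.
Qed.

Let ishift f (s : T) : mu.-integrable setT (EFin \o f) -> measurable_fun setT f ->
  mu.-integrable setT (EFin \o (fun x : T => f (x + s))).
Proof.
move=> fi mf; apply/integrable_N1 => //; first exact: measurable_fun_shift.
by rewrite N1_shift//; exact/integrable_N1.
Qed.

Let integrableB_ E f g : measurable E -> mu.-integrable E (EFin \o f) ->
  mu.-integrable E (EFin \o g) -> mu.-integrable E (EFin \o (fun x : T => f x - g x)).
Proof. by move=> mE fi gi; have := integrableB mE fi gi. Qed.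

Let xhQ2 (j : nat) (x : T) : j.+1%:R^-1 * `|e_ l : T| < r -> Q x ->
  (x \in Q2) /\ (x + j.+1%:R^-1 *: e_ l \in Q2).
Proof.
move=> hr xQ; split; rewrite inE; first exact: QQ2.
apply: (@shift_ball j.+1%:R^-1); last by rewrite addrK; exact: sub_ball_cball.
by rewrite gtr0_norm// invr_gt0.
Qed.

Lemma dquot_integrable (j : nat) : j.+1%:R^-1 * `|e_ l : T| < r ->
  mu.-integrable Q (EFin \o (fun x : T => dquot l a j x - b x)).
Proof.
move=> hr; have h : mu.-integrable setT (EFin \o (fun x : T => dquot l a2 j x - b2 x)).
  apply: integrableB_ => //; rewrite /dquot.
  under [_ \o _]eq_fun do rewrite /= EFinM.
  by apply: integrableZl => //; apply: integrableB_ => //; exact: ishift.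
have mQ : measurable Q by exact: measurable_ball_rV.
apply: eq_integrable (integrableS measurableT mQ (@subsetT _ _) h) => //.
move=> x; rewrite inE => xQ; have [h1 h2] := xhQ2 hr xQ.
by rewrite /= /dquot /a2 /b2 !patchE h1 h2.
Qed.

(** By the mean value theorem for [A], the difference quotient of [a] paired
    with [eta] is the pairing of [eta] with a translate of [b] by at most the
    step of the quotient. *)
Lemma dquot_pairing (j : nat) (w : R) : j.+1%:R^-1 * `|e_ l : T| < r ->
  (forall t : R, `|t| <= j.+1%:R^-1 ->
    (N1 mu setT (fun x => b2 (x + t *: e_ l) - b2 x)%R <= w%:E)%E) ->
  (\int[mu]_(x in Q) ((dquot l a j x - b x) * eta x)%:E <= w%:E)%E.
Proof.
set h : R := j.+1%:R^-1 => hr hw.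
have h0 : 0 < h by rewrite invr_gt0.
have hn : `|h| = h by rewrite gtr0_norm.
have [t /andP[t0 th] At] : exists2 t, 0 <= t <= h &
    A h - A 0 = (- (\int[mu]_y (a2 y * partial l eta (y - t *: e_ l)))) * (h - 0).
  have := @MVT_segment R A (fun t : R => - \int[mu]_y (a2 y * partial l eta (y - t *: e_ l)))
    0 h (ltW h0) (fun t _ => dA t).
  case; last by move=> t; rewrite in_itv/= => ? ?; exists t.
  by apply: derivable_within_continuous => t _; have [] := dA t.
have tn : `|t| <= h by rewrite ger0_norm.
have tr : `|t| * `|e_ l : T| < r by apply: le_lt_trans hr; rewrite ler_wpM2r.
have key : \int[mu]_(x in Q) ((dquot l a j x - b x) * eta x) =
    \int[mu]_x ((b2 (x + t *: e_ l) - b2 x) * eta x).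
  rewrite [LHS](_ : _ = \int[mu]_x (j.+1%:R * (a2 (x + h *: e_ l) * eta x - a2 x * eta x) - b2 x * eta x)); last first.
    transitivity (\int[mu]_x ((dquot l a2 j x - b2 x) * eta x)).
      rewrite [RHS](@Rintegral_supp setT Q)//; last by move=> x /eta0 ->; rewrite mulr0.
      apply: eq_Rintegral => x; rewrite inE => xQ; congr (_ * _).
      have [h1 h2] := xhQ2 hr xQ.
      by rewrite /dquot /a2 /b2 !patchE h1 h2.
    by apply: eq_Rintegral => x _; rewrite /dquot -/h; ring.
  have i1 := imul (h *: e_ l) ia2 ma2; have i2 := imul0 ia2 ma2; have i3 := imul0 ib2 mb2.
  have i4 := imul (t *: e_ l) ib2 mb2.
  have i12 : mu.-integrable setT (EFin \o (fun x : T => a2 (x + h *: e_ l) * eta x - a2 x * eta x)).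
    exact: integrableB_.
  have i12' : mu.-integrable setT (EFin \o (fun x : T => j.+1%:R * (a2 (x + h *: e_ l) * eta x - a2 x * eta x))).
    by under [_ \o _]eq_fun do rewrite /= EFinM; exact: integrableZl.
  rewrite RintegralB// RintegralZl// RintegralB//.
  have -> : \int[mu]_x (a2 (x + h *: e_ l) * eta x) = A h.
    rewrite /A -[RHS](@Rintegral_shift (h *: e_ l)); last exact: measurable_funM.
    by apply: eq_Rintegral => x _; rewrite addrK.
  have -> : \int[mu]_x (a2 x * eta x) = A 0.
    by apply: eq_Rintegral => x _; rewrite scale0r subr0.
  rewrite At dAE// subr0 mulrCA /h mulfV ?pnatr_eq0// mulr1 -RintegralB//.
  by apply: eq_Rintegral => x _; rewrite mulrBl.
have i5 : mu.-integrable setT (EFin \o (fun x : T => (b2 (x + t *: e_ l) - b2 x) * eta x)).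
  under [_ \o _]eq_fun do rewrite /= mulrBl.
  by apply: integrableB_ => //; [exact: imul|exact: imul0].
have hw' := hw t tn.
have -> : (\int[mu]_(x in Q) ((dquot l a j x - b x) * eta x)%:E)%E =
    (\int[mu]_(x in Q) ((dquot l a j x - b x) * eta x))%:E.
  rewrite /Rintegral fineK//; apply: integrable_fin_num => //.
    exact: measurable_ball_rV.
  apply: (@integrable_mul_bounded _ _ _ _ _ 1) => //.
  - exact: measurable_ball_rV.
  - by apply: measurable_funB => //; exact: measurable_dquot.
  - exact: smooth_measurable.
  - exact: dquot_integrable.
rewrite key /Rintegral fineK; last exact: integrable_fin_num.
apply: le_trans hw'; apply: le_integral => //.
  by apply: integrable_norm; apply: integrableB_ => //; exact: ishift.
move=> x _; rewrite lee_fin; apply: le_trans (ler_norm _) _.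
by rewrite normrM ler_piMr.
Qed.

End cube.

End weak_to_strong.

Section strong_calculus.
Context {R : realType} {n : nat}.
Local Notation T := 'rV[R]_n.
Local Notation mu := (@lebesgue_rV R n).
Implicit Types (D : set T) (f g a b : T -> R) (l : 'I_n).

Local Notation e_ l := (delta_mx 0 l : T).

Lemma near_invS_lt (e : R) : 0 < e -> \forall j \near \oo, (j.+1%:R^-1 : R) < e.
Proof. by move=> e0; exact: (near_infty_natSinv_lt (PosNum e0)). Qed.

(** Paired with a bump, a difference quotient of [a] is a translate of [b]
    ([dquot_pairing]).  Duality turns this into an estimate of the norm of
    [dquot l a j - b] by that of [b] minus its translates, which is small. *)
Lemma rweak_strong D l a b : open D -> rweak D l a b -> strong D l a b.
Proof.
move=> oD ab; have [la lb _] := ab; have [ma _] := la; have [mb _] := lb.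
split => // K cK KD.
have mF j : measurable_fun setT (fun x : T => dquot l a j x - b x).
  by apply: measurable_funB => //; exact: measurable_dquot.
split => //.
pose P (A : set T) := measurable A /\ to0 (fun j => N1 mu A (fun x : T => dquot l a j x - b x)).
have [|A B [mA hA] [mB hB]|x Dx|A KA [mA hA]] := @compact_ball_ind _ _ P K D cK KD.
- split => // e e0; apply: nearW => j.
  by rewrite /N1 integral_set0 lee_fin ltW.
- split; first exact: measurableU.
  by apply: to0_le (to0D hA hB); apply: nearW => j; exact: N1U.
- have [r r0 xr] := open_cball oD Dx.
  have r20 : 0 < r / 2 by rewrite divr_gt0.
  (* half the radius, because translates of bumps reach into the doubled cube *)
  exists (r / 2) => //; split; first exact: measurable_ball_rV.
  move=> e e0.
  have e2 : 2 * (r / 2) = r by field.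
  have xD : cball x (2 * (r / 2)) `<=` D by rewrite e2.
  pose Q2 : set T := ball x (2 * (r / 2)).
  have mQ2 : measurable Q2 by exact: measurable_ball_rV.
  have mb2 : measurable_fun setT (b \_ Q2).
    by apply: (measurable_restrictT b mQ2).1; exact: measurable_funTS.
  have ib2 : mu.-integrable Q2 (EFin \o (b \_ Q2)).
    have ib : mu.-integrable Q2 (EFin \o b).
      apply: (@integrableS _ _ _ _ (cball x (2 * (r / 2)))) => //.
      - by apply: compact_measurable_rV; exact: cball_compact.
      - exact: sub_ball_cball.
      - by case: lb => _; apply => //; exact: cball_compact.
    by apply: eq_integrable ib => // y yQ; rewrite /= patchE yQ.
  have Q20 : 0 < 2 * (r / 2) by rewrite e2.
  have bout y : ~ Q2 y -> (b \_ Q2) y = 0 by move=> ny; rewrite patchE memNset.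
  have [d d0 hd] := @translation_continuity _ _ x (2 * (r / 2)) (b \_ Q2) l e Q20 mb2 ib2
    bout e0.
  have el0 : 0 < `|e_ l| + 1 by rewrite ltr_wpDl// normr_ge0.
  have rel : 0 < r / 2 / (`|e_ l| + 1) by rewrite divr_gt0.
  apply: filterS2 (near_invS_lt d0) (near_invS_lt rel) => j jd jr.
  have jr' : j.+1%:R^-1 * `|e_ l| < r / 2.
    apply: (@le_lt_trans _ _ (j.+1%:R^-1 * (`|e_ l| + 1))); first by rewrite ler_wpM2l// lerDl.
    by rewrite -ltr_pdivlMr.
  apply: (L1_duality r20 (mF j) (dquot_integrable r20 ab xD jr')).
  move=> eta beta; apply: (dquot_pairing r20 ab xD beta jr') => t tj.
  by apply: hd; exact: le_trans tj (ltW jd).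
have mK := compact_measurable_rV cK.
by apply: to0_le hA; apply: nearW => j; exact: le_N1_set.
Qed.

Lemma strong_unique D l a b b' : open D -> strong D l a b -> strong D l a b' ->
  {ae mu, forall x, D x -> b x = b' x}.
Proof.
move=> oD [[ma _] [mb _] ab] [_ [mb' _] ab'].
have mbb : measurable_fun setT (fun x : T => b x - b' x) by exact: measurable_funB.
have hK K : compact K -> K `<=` D -> N1 mu K (fun x : T => b x - b' x) = 0%E.
  move=> cK KD; have [mF hF] := ab _ cK KD; have [mG hG] := ab' _ cK KD.
  have mK := compact_measurable_rV cK.
  apply: to0_cst; first exact: N1_ge0.
  apply: to0_le (to0D hF hG); apply: nearW => j; apply: le_N1D => // x _.
  rewrite (_ : b x - b' x = (dquot l a j x - b' x) - (dquot l a j x - b x)); last by ring.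
  by rewrite [leRHS]addrC; exact: ler_normB.
have [c [r [cD ->]]] := open_cubes oD.
have hk k : {ae mu, forall x, ball (c k) (r k) x -> b x = b' x}.
  have [rk|rk] := ltP 0 (r k); last first.
    by apply: aeW => x [r0]; move: (lt_le_trans r0 rk); rewrite ltxx.
  have h0 : (\int[mu]_(x in ball (c k) (r k)) `|(b x - b' x)%:E| = 0)%E.
    apply/eqP; rewrite eq_le integral_ge0// andbT -(hK (cball (c k) (2 * r k)))//.
    - apply: le_N1_set => //; first exact: measurable_ball_rV.
        by apply: compact_measurable_rV; exact: cball_compact.
      apply: subset_trans (@sub_ball_cball _ _ _ _) _; apply: sub_cball.
      by rewrite subrr normr0 add0r ler_peMl ?ler1n// ltW.
    - exact: cball_compact.
    - exact: cD.
  have mk : measurable (ball (c k) (r k)) by exact: measurable_ball_rV.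
  have mbE : measurable_fun (ball (c k) (r k)) (fun x : T => (b x - b' x)%:E).
    by apply: measurable_funTS; exact/measurable_EFinP.
  move/(ae_eq_integral_abs _ mk mbE) : h0; apply: filterS => x h xk.
  by apply/eqP; rewrite -subr_eq0; have := h xk; rewrite /= => -[->].
by apply: filterS (ae_foralln hk) => x h [k _ xk]; exact: (h k).
Qed.

Lemma L1to0_shift D l f f' K : strong D l f f' -> compact K -> K `<=` D ->
  L1to0 mu K (fun (j : nat) (x : T) => f (x + j.+1%:R^-1 *: e_ l) - f x).
Proof.
move=> [[mf _] [mf' hf'] ff'] cK KD; have mK := compact_measurable_rV cK.
have [mF hF] := ff' _ cK KD.
have fi' : (N1 mu K f' < +oo)%E by apply/integrable_N1 => //; exact: hf'.
split => [j|].
  by apply: measurable_funB => //; exact: measurable_fun_shift.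
pose m := fine (N1 mu K f').
have mE : N1 mu K f' = m%:E by rewrite /m fineK// ge0_fin_numE// N1_ge0.
have m0 : 0 <= m by rewrite fine_ge0// N1_ge0.
have hm : to0 (fun j => (j.+1%:R^-1 * m)%:E).
  move=> e e0; have em : 0 < e / (m + 1) by rewrite divr_gt0// ltr_wpDl.
  apply: filterS (near_invS_lt em) => j je; rewrite lee_fin.
  apply: (@le_trans _ _ (j.+1%:R^-1 * (m + 1))); first by rewrite ler_wpM2l// lerDl.
  by rewrite -ler_pdivlMr ?ltr_wpDl// ltW.
apply: to0_le (to0D hF hm); apply: nearW => j.
rewrite EFinM -mE.
have -> : (j.+1%:R^-1%:E * N1 mu K f' = N1 mu K (fun x : T => (j.+1%:R^-1 * f' x)%R))%E.
  by rewrite N1Z// ger0_norm.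
apply: le_N1D => //; first by apply: measurable_funB => //; exact: measurable_fun_shift.
  exact: measurable_funM.
move=> x _.
have -> : f (x + j.+1%:R^-1 *: e_ l) - f x =
    j.+1%:R^-1 * (dquot l f j x - f' x) + j.+1%:R^-1 * f' x.
  by rewrite -mulrDr subrK /dquot mulrA mulVf ?mul1r// pnatr_eq0.
rewrite (le_trans (ler_normD _ _))// lerD2r normrM ler_piMl//.
by rewrite ger0_norm// invf_le1// ler1n.
Qed.

Definition bounded_fun_by (M : R) f := forall x, `|f x| <= M.

Lemma L1loc_bounded D f M : measurable_fun setT f -> bounded_fun_by M f -> L1loc D f.
Proof.
move=> mf fM; split => // K cK KD; have mK := compact_measurable_rV cK.
apply: measurable_bounded_integrable => //; first exact: compact_mu_lty.
  exact: measurable_funTS.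
exists M; split; first exact: num_real.
by move=> B MB x _; exact: le_trans (fM x) (ltW MB).
Qed.

Lemma L1locD D f g : L1loc D f -> L1loc D g -> L1loc D (fun x : T => f x + g x).
Proof.
move=> [mf hf] [mg hg]; split; first exact: measurable_funD.
move=> K cK KD; have mK := compact_measurable_rV cK.
by have := integrableD mK (hf _ cK KD) (hg _ cK KD).
Qed.

Lemma L1locM D f g M : L1loc D f -> measurable_fun setT g -> bounded_fun_by M g ->
  L1loc D (fun x : T => f x * g x).
Proof.
move=> [mf hf] mg gM; split; first exact: measurable_funM.
move=> K cK KD; have mK := compact_measurable_rV cK.
by apply: (@integrable_mul_bounded _ _ _ _ _ M) => //; exact: hf.
Qed.

Lemma eq_L1loc D f g : f =1 g -> L1loc D f -> L1loc D g.
Proof. by move=> /funext ->. Qed.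

(** The translates of [g] converge to [g] in mean only; boundedness of [g] then
    allows the multiplication by the integrable function [f']. *)
Lemma strongM D l f f' g g' M : strong D l f f' -> strong D l g g' ->
  bounded_fun_by M f -> bounded_fun_by M g ->
  strong D l (fun x : T => f x * g x) (fun x : T => f' x * g x + f x * g' x).
Proof.
move=> sf sg fM gM; have [[mf _] lf' hf] := sf; have [[mg _] lg' hg] := sg.
have [mf' _] := lf'; have [mg' _] := lg'.
have M0 : 0 <= M by apply: le_trans (fM 0).
split.
- apply: (@L1loc_bounded _ _ (M * M)); first exact: measurable_funM.
  by move=> x; rewrite normrM ler_pM.
- apply: L1locD; first exact: L1locM lf' mg gM.
  by apply: eq_L1loc (L1locM lg' mf fM) => x; rewrite mulrC.
move=> K cK KD; have mK := compact_measurable_rV cK.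
have hF := hf _ cK KD; have hG := hg _ cK KD.
have [mF _] := hF; have [mG _] := hG.
have msg j : measurable_fun setT (fun x : T => g (x + j.+1%:R^-1 *: e_ l)).
  exact: measurable_fun_shift.
have h1 : L1to0 mu K (fun (j : nat) (x : T) => (dquot l f j x - f' x) * g (x + j.+1%:R^-1 *: e_ l)).
  apply: L1to0_le (L1to0Z M mK hF) => //; first by move=> j; exact: measurable_funM.
  by apply: nearW => j x _; rewrite mulrC !normrM (ger0_norm M0) ler_wpM2r// gM.
have h2 : L1to0 mu K (fun (j : nat) (x : T) => f' x * (g (x + j.+1%:R^-1 *: e_ l) - g x)).
  apply: (@L1to0_weight _ _ _ _ _ _ _ (M + M)) => //.
  - by case: lf' => _; apply.
  - by move=> j x _; rewrite (le_trans (ler_normB _ _))// lerD ?gM.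
  - exact: L1to0_shift sg cK KD.
have h3 : L1to0 mu K (fun (j : nat) (x : T) => f x * (dquot l g j x - g' x)).
  apply: L1to0_le (L1to0Z M mK hG) => //; first by move=> j; exact: measurable_funM.
  by apply: nearW => j x _; rewrite !normrM (ger0_norm M0) ler_wpM2r// fM.
have := L1to0D mK (L1to0D mK h1 h2) h3.
rewrite (_ : (fun (j : nat) (x : T) => _) = (fun (j : nat) (x : T) => dquot l (fun x : T => f x * g x) j x - (f' x * g x + f x * g' x)))//.
by apply/funext => j; apply/funext => x; rewrite /dquot; ring.
Qed.

(** With [delta] the increment of [v], the Taylor remainder is at most
    [min (2 M) (L |delta|) |delta|].  The first factor is bounded and tends to 0
    in mean, while the second, divided by the step, converges in mean. *)
Lemma strong_comp D l v v' (F F' : R -> R) (L M B : R) : strong D l v v' ->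
  measurable_fun setT F -> measurable_fun setT F' ->
  (forall s t, `|F t - F s - F' s * (t - s)| <= L * `|t - s| ^+ 2) ->
  (forall s t, `|F t - F s| <= M * `|t - s|) -> (forall s, `|F' s| <= M) ->
  (forall s, `|F s| <= B) ->
  strong D l (fun x : T => F (v x)) (fun x : T => F' (v x) * v' x).
Proof.
move=> sv mF mF' FL FM F'M FB; have [[mv _] lv' hv] := sv; have [mv' _] := lv'.
have mFv : measurable_fun setT (fun x : T => F (v x)) by exact: measurableT_comp mF mv.
have mF'v : measurable_fun setT (fun x : T => F' (v x)) by exact: measurableT_comp mF' mv.
have M0 : 0 <= M by apply: le_trans (F'M 0).
have L0 : 0 <= L.
  by have := FL 0 1; rewrite subr0 normr1 expr1n !mulr1 => h; exact: le_trans (normr_ge0 _) h.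
split.
- by apply: (@L1loc_bounded _ _ B) => // x; exact: FB.
- apply: (@eq_L1loc _ (fun x : T => v' x * F' (v x))); first by move=> x; rewrite mulrC.
  by apply: L1locM lv' mF'v _ => x; exact: F'M.
move=> K cK KD; have mK := compact_measurable_rV cK.
have hV := hv _ cK KD; have [mV _] := hV.
have sV := L1to0_shift sv cK KD; have [msV _] := sV.
pose del j x := v (x + j.+1%:R^-1 *: e_ l) - v x.
have mmin j : measurable_fun setT (fun x : T => Num.min (2 * M) (L * `|del j x|)).
  apply: measurable_minr => //; apply: measurable_funM => //.
  by apply: measurableT_comp => //; exact: msV.
have min0 j x : 0 <= Num.min (2 * M) (L * `|del j x|) by rewrite le_min !mulr_ge0.
have h1 : L1to0 mu K (fun (j : nat) (x : T) => v' x * Num.min (2 * M) (L * `|del j x|)).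
  apply: (@L1to0_weight _ _ _ _ _ _ _ (2 * M)) => //.
  - by case: lv' => _; apply.
  - by move=> j x _; rewrite ger0_norm// ge_min lexx.
  - apply: L1to0_le (L1to0Z L mK sV) => //; apply: nearW => j x _.
    by rewrite ger0_norm// normrM (ger0_norm L0) ge_min lexx orbT.
have h2 := L1to0Z (3 * M) mK hV.
apply: (@L1to0_le _ _ _ _ _ _ (fun (j : nat) (x : T) => `|v' x * Num.min (2 * M) (L * `|del j x|)| + `|3 * M * (dquot l v j x - v' x)|)) => //.
- move=> j; apply: measurable_funB; first exact: measurable_dquot.
  exact: measurable_funM.
- apply: nearW => j x _; rewrite [leRHS]ger0_norm ?addr_ge0//.
  have -> : dquot l (fun x : T => F (v x)) j x - F' (v x) * v' x =
     j.+1%:R * (F (v (x + j.+1%:R^-1 *: e_ l)) - F (v x) - F' (v x) * del j x) +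
     F' (v x) * (dquot l v j x - v' x).
    by rewrite /dquot /del; ring.
  rewrite (le_trans (ler_normD _ _))//.
  (* small increments: the Taylor remainder; large ones: twice the Lipschitz bound *)
  have q1 : `|F (v (x + j.+1%:R^-1 *: e_ l)) - F (v x) - F' (v x) * del j x| <=
      Num.min (2 * M) (L * `|del j x|) * `|del j x|.
    rewrite /Num.min; case: ifP => _; last by rewrite -mulrA -expr2; exact: FL.
    rewrite (le_trans (ler_normB _ _))// mulrDl mul1r mulrDl lerD ?FM//.
    by rewrite normrM ler_wpM2r.
  have q2 : j.+1%:R * `|del j x| = `|dquot l v j x|.
    by rewrite /dquot normrM ger0_norm.
  rewrite normrM (ger0_norm (ler0n _ _)).
  apply: (@le_trans _ _ (Num.min (2 * M) (L * `|del j x|) * `|dquot l v j x| + M * `|dquot l v j x - v' x|)).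
    rewrite lerD//; last by rewrite normrM ler_wpM2r.
    by rewrite -q2 mulrCA ler_wpM2l.
  rewrite [`|v' x * _|]normrM (ger0_norm (min0 j x)) [`|3 * M * _|]normrM (ger0_norm (_ : 0 <= 3 * M)) ?mulr_ge0//.
  have q3 : `|dquot l v j x| <= `|v' x| + `|dquot l v j x - v' x|.
    by rewrite -[X in `|X| <= _](subrK (v' x)) addrC; exact: ler_normD.
  apply: (@le_trans _ _ (Num.min (2 * M) (L * `|del j x|) * (`|v' x| + `|dquot l v j x - v' x|) + M * `|dquot l v j x - v' x|)).
    by rewrite lerD2r ler_wpM2l.
  rewrite mulrDr -addrA mulrC lerD2l -mulrDl ler_wpM2r//.
  have : Num.min (2 * M) (L * `|del j x|) <= 2 * M by rewrite ge_min lexx.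
  by lra.
- split=> [j|].
    apply: measurable_funD; apply: measurableT_comp => //; first exact: measurable_funM.
    by apply: measurable_funM => //; exact: mV.
  have [_ h1'] := h1; have [_ h2'] := h2.
  apply: to0_le (to0D h1' h2'); apply: nearW => j; apply: le_N1D => //.
  + apply: measurable_funD; apply: measurableT_comp => //; first exact: measurable_funM.
    by apply: measurable_funM => //; exact: mV.
  + exact: measurable_funM.
  + by apply: measurable_funM => //; exact: mV.
  + by move=> x _; rewrite ger0_norm ?addr_ge0.
Qed.

End strong_calculus.

Section strong_integration.
Context {R : realType} {n : nat}.
Local Notation T := 'rV[R]_n.
Local Notation mu := (@lebesgue_rV R n).
Implicit Types (D : set T) (f g a b : T -> R) (l : 'I_n).

Local Notation e_ l := (delta_mx 0 l : T).

Lemma dquot_cvg l f (x : T) : derivable f x (e_ l) ->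
  dquot l f j x @[j --> \oo] --> partial l f x.
Proof.
move=> df; have h0 : (forall j : nat, (j.+1%:R^-1 : R) != 0) /\ (j.+1%:R^-1 : R) @[j --> \oo] --> (0 : R).
  by split; [move=> j; rewrite invr_eq0 pnatr_eq0|exact: cvg_harmonic].
have : (fun h : R => h^-1 *: ((f \o shift x) (h *: e_ l) - f x)) @ 0^' --> partial l f x by exact: df.
move=> /cvgr_dnbhsP/(_ _ h0); apply: cvg_trans.
rewrite (_ : dquot l f ^~ x = (fun j : nat => (j.+1%:R^-1)^-1 *: ((f \o shift x) (j.+1%:R^-1 *: e_ l) - f x)))//.
by apply/funext => j; rewrite /dquot invrK /= (addrC x).
Qed.

(** By the mean value theorem [M] also bounds the difference quotients, which
    converge pointwise: dominated convergence applies. *)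
Lemma strong_lipschitz D l f (B M : R) : measurable_fun setT f ->
  (forall x, derivable f x (e_ l)) -> bounded_fun_by B f ->
  bounded_fun_by M (partial l f) -> strong D l f (partial l f).
Proof.
move=> mf df fB fM.
have mdf : measurable_fun setT (partial l f).
  apply: (@measurable_fun_cvg _ _ _ setT (dquot l f)) => //.
    by move=> j; exact: measurable_dquot.
  by move=> x _; exact: dquot_cvg.
split.
- exact: L1loc_bounded fB.
- exact: L1loc_bounded fM.
move=> K cK KD; have mK := compact_measurable_rV cK.
apply: (@L1to0_dct _ _ _ _ _ _ (fun _ => M + M)) => //.
- by move=> j; apply: measurable_funB => //; exact: measurable_dquot.
- apply: measurable_bounded_integrable => //; first exact: compact_mu_lty.
  by exists `|M + M|; split; [exact: num_real|move=> C MC x _; exact: ltW].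
- by apply: aeW => x _; apply/subr_cvg0; exact: dquot_cvg.
- apply: aeW => x j _; rewrite (le_trans (ler_normB _ _))// lerD ?fM//.
  rewrite /dquot normrM ger0_norm// mulrC -ler_pdivlMr ?ltr0n//.
  have := line_lipschitz df fM x j.+1%:R^-1.
  by rewrite (ger0_norm (_ : 0 <= j.+1%:R^-1))// invr_ge0.
Qed.

(** A difference quotient has integral 0 by translation invariance. *)
Lemma strong_integral0 D K l f f' : open D -> compact K -> K `<=` D ->
  strong D l f f' -> (forall x, ~ K x -> f x = 0) -> (forall x, ~ K x -> f' x = 0) ->
  \int[mu]_(x in D) f' x = 0.
Proof.
move=> oD cK KD sf f0 f'0; have [[mf lf] [mf' lf'] hf] := sf.
have [e e0 [cK' K'D]] := compact_nbhd cK oD KD.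
set K' := thicken K e in cK' K'D.
have mK' := compact_measurable_rV cK'.
have KK' : K `<=` K' by move=> x Kx; exists x => //; rewrite subrr normr0 ltW.
have [mF hF] := hf _ cK' K'D.
rewrite (@Rintegral_supp _ _ _ K')//; last by move=> x nx; apply: f'0 => /KK'.
have el0 : 0 < `|e_ l| + 1 by rewrite ltr_wpDl// normr_ge0.
have eel : 0 < e / (`|e_ l| + 1) by rewrite divr_gt0.
have if_ : mu.-integrable setT (EFin \o f).
  by apply: (@integrable_supp _ _ _ K') => //; [move=> x nx; apply: f0 => /KK'|exact: lf].
have ifs (s : T) : mu.-integrable setT (EFin \o (fun x : T => f (x + s))).
  apply/integrable_N1 => //; first exact: measurable_fun_shift.
  by rewrite N1_shift//; exact/integrable_N1.
have if' : mu.-integrable K' (EFin \o f') by exact: lf'.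
suff h : (`|\int[mu]_(x in K') f' x|%:E = 0)%E.
  by apply/eqP; rewrite -normr_eq0; case: h => ->.
apply: to0_cst; first by rewrite lee_fin.
apply: to0_le hF; apply: filterS (near_invS_lt eel) => j je.
have hN : j.+1%:R^-1 * `|e_ l| <= e.
  apply: (@le_trans _ _ (j.+1%:R^-1 * (`|e_ l| + 1))); first by rewrite ler_wpM2l// lerDl.
  by rewrite -ler_pdivlMr// ltW.
have dq0 x : ~ K' x -> dquot l f j x = 0.
  move=> nx; rewrite /dquot f0; last first.
    move=> Kx; apply: nx; exists (x + j.+1%:R^-1 *: e_ l) => //.
    by rewrite addrAC subrr add0r normrZ ger0_norm.
  by rewrite f0 ?subrr ?mulr0// => /KK'.
have idq : mu.-integrable setT (EFin \o dquot l f j).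
  rewrite /dquot; under [_ \o _]eq_fun do rewrite /= EFinM.
  by apply: integrableZl => //; have := integrableB measurableT (ifs (j.+1%:R^-1 *: e_ l)) if_.
have dqK : \int[mu]_(x in K') dquot l f j x = 0.
  rewrite -(@Rintegral_supp _ _ setT)//.
  rewrite /dquot RintegralZl//; last first.
    by have := integrableB measurableT (ifs (j.+1%:R^-1 *: e_ l)) if_.
  by rewrite RintegralB// Rintegral_shift// subrr mulr0.
have idqK : mu.-integrable K' (EFin \o dquot l f j).
  exact: (integrableS measurableT).
have -> : \int[mu]_(x in K') f' x = - \int[mu]_(x in K') (dquot l f j x - f' x).
  by rewrite RintegralB// dqK sub0r opprK.
rewrite normrN /N1 EFin_normr_Rintegral//; last first.
  by have := integrableB mK' idqK if'.
apply: le_abse_integral => //.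
by apply/measurable_EFinP; apply: measurable_funTS; exact: mF.
Qed.

Definition fsupport f : set T := closure [set x | f x != 0].

Lemma fsupport_out f x : ~ fsupport f x -> f x = 0.
Proof. by move=> nx; apply/eqP; apply: contra_notT nx => fx; exact: subset_closure. Qed.

Lemma test_strong D D' l f : test_function D f ->
  strong D' l f (partial l f) /\
  exists B, [/\ bounded_fun_by B f, bounded_fun_by B (partial l f) &
   forall x, ~ fsupport f x -> partial l f x = 0].
Proof.
move=> [sf cf _].
have [B B0 hB] := continuous_supp_bounded cf (smooth_continuous sf) (@fsupport_out f).
have pout := partial_supp l (@closed_closure _ _) (@fsupport_out f).
have [M M0 hM] := continuous_supp_bounded cf (smooth_continuous (smooth_partial l sf)) pout.
split.
  apply: (@strong_lipschitz _ _ _ B M) => //; first exact: smooth_measurable.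
  by move=> x; exact/diff_derivable/smooth_differentiable.
exists (Num.max B M); split => //.
- by move=> x; rewrite le_max hB.
- by move=> x; rewrite le_max hM orbT.
Qed.

Lemma strong_rweak D l f f' M : open D -> strong D l f f' -> bounded_fun_by M f ->
  rweak D l f f'.
Proof.
move=> oD sf fM; have [lf lf' _] := sf; split => // phi tphi.
have [sphi [B [pB dpB pout]]] := test_strong D l tphi.
have [smphi cK KD] := tphi; rewrite -/(fsupport phi) in cK KD.
have mK := compact_measurable_rV cK; have mD := open_measurable_rV oD.
have fM' : bounded_fun_by (Num.max M B) f by move=> x; rewrite le_max fM.
have pB' : bounded_fun_by (Num.max M B) phi by move=> x; rewrite le_max pB orbT.
have /(strong_integral0 oD cK KD) := strongM sf sphi fM' pB'.
have [mf _] := lf; have [mf' hf'] := lf'.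
have i1 : mu.-integrable D (EFin \o (fun x : T => f' x * phi x)).
  apply: (@integrable_supp _ _ _ (fsupport phi)) => //.
    by move=> x /fsupport_out ->; rewrite mulr0.
  apply: (@integrable_mul_bounded _ _ _ _ _ B) => //; first exact: smooth_measurable.
  exact: hf'.
have i2 : mu.-integrable D (EFin \o (fun x : T => f x * partial l phi x)).
  apply: (@integrable_supp _ _ _ (fsupport phi)) => //.
    by move=> x /pout ->; rewrite mulr0.
  apply: (@integrable_mul_bounded _ _ _ _ _ B) => //.
    by apply: smooth_measurable; exact: smooth_partial.
  by case: lf => _; apply.
rewrite RintegralD// => h; apply/eqP; rewrite -addr_eq0 addrC h//.
- by move=> x /fsupport_out ->; rewrite mulr0.
- by move=> x nx; rewrite (fsupport_out nx) (pout _ nx) !mulr0 addr0.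
Qed.

End strong_integration.

(** * Real and imaginary parts *)

Section complex_weak.
Context {R : realType} {n : nat}.
Local Notation T := 'rV[R]_n.
Local Notation mu := (@lebesgue_rV R n).
Implicit Types (D : set T) (f g a b : T -> R) (u v w : T -> R[i]) (l k : 'I_n).
Local Open Scope complex_scope.

Definition re u : T -> R := fun x : T => complex.Re (u x).
Definition im u : T -> R := fun x : T => complex.Im (u x).

Lemma ReD (x y : R[i]) : complex.Re (x + y) = complex.Re x + complex.Re y.
Proof. by case: x y => ? ? [? ?]. Qed.
Lemma ImD (x y : R[i]) : complex.Im (x + y) = complex.Im x + complex.Im y.
Proof. by case: x y => ? ? [? ?]. Qed.
Lemma ReN (x : R[i]) : complex.Re (- x) = - complex.Re x.
Proof. by case: x. Qed.
Lemma ImN (x : R[i]) : complex.Im (- x) = - complex.Im x.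
Proof. by case: x. Qed.
Lemma ReM (x y : R[i]) :
  complex.Re (x * y) = complex.Re x * complex.Re y - complex.Im x * complex.Im y.
Proof. by case: x y => ? ? [? ?]. Qed.
Lemma ImM (x y : R[i]) :
  complex.Im (x * y) = complex.Re x * complex.Im y + complex.Im x * complex.Re y.
Proof. by case: x y => ? ? [? ?]. Qed.
Lemma ReJ (x : R[i]) : complex.Re (conjc x) = complex.Re x.
Proof. by case: x. Qed.
Lemma ImJ (x : R[i]) : complex.Im (conjc x) = - complex.Im x.
Proof. by case: x. Qed.
Definition cE := (ReD, ImD, ReN, ImN, ReM, ImM, ReJ, ImJ).

Lemma complex_eqP (x y : R[i]) : complex.Re x = complex.Re y ->
  complex.Im x = complex.Im y -> x = y.
Proof. by case: x y => ? ? [? ?] /= -> ->. Qed.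

Lemma ReZl (r : R) (x : R[i]) : complex.Re (r%:C * x) = r * complex.Re x.
Proof. by case: x => a b /=; rewrite mul0r subr0. Qed.
Lemma ImZl (r : R) (x : R[i]) : complex.Im (r%:C * x) = r * complex.Im x.
Proof. by case: x => a b /=; rewrite mul0r addr0. Qed.
Lemma ReZr (r : R) (x : R[i]) : complex.Re (x * r%:C) = complex.Re x * r.
Proof. by case: x => a b /=; rewrite mulr0 subr0. Qed.
Lemma ImZr (r : R) (x : R[i]) : complex.Im (x * r%:C) = complex.Im x * r.
Proof. by case: x => a b /=; rewrite mulr0 add0r. Qed.

Lemma cmodulus_ge0 (z : R[i]) : 0 <= cmodulus z.
Proof. by case: z => a b; exact: sqrtr_ge0. Qed.

Lemma normRe_le (z : R[i]) : `|complex.Re z| <= cmodulus z.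
Proof.
by case: z => a b /=; rewrite -sqrtr_sqr ler_wsqrtr// lerDl sqr_ge0.
Qed.

Lemma normIm_le (z : R[i]) : `|complex.Im z| <= cmodulus z.
Proof.
by case: z => a b /=; rewrite -sqrtr_sqr ler_wsqrtr// lerDr sqr_ge0.
Qed.

Lemma cmodulus_le (z : R[i]) : cmodulus z <= `|complex.Re z| + `|complex.Im z|.
Proof.
case: z => a b; rewrite /cmodulus /= -[leRHS]ger0_norm ?addr_ge0// -sqrtr_sqr.
rewrite ler_wsqrtr// sqrrD !real_normK ?num_real// -addrA lerD2l lerDr.
by rewrite mulrn_wge0// mulr_ge0.
Qed.

Lemma cmodulus_sqr (z : R[i]) : cmodulus z ^+ 2 = complex.Re z ^+ 2 + complex.Im z ^+ 2.
Proof. by case: z => a b; rewrite sqr_sqrtr// addr_ge0// sqr_ge0. Qed.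

Lemma patch_in D f x : D x -> (f \_ D) x = f x.
Proof. by move=> Dx; rewrite patchE mem_set. Qed.

Lemma patch_out D f x : ~ D x -> (f \_ D) x = 0.
Proof. by move=> Dx; rewrite patchE memNset. Qed.

Lemma measurable_patch D f : measurable D ->
  measurable_fun D f <-> measurable_fun setT (f \_ D).
Proof. by move=> mD; exact: measurable_restrictT. Qed.

Lemma measurable_cmodulus D u : cmeasurable D u -> measurable_fun D (cmodulus \o u).
Proof.
move=> [mr mi].
rewrite (_ : cmodulus \o u = (fun x : T => Num.sqrt (re u x ^+ 2 + im u x ^+ 2))); last first.
  by apply/funext => x; rewrite /re /im /=; case: (u x).
apply: (measurableT_comp (continuous_measurable_fun (@sqrt_continuous R))).
by apply: measurable_funD; exact: measurable_funX.
Qed.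

Lemma LpNorm1 D u : measurable D ->
  LpNorm D 1%E u = (\int[mu]_(x in D) (cmodulus (u x))%:E)%E.
Proof.
move=> mD; rewrite /LpNorm Lnorm1 [RHS]integral_mkcond; apply: eq_integral => x _.
rewrite /= !patchE; case: ifP => _; last by rewrite normr0.
by rewrite ger0_norm// cmodulus_ge0.
Qed.

Lemma memL1_integrable D u : measurable D ->
  memLp D 1%E u <-> cmeasurable D u /\
  mu.-integrable D (EFin \o re u) /\ mu.-integrable D (EFin \o im u).
Proof.
move=> mD; rewrite /memLp LpNorm1//; split => -[mu_ h]; split => //.
  have ic : mu.-integrable D (fun x : T => (cmodulus (u x))%:E).
    apply/integrableP; split; first by apply/measurable_EFinP; exact: measurable_cmodulus.
    apply: le_lt_trans h; rewrite le_eqVlt; apply/orP; left; apply/eqP.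
    by apply: eq_integral => x _; rewrite /= ger0_norm// cmodulus_ge0.
  have [mr mi] := mu_.
  split; apply: (le_integrable mD _ _ ic); try exact/measurable_EFinP;
    move=> x _ /=; rewrite lee_fin (le_trans _ (ler_norm _))//.
    exact: normRe_le.
  exact: normIm_le.
have [h1 h2] := h; have i1 := integrable_norm h1; have i2 := integrable_norm h2.
have i12 := integrableD mD i1 i2.
have /integrableP[_ ] : mu.-integrable D (fun x : T => (cmodulus (u x))%:E).
  apply: (le_integrable mD _ _ i12).
    by apply/measurable_EFinP; exact: measurable_cmodulus.
  move=> x _ /=; rewrite lee_fin ger0_norm ?cmodulus_ge0// ger0_norm ?addr_ge0//.
  exact: cmodulus_le.
apply: le_lt_trans; rewrite le_eqVlt; apply/orP; left; apply/eqP.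
by apply: eq_integral => x _; rewrite /= ger0_norm// cmodulus_ge0.
Qed.

Lemma integrable_patch D K f : measurable K -> K `<=` D ->
  mu.-integrable K (EFin \o (f \_ D)) <-> mu.-integrable K (EFin \o f).
Proof.
move=> mK KD; split; apply: eq_integrable => // x; rewrite inE => Kx /=;
  by rewrite patch_in//; exact: KD.
Qed.

Lemma memL1loc_L1loc D u : open D ->
  memL1loc D u <-> L1loc D (re u \_ D) /\ L1loc D (im u \_ D).
Proof.
move=> oD; have mD := open_measurable_rV oD; split.
  move=> [[mr mi] h]; split; split; try exact/(measurable_patch _ mD);
    move=> K cK KD; have mK := compact_measurable_rV cK;
    by have /(memL1_integrable _ mK)[_ [h1 h2]] := h K cK KD; apply/integrable_patch.
move=> [[mr hr] [mi hi]].
have mr' : measurable_fun D (re u) by apply/(measurable_patch _ mD).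
have mi' : measurable_fun D (im u) by apply/(measurable_patch _ mD).
split => // K cK KD; have mK := compact_measurable_rV cK.
apply/memL1_integrable => //; split; first by split; exact: measurable_funS KD _.
by split; apply: (integrable_patch _ mK KD).1; [exact: hr|exact: hi].
Qed.

Lemma eq_Rintegral_in D f g : (forall x, D x -> f x = g x) ->
  \int[mu]_(x in D) f x = \int[mu]_(x in D) g x.
Proof. by move=> fg; apply: eq_Rintegral => x; rewrite inE => /fg. Qed.

(** The restriction to [D] extended by 0 is a function on the whole space, on
    which translations act. *)
Lemma weak_partialP D k u v : open D ->
  is_weak_partial D k u v <->
  rweak D k (re u \_ D) (re v \_ D) /\ rweak D k (im u \_ D) (im v \_ D).
Proof.
move=> oD; split.
  move=> [/(memL1loc_L1loc _ oD)[ur ui] /(memL1loc_L1loc _ oD)[vr vi] h].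
  split; split => // f tf; have [h1 h2] := h f tf.
    rewrite (eq_Rintegral_in (g := fun x : T => complex.Re (u x * (partial k f x)%:C))); last first.
      by move=> x Dx; rewrite patch_in// ReZr.
    rewrite h1 (eq_Rintegral_in (g := fun x : T => complex.Re (v x * (f x)%:C)))//.
    by move=> x Dx; rewrite patch_in// ReZr.
  rewrite (eq_Rintegral_in (g := fun x : T => complex.Im (u x * (partial k f x)%:C))); last first.
    by move=> x Dx; rewrite patch_in// ImZr.
  rewrite h2 (eq_Rintegral_in (g := fun x : T => complex.Im (v x * (f x)%:C)))//.
  by move=> x Dx; rewrite patch_in// ImZr.
move=> [[ur vr hr] [ui vi hi]]; split.
- exact/memL1loc_L1loc.
- exact/memL1loc_L1loc.
- move=> f tf; apply: complex_eqP; rewrite /cintegral ?ReN ?ImN /=.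
    rewrite (eq_Rintegral_in (g := fun x : T => (re u \_ D) x * partial k f x)); last first.
      by move=> x Dx; rewrite patch_in// -ReZr.
    rewrite hr// (eq_Rintegral_in (g := fun x : T => complex.Re (v x * (f x)%:C)))//.
    by move=> x Dx; rewrite patch_in// -ReZr.
  rewrite (eq_Rintegral_in (g := fun x : T => (im u \_ D) x * partial k f x)); last first.
    by move=> x Dx; rewrite patch_in// -ImZr.
  rewrite hi// (eq_Rintegral_in (g := fun x : T => complex.Im (v x * (f x)%:C)))//.
  by move=> x Dx; rewrite patch_in// -ImZr.
Qed.

End complex_weak.

(** * Cutoff functions of the gradient *)

Section cutoff.
Context {R : realType}.
Implicit Types (c s t x y : R).

Let k x : R := (1 + x ^+ 2)^-1.

Let k1_gt0 x : 0 < 1 + x ^+ 2. Proof. by rewrite ltr_pwDl// sqr_ge0. Qed.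

Let k_gt0 x : 0 < k x. Proof. by rewrite invr_gt0. Qed.

Let kK x : (1 + x ^+ 2) * k x = 1. Proof. by rewrite mulfV// gt_eqF. Qed.

(** Clearing denominators reduces the estimates below to polynomial
    inequalities. *)
Let kbound P C x y : `|P| <= C * ((1 + x ^+ 2) * (1 + y ^+ 2) ^+ 2) ->
  `|P * (k x * k y ^+ 2)| <= C.
Proof.
move=> h; have q0 : 0 < k x * k y ^+ 2 by rewrite mulr_gt0// exprn_gt0.
rewrite normrM (gtr0_norm q0) -ler_pdivlMr//.
by rewrite invfM /k !exprVn !invrK.
Qed.

Let kbound1 P C y : `|P| <= C * ((1 + y ^+ 2) ^+ 2) -> `|P * (k y ^+ 2)| <= C.
Proof.
move=> h; have := @kbound P C 0 y; rewrite /k expr0n addr0 invr1 !mul1r; exact.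
Qed.

(** The cutoff [kap c t = 1 / (1 + (c t)^2)] is positive and tends to 1 as [c]
    tends to 0, while [t * kap c t] is bounded; moreover [t * dkap c t] has a
    bound that does not depend on [c]. *)
Definition kap c t : R := k (c * t).
Definition dkap c t : R := - 2 * c ^+ 2 * t * kap c t ^+ 2.
Definition tkap c t : R := t * kap c t.
Definition dtkap c t : R := kap c t + t * dkap c t.

Lemma kap_gt0 c t : 0 < kap c t. Proof. exact: k_gt0. Qed.

Lemma kap_le1 c t : kap c t <= 1.
Proof. by rewrite /kap /k invf_le1 // lerDl sqr_ge0. Qed.

Lemma norm_kap c t : `|kap c t| <= 1.
Proof. by rewrite gtr0_norm ?kap_gt0// kap_le1. Qed.

Lemma continuous_kap c : continuous (kap c).
Proof.
move=> t; rewrite /kap /k; apply: cvgV; first by rewrite gt_eqF.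
apply: cvgD; first exact: cvg_cst.
by rewrite expr2; apply: cvgM; apply: cvgM => //; exact: cvg_cst.
Qed.

Lemma continuous_dkap c : continuous (dkap c).
Proof.
move=> t; rewrite /dkap; apply: cvgM; first by apply: cvgM => //; exact: cvg_cst.
by rewrite expr2; apply: cvgM; exact: continuous_kap.
Qed.

Lemma continuous_tkap c : continuous (tkap c).
Proof. by move=> t; apply: cvgM => //; exact: continuous_kap. Qed.

Lemma continuous_dtkap c : continuous (dtkap c).
Proof.
move=> t; apply: cvgD; first exact: continuous_kap.
by apply: cvgM => //; exact: continuous_dkap.
Qed.

Lemma dkap_bound c t : 0 < c -> `|dkap c t| <= c.
Proof.
move=> c0; have -> : dkap c t = c * ((- 2 * (c * t)) * k (c * t) ^+ 2).
  by rewrite /dkap /kap; ring.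
rewrite normrM gtr0_norm// ger_pMr//; apply: kbound1; set x := c * t.
rewrite mul1r ler_norml; have := sqr_ge0 (x - 1); have := sqr_ge0 (x + 1).
by have := sqr_ge0 (x ^+ 2); nra.
Qed.

Lemma tkap_bound c t : 0 < c -> `|tkap c t| <= c^-1.
Proof.
move=> c0; have -> : tkap c t = c^-1 * ((c * t) * (1 + (c * t) ^+ 2) * k (c * t) ^+ 2).
  rewrite /tkap /kap; have := kK (c * t); set q := k _ => hq.
  transitivity (c^-1 * c * (t * q) * ((1 + (c * t) ^+ 2) * q)); last by ring.
  by rewrite hq mulr1 mulVf ?mul1r// gt_eqF.
rewrite normrM gtr0_norm ?invr_gt0// ger_pMr ?invr_gt0//; apply: kbound1; set x := c * t.
rewrite mul1r ler_norml; have := sqr_ge0 (x - 1); have := sqr_ge0 (x + 1).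
have := sqr_ge0 x; nra.
Qed.

Lemma tdkap_bound c t : `|t * dkap c t| <= 1.
Proof.
have -> : t * dkap c t = (- 2 * (c * t) ^+ 2) * k (c * t) ^+ 2.
  by rewrite /dkap /kap; ring.
apply: kbound1; set x := c * t.
rewrite mul1r ler_norml; have := sqr_ge0 (x ^+ 2); have := sqr_ge0 x; nra.
Qed.

Lemma dtkap_bound c t : `|dtkap c t| <= 2.
Proof.
rewrite /dtkap (le_trans (ler_normD _ _))// (_ : 2 = 1 + 1)//.
by apply: lerD; [exact: norm_kap|exact: tdkap_bound].
Qed.

Lemma kap_taylor c s t : 0 < c ->
  `|kap c t - kap c s - dkap c s * (t - s)| <= 2 * c ^+ 2 * `|t - s| ^+ 2.
Proof.
move=> c0; have -> : kap c t - kap c s - dkap c s * (t - s) =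
   (c ^+ 2 * (t - s) ^+ 2) * ((2 * (c * t) * (c * s) + (c * s) ^+ 2 - 1) *
     (k (c * t) * k (c * s) ^+ 2)).
  rewrite /dkap /kap /k; field.
  by rewrite !gt_eqF// (lt_le_trans (k1_gt0 _) _).
rewrite normrM [X in _ <= X](_ : _ = c ^+ 2 * `|t - s| ^+ 2 * 2); last by ring.
apply: ler_pM => //; first by rewrite normrM !normrX (gtr0_norm c0).
apply: kbound; set x := c * t; set y := c * s.
rewrite ler_norml; have := sqr_ge0 (x - y); have := sqr_ge0 (x + y).
have := sqr_ge0 (x * y); have := sqr_ge0 x; have := sqr_ge0 y; have := sqr_ge0 (y ^+ 2).
have := sqr_ge0 (x * y ^+ 2); nra.
Qed.

Lemma kap_lip c s t : 0 < c -> `|kap c t - kap c s| <= c * `|t - s|.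
Proof.
move=> c0; have -> : kap c t - kap c s =
   (c * (t - s)) * ((- (c * t + c * s) * (1 + (c * s) ^+ 2)) * (k (c * t) * k (c * s) ^+ 2)).
  by rewrite /kap /k; field; rewrite !gt_eqF.
rewrite normrM -[leRHS]mulr1; apply: ler_pM => //; first by rewrite normrM (gtr0_norm c0).
apply: kbound; set x := c * t; set y := c * s.
rewrite ler_norml; have := sqr_ge0 (x - 1); have := sqr_ge0 (x + 1).
have := sqr_ge0 (y - 1); have := sqr_ge0 (y + 1); have := sqr_ge0 (x * y).
have := k1_gt0 y; nra.
Qed.

Lemma tkap_taylor c s t : 0 < c ->
  `|tkap c t - tkap c s - dtkap c s * (t - s)| <= 2 * c * `|t - s| ^+ 2.
Proof.
move=> c0; have -> : tkap c t - tkap c s - dtkap c s * (t - s) =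
   (c * (t - s) ^+ 2) * (((c * t) * (c * s) ^+ 2 - 2 * (c * s) - c * t) *
     (k (c * t) * k (c * s) ^+ 2)).
  rewrite /dtkap /tkap /dkap /kap /k; field.
  by rewrite !gt_eqF.
rewrite normrM [X in _ <= X](_ : _ = c * `|t - s| ^+ 2 * 2); last by ring.
apply: ler_pM => //; first by rewrite normrM !normrX (gtr0_norm c0).
apply: kbound; set x := c * t; set y := c * s.
rewrite ler_norml; have := sqr_ge0 (x - 1); have := sqr_ge0 (x + 1).
have := sqr_ge0 (y - 1); have := sqr_ge0 (y + 1); have := sqr_ge0 (x * y).
nra.
Qed.

Lemma tkap_lip c s t : 0 < c -> `|tkap c t - tkap c s| <= 2 * `|t - s|.
Proof.
move=> c0; have -> : tkap c t - tkap c s =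
   (t - s) * (((1 - (c * t) * (c * s)) * (1 + (c * s) ^+ 2)) * (k (c * t) * k (c * s) ^+ 2)).
  by rewrite /tkap /kap /k; field; rewrite !gt_eqF.
rewrite normrM mulrC; apply: ler_pM => //.
apply: kbound; set x := c * t; set y := c * s.
rewrite ler_norml; have := sqr_ge0 (x - y); have := sqr_ge0 (x + y); have := sqr_ge0 (x * y).
nra.
Qed.

Lemma kap_cvg1 t : kap j.+1%:R^-1 t @[j --> \oo] --> (1 : R).
Proof.
rewrite /kap /k -[X in _ --> X]invr1; apply: cvgV => //.
rewrite -[X in _ --> X]addr0; apply: cvgD; first exact: cvg_cst.
have h : j.+1%:R^-1 * t @[j --> \oo] --> (0 : R).
  by rewrite -(mul0r t); apply: cvgMl; exact: cvg_harmonic.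
under eq_fun do rewrite expr2.
by have := cvgM h h; rewrite mulr0; apply.
Qed.

End cutoff.

Section strong_cutoff.
Context {R : realType} {n : nat}.
Local Notation T := 'rV[R]_n.
Local Notation mu := (@lebesgue_rV R n).
Implicit Types (D : set T) (f g a b v : T -> R) (l : 'I_n).

Lemma strong_kap D l v v' (c : R) : 0 < c -> strong D l v v' ->
  strong D l (fun x : T => kap c (v x)) (fun x : T => dkap c (v x) * v' x).
Proof.
move=> c0 sv; apply: (@strong_comp _ _ _ _ _ _ _ _ (2 * c ^+ 2) c 1) => //.
- by apply: continuous_measurable_fun; exact: continuous_kap.
- by apply: continuous_measurable_fun; exact: continuous_dkap.
- by move=> s t; exact: kap_taylor.
- by move=> s t; exact: kap_lip.
- by move=> s; exact: dkap_bound.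
- exact: norm_kap.
Qed.

Lemma strong_tkap D l v v' (c : R) : 0 < c -> strong D l v v' ->
  strong D l (fun x : T => tkap c (v x)) (fun x : T => dtkap c (v x) * v' x).
Proof.
move=> c0 sv; apply: (@strong_comp _ _ _ _ _ _ _ _ (2 * c) 2 c^-1) => //.
- by apply: continuous_measurable_fun; exact: continuous_tkap.
- by apply: continuous_measurable_fun; exact: continuous_dtkap.
- by move=> s t; exact: tkap_taylor.
- by move=> s t; exact: tkap_lip.
- by move=> s; exact: dtkap_bound.
- by move=> s; exact: tkap_bound.
Qed.

Section product.
Variables (I : eqType) (D : set T) (l : 'I_n) (c : R) (a a' : I -> T -> R).
Hypotheses (c0 : 0 < c) (sa : forall i, strong D l (a i) (a' i)).

Definition cutX (s : seq I) (x : T) : R := \prod_(i <- s) kap c (a i x).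

Fixpoint dcutX (s : seq I) (x : T) : R :=
  if s is i :: s' then dkap c (a i x) * a' i x * cutX s' x + kap c (a i x) * dcutX s' x
  else 0.

Lemma cutX_cons i s x : cutX (i :: s) x = kap c (a i x) * cutX s x.
Proof. by rewrite /cutX big_cons. Qed.

Lemma cutX_gt0 s x : 0 < cutX s x.
Proof. by apply: prodr_gt0 => i _; exact: kap_gt0. Qed.

Lemma cutX_le1 s x : cutX s x <= 1.
Proof. by apply: prodr_ile1 => i _; rewrite ltW ?kap_gt0//= kap_le1. Qed.

Lemma norm_cutX s x : `|cutX s x| <= 1.
Proof. by rewrite gtr0_norm ?cutX_gt0// cutX_le1. Qed.

Lemma strong_cutX s : strong D l (cutX s) (dcutX s).
Proof.
elim: s => [|i s ih].
  rewrite (_ : cutX [::] = fun _ : T => 1 : R); last by apply/funext => x; rewrite /cutX big_nil.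
  have d1 x : derivable (fun _ : T => 1 : R) x (delta_mx 0 l) by exact: derivable_cst.
  rewrite (_ : dcutX [::] = partial l (fun _ : T => 1 : R)); last first.
    by apply/funext => x; rewrite /partial derive_cst.
  apply: (@strong_lipschitz _ _ _ _ _ 1 0) => // x; first by rewrite normr1.
  by rewrite /partial derive_cst normr0.
rewrite (_ : cutX (i :: s) = fun x : T => kap c (a i x) * cutX s x); last first.
  by apply/funext => x; exact: cutX_cons.
apply: (strongM (strong_kap c0 (sa i)) ih (M := 1)) => x; first exact: norm_kap.
exact: norm_cutX.
Qed.

Lemma mul_cutX_bound s i x : i \in s -> `|a i x * cutX s x| <= c^-1.
Proof.
elim: s => // j s ih; rewrite in_cons => /predU1P[->|/ih h].
  rewrite cutX_cons mulrA normrM -[leRHS]mulr1 ler_pM ?norm_cutX//.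
  exact: tkap_bound.
by rewrite cutX_cons mulrCA normrM -[leRHS]mul1r ler_pM// norm_kap.
Qed.

Lemma strong_mul_cutX s i : i \in s ->
  strong D l (fun x : T => a i x * cutX s x) (fun x : T => a' i x * cutX s x + a i x * dcutX s x).
Proof.
elim: s => // j s ih; rewrite in_cons => /predU1P[<-|si].
  have := strongM (strong_tkap c0 (sa i)) (strong_cutX s) (M := Num.max 1 c^-1).
  rewrite (_ : (fun x : T => tkap c (a i x) * cutX s x) = (fun x : T => a i x * cutX (i :: s) x)); last first.
    by apply/funext => x; rewrite cutX_cons mulrA.
  rewrite (_ : (fun x : T => _ + _) = (fun x : T => a' i x * cutX (i :: s) x + a i x * dcutX (i :: s) x)); last first.
    by apply/funext => x; rewrite cutX_cons /= /dtkap /tkap; ring.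
  apply => x; first by rewrite le_max tkap_bound// orbT.
  by rewrite le_max norm_cutX.
have := strongM (strong_kap c0 (sa j)) (ih si) (M := Num.max 1 c^-1).
rewrite (_ : (fun x : T => kap c (a j x) * _) = (fun x : T => a i x * cutX (j :: s) x)); last first.
  by apply/funext => x; rewrite cutX_cons mulrCA.
rewrite (_ : (fun x : T => _ + _) = (fun x : T => a' i x * cutX (j :: s) x + a i x * dcutX (j :: s) x)); last first.
  by apply/funext => x; rewrite cutX_cons /=; ring.
apply => x; first by rewrite le_max norm_kap.
by rewrite le_max mul_cutX_bound// orbT.
Qed.

Lemma dcutX_bound s x : `|dcutX s x| <= c * \sum_(i <- s) `|a' i x|.
Proof.
elim: s => [|i s ih]; first by rewrite big_nil mulr0 normr0.
rewrite big_cons mulrDr /= (le_trans (ler_normD _ _))// lerD//.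
  rewrite normrM [`|dkap _ _ * _|]normrM -[leRHS]mulr1; apply: ler_pM; rewrite ?mulr_ge0 ?norm_cutX//.
  by apply: ler_wpM2r => //; exact: dkap_bound.
by rewrite normrM -[leRHS]mul1r ler_pM// norm_kap.
Qed.

(** The growth of [a i] is compensated by the factor [kap c (a i x)], with a
    bound independent of [c]: this is what makes the derivative of the cutoff
    harmless as [c] tends to 0. *)
Lemma mul_dcutX_bound s i x : i \in s -> `|a i x * dcutX s x| <= \sum_(j <- s) `|a' j x|.
Proof.
elim: s => // j s ih; rewrite in_cons => /predU1P[<-|si]; rewrite big_cons /=.
  rewrite mulrDr (le_trans (ler_normD _ _))// lerD//.
    rewrite (_ : _ * _ = (a i x * dkap c (a i x)) * a' i x * cutX s x); last by ring.
    rewrite normrM -[leRHS]mulr1; apply: ler_pM; rewrite ?norm_cutX//.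
    by rewrite normrM ler_piMl// tdkap_bound.
  rewrite mulrA normrM; apply: le_trans (ler_pM _ _ (tkap_bound _ c0) (dcutX_bound s x)) _ => //.
  by rewrite mulrA mulVf ?mul1r// gt_eqF.
rewrite mulrDr (le_trans (ler_normD _ _))// lerD//.
  rewrite (_ : _ * _ = dkap c (a j x) * (a i x * cutX s x) * a' j x); last by ring.
  rewrite normrM ler_piMl// normrM.
  apply: le_trans (ler_pM _ _ (dkap_bound _ c0) (mul_cutX_bound x si)) _ => //.
  by rewrite mulfV// gt_eqF.
by rewrite mulrCA normrM -[leRHS]mul1r ler_pM// ?norm_kap// ih.
Qed.

End product.

Lemma cutX_cvg1 (I : eqType) (a : I -> T -> R) s x :
  cutX j.+1%:R^-1 a s x @[j --> \oo] --> (1 : R).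
Proof. by apply: cvg_prod1 => i; exact: kap_cvg1. Qed.

End strong_cutoff.

(** * Weak derivatives of products *)

Section weak_product.
Context {R : realType} {n : nat}.
Local Notation T := 'rV[R]_n.
Local Notation mu := (@lebesgue_rV R n).
Implicit Types (D : set T) (f g a b c v : T -> R) (l k : 'I_n).
Local Open Scope complex_scope.

Lemma Rintegral_lim0 D (G : nat -> T -> R) g : measurable D -> measurable_fun setT g ->
  (forall N, mu.-integrable D (EFin \o G N)) -> mu.-integrable D (EFin \o g) ->
  (forall N, \int[mu]_(x in D) G N x = 0) -> L1to0 mu D (fun (N : nat) (x : T) => G N x - g x) ->
  \int[mu]_(x in D) g x = 0.
Proof.
move=> mD mg iG ig G0 [mF hF].
suff h : (`|\int[mu]_(x in D) g x|%:E = 0)%E.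
  by apply/eqP; rewrite -normr_eq0; case: h => ->.
apply: to0_cst; first by rewrite lee_fin.
apply: to0_le hF; apply: nearW => N.
have iGg : mu.-integrable D (EFin \o (fun x : T => G N x - g x)).
  by have := integrableB mD (iG N) ig.
have -> : \int[mu]_(x in D) g x = - \int[mu]_(x in D) (G N x - g x).
  by rewrite RintegralB// G0 sub0r opprK.
rewrite normrN /N1 EFin_normr_Rintegral//.
apply: le_abse_integral => //.
by apply/measurable_EFinP; apply: measurable_funTS; exact: mF.
Qed.

Lemma ae_L1loc D a a' : L1loc D a -> measurable_fun setT a' ->
  {ae mu, forall x, D x -> a' x = a x} -> L1loc D a'.
Proof.
move=> [ma ha] ma' aa; split => // K cK KD; have mK := compact_measurable_rV cK.
apply/integrable_N1 => //; have /integrable_N1 := ha _ cK KD.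
move=> /(_ mK ma); rewrite /N1; congr (_ < _)%E.
apply: ae_eq_integral => //; try exact: measurable_normE.
by apply: filterS aa => x h Kx; rewrite h//; exact: KD.
Qed.

Lemma ae_rweak D l a b a' b' : open D -> rweak D l a b ->
  measurable_fun setT a' -> measurable_fun setT b' ->
  {ae mu, forall x, D x -> a' x = a x} -> {ae mu, forall x, D x -> b' x = b x} ->
  rweak D l a' b'.
Proof.
move=> oD [la lb h] ma' mb' aa bb; have mD := open_measurable_rV oD.
have [ma _] := la; have [mb _] := lb.
split; [exact: ae_L1loc aa|exact: ae_L1loc bb|move=> f tf].
have mf : measurable_fun setT f by case: tf => /smooth_measurable.
have mpf : measurable_fun setT (partial l f).
  by case: tf => sf _ _; apply: smooth_measurable; exact: smooth_partial.
have e1 : \int[mu]_(x in D) (a' x * partial l f x) = \int[mu]_(x in D) (a x * partial l f x).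
  congr fine; apply: ae_eq_integral => //;
    try (apply: measurable_funTS; apply/measurable_EFinP; exact: measurable_funM).
  by apply: filterS aa => x h1 Dx; rewrite h1.
have e2 : \int[mu]_(x in D) (b' x * f x) = \int[mu]_(x in D) (b x * f x).
  congr fine; apply: ae_eq_integral => //;
    try (apply: measurable_funTS; apply/measurable_EFinP; exact: measurable_funM).
  by apply: filterS bb => x h1 Dx; rewrite h1.
by rewrite e1 e2 h.
Qed.

Lemma integrable_test D f g (M : R) : open D -> L1loc D g -> measurable_fun setT f ->
  bounded_fun_by M f ->
  forall K, compact K -> K `<=` D -> (forall x, ~ K x -> f x = 0) ->
  mu.-integrable D (EFin \o (fun x : T => g x * f x)).
Proof.
move=> oD [mg hg] mf fM K cK KD f0; have mK := compact_measurable_rV cK.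
have mD := open_measurable_rV oD.
apply: (@integrable_supp _ _ _ K) => //; first by move=> x /f0 ->; rewrite mulr0.
by apply: (@integrable_mul_bounded _ _ _ _ _ M) => //; exact: hg.
Qed.

Lemma rweak_lin D l a a' b b' (r : R) : open D -> rweak D l a a' -> rweak D l b b' ->
  rweak D l (fun x : T => a x + r * b x) (fun x : T => a' x + r * b' x).
Proof.
move=> oD [la la' ha] [lb lb' hb].
have mD := open_measurable_rV oD.
have lr f : L1loc D f -> L1loc D (fun x : T => r * f x).
  move=> lf; apply: (@eq_L1loc _ _ _ (fun x : T => f x * r)); first by move=> x; rewrite mulrC.
  by apply: (@L1locM _ _ _ _ (fun _ : T => r) `|r|) => // x.
split; [by apply: L1locD => //; exact: lr|by apply: L1locD => //; exact: lr|].
move=> f tf; have [sf [B [fB dfB pout]]] := test_strong D l tf.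
have [smf cK KD] := tf.
have mf := smooth_measurable smf; have mpf := smooth_measurable (smooth_partial l smf).
have i1 g : L1loc D g -> mu.-integrable D (EFin \o (fun x : T => g x * partial l f x)).
  by move=> lg; apply: integrable_test lg mpf dfB _ cK KD pout.
have i2 g : L1loc D g -> mu.-integrable D (EFin \o (fun x : T => g x * f x)).
  by move=> lg; apply: integrable_test lg mf fB _ cK KD _ => // x; exact: fsupport_out.
transitivity (\int[mu]_(x in D) (a x * partial l f x) + r * \int[mu]_(x in D) (b x * partial l f x)).
  rewrite -RintegralZl ?i1// -RintegralD ?i1//; last first.
    by under [_ \o _]eq_fun do rewrite /= EFinM; apply: integrableZl => //; exact: i1.
  by apply: eq_Rintegral => x _; ring.
rewrite ha// hb// mulrN -opprD; congr (- _).
rewrite -RintegralZl ?i2// -RintegralD ?i2//; last first.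
  by under [_ \o _]eq_fun do rewrite /= EFinM; apply: integrableZl => //; exact: i2.
by apply: eq_Rintegral => x _; ring.
Qed.

(** The factor [v] is first replaced by the bounded function [tkap c v], to
    which [strongM] applies; then [c] tends to 0 by dominated convergence on the
    support of the test function. *)
Lemma rweakM D l c c' v v' (M : R) : open D -> rweak D l c c' -> rweak D l v v' ->
  bounded_fun_by M c -> bounded_fun_by M c' ->
  rweak D l (fun x : T => c x * v x) (fun x : T => c' x * v x + c x * v' x).
Proof.
move=> oD cc' vv' cM c'M; have mD := open_measurable_rV oD.
have sc := rweak_strong oD cc'; have sv := rweak_strong oD vv'.
have [lc lc' _] := sc; have [lv lv' _] := sv.
have [mc _] := lc; have [mc' _] := lc'; have [mv _] := lv; have [mv' _] := lv'.
have M0 : 0 <= M by apply: le_trans (cM 0).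
have lcv : L1loc D (fun x : T => c x * v x).
  by apply: (@eq_L1loc _ _ _ (fun x : T => v x * c x)) (L1locM lv mc cM) => x; rewrite mulrC.
have lcv' : L1loc D (fun x : T => c' x * v x + c x * v' x).
  apply: L1locD.
    by apply: (@eq_L1loc _ _ _ (fun x : T => v x * c' x)) (L1locM lv mc' c'M) => x; rewrite mulrC.
  by apply: (@eq_L1loc _ _ _ (fun x : T => v' x * c x)) (L1locM lv' mc cM) => x; rewrite mulrC.
split => // f tf; have [sf [B [fB dfB pout]]] := test_strong D l tf.
have [smf cK KD] := tf; have mK := compact_measurable_rV cK.
have B0 : 0 <= B by apply: le_trans (fB 0).
have mf := smooth_measurable smf; have mpf := smooth_measurable (smooth_partial l smf).
have i1 g : L1loc D g -> mu.-integrable D (EFin \o (fun x : T => g x * partial l f x)).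
  by move=> lg; apply: integrable_test lg mpf dfB _ cK KD pout.
have i2 g : L1loc D g -> mu.-integrable D (EFin \o (fun x : T => g x * f x)).
  by move=> lg; apply: integrable_test lg mf fB _ cK KD _ => // x; exact: fsupport_out.
pose cN N : R := N.+1%:R^-1.
have cN0 N : 0 < cN N by rewrite invr_gt0.
pose a N x := c x * tkap (cN N) (v x).
pose a' N x := c' x * tkap (cN N) (v x) + c x * (dtkap (cN N) (v x) * v' x).
have sa N : strong D l (a N) (a' N).
  apply: (strongM sc (strong_tkap (cN0 N) sv) (M := Num.max M (cN N)^-1)) => x.
    by rewrite le_max cM.
  by rewrite le_max tkap_bound// orbT.
have [la la'] : (forall N, L1loc D (a N)) /\ (forall N, L1loc D (a' N)).
  by split => N; have [] := sa N.
pose G N x := a N x * partial l f x + a' N x * f x.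
pose g x := (c x * v x) * partial l f x + (c' x * v x + c x * v' x) * f x.
have [mcv _] := lcv; have [mcv' _] := lcv'.
have mg : measurable_fun setT g by apply: measurable_funD; exact: measurable_funM.
have iG N : mu.-integrable D (EFin \o G N).
  by have := integrableD mD (i1 _ (la N)) (i2 _ (la' N)).
have ig : mu.-integrable D (EFin \o g).
  by have := integrableD mD (i1 _ lcv) (i2 _ lcv').
have G0 N : \int[mu]_(x in D) G N x = 0.
  have [_ _ /(_ f tf) h] : rweak D l (a N) (a' N).
    apply: (strong_rweak oD (sa N) (M := M * (cN N)^-1)) => x.
    by rewrite normrM ler_pM ?tkap_bound.
  by rewrite /G RintegralD ?i1 ?i2// h addNr.
have : \int[mu]_(x in D) g x = 0.
  apply: (@Rintegral_lim0 _ G) => //.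
  pose dom x := (M * `|v x|) * B * 2 + ((M * `|v x|) * 2 + (M * `|v' x|) * 3) * B.
  have idom : mu.-integrable (fsupport f) (EFin \o dom).
    have iv : mu.-integrable (fsupport f) (EFin \o (fun x : T => `|v x|)).
      by apply: integrable_norm; case: lv => _; apply.
    have iv' : mu.-integrable (fsupport f) (EFin \o (fun x : T => `|v' x|)).
      by apply: integrable_norm; case: lv' => _; apply.
    rewrite (_ : EFin \o dom = (fun x : T => (M * B * 4)%:E * (`|v x|)%:E + (M * B * 3)%:E * (`|v' x|)%:E)%E).
      by apply: integrableD => //; exact: integrableZl.
    by apply/funext => x; rewrite /= -!EFinM -EFinD; congr EFin; rewrite /dom; ring.
  have mG N : measurable_fun setT (fun x : T => G N x - g x).
    apply: measurable_funB => //; apply: measurable_funD; apply: measurable_funM => //.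
      by case: (la N).
    by case: (la' N).
  have out N x : ~ fsupport f x -> G N x - g x = 0.
    by move=> nx; rewrite /G /g (fsupport_out nx) (pout _ nx) !mulr0 subrr.
  have [_ hK] : L1to0 mu (fsupport f) (fun (N : nat) (x : T) => G N x - g x).
    apply: (@L1to0_dct _ _ _ _ _ _ dom) => //.
    - apply: aeW => x _.
      have h1 : tkap (cN N) (v x) @[N --> \oo] --> v x.
        by have := cvgM (cvg_cst (v x)) (@kap_cvg1 R (v x)); rewrite mulr1; apply.
      have h2 : dtkap (cN N) (v x) @[N --> \oo] --> (1 : R).
        have hd : v x * dkap (cN N) (v x) @[N --> \oo] --> (0 : R).
          rewrite -(mulr0 (v x)); apply: cvgMr.
          apply/cvgrPdist_le => /= e e0; apply: filterS (near_invS_lt e0) => N Ne.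
          by rewrite sub0r normrN (le_trans (dkap_bound _ (cN0 N)))// ltW.
        by have := cvgD (@kap_cvg1 R (v x)) hd; rewrite addr0; apply.
      apply/subr_cvg0; rewrite /G /g /a /a'.
      apply: cvgD; first by apply: cvgMl; exact: cvgMr.
      apply: cvgMl; apply: cvgD; first exact: cvgMr.
      by apply: cvgMr; rewrite -[X in _ --> X]mul1r; exact: cvgMl.
    - apply: aeW => x N _.
      have q1 : `|tkap (cN N) (v x)| <= `|v x| by rewrite normrM ler_piMr// norm_kap.
      have q2 := @dtkap_bound R (cN N) (v x).
      have p1 : `|c x * tkap (cN N) (v x)| <= M * `|v x| by rewrite normrM ler_pM.
      have p2 : `|c' x * tkap (cN N) (v x)| <= M * `|v x| by rewrite normrM ler_pM.
      have p3 : `|c x * (dtkap (cN N) (v x) * v' x)| <= M * (2 * `|v' x|).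
        by rewrite normrM ler_pM// normrM ler_wpM2r.
      have p4 : `|c x * v x| <= M * `|v x| by rewrite normrM ler_wpM2r.
      have p5 : `|c' x * v x| <= M * `|v x| by rewrite normrM ler_wpM2r.
      have p6 : `|c x * v' x| <= M * `|v' x| by rewrite normrM ler_wpM2r.
      rewrite (_ : G N x - g x = (c x * tkap (cN N) (v x) - c x * v x) * partial l f x +
        ((c' x * tkap (cN N) (v x) - c' x * v x) + (c x * (dtkap (cN N) (v x) * v' x) - c x * v' x)) * f x); last first.
        by rewrite /G /g /a /a'; ring.
      rewrite (le_trans (ler_normD _ _))// /dom; apply: lerD; rewrite normrM.
        rewrite mulrAC; apply: ler_pM => //.
        by rewrite (le_trans (ler_normB _ _))//; lra.
      apply: ler_pM => //.
      rewrite (le_trans (ler_normD _ _))//; apply: lerD.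
        by rewrite (le_trans (ler_normB _ _))//; lra.
      by rewrite (le_trans (ler_normB _ _))//; lra.
  split=> //; apply: to0_le hK; apply: nearW => N.
  by rewrite -(N1_supp mK (out N)); exact: le_N1_set.
rewrite /g /= RintegralD ?i1 ?i2// => /eqP.
by rewrite addr_eq0 => /eqP.
Qed.

End weak_product.

(** * The quadratic form of a sectorial matrix *)

Section sector_algebra.
Context {R : realType} {d : nat}.
Implicit Types (m r b : 'I_d -> 'I_d -> R) (x y : 'I_d -> R).

Definition bil m x y : R := \sum_k \sum_l m k l * x k * y l.

Lemma bilDl m x x' y : bil m (fun k => x k + x' k) y = bil m x y + bil m x' y.
Proof.
rewrite /bil -big_split; apply: eq_bigr => k _; rewrite -big_split.
by apply: eq_bigr => l _ /=; ring.
Qed.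

Lemma bilDr m x y y' : bil m x (fun k => y k + y' k) = bil m x y + bil m x y'.
Proof.
rewrite /bil -big_split; apply: eq_bigr => k _; rewrite -big_split.
by apply: eq_bigr => l _ /=; ring.
Qed.

Lemma bilZl m (c : R) x y : bil m (fun k => c * x k) y = c * bil m x y.
Proof.
rewrite /bil mulr_sumr; apply: eq_bigr => k _; rewrite mulr_sumr.
by apply: eq_bigr => l _ /=; ring.
Qed.

Lemma bilZr m (c : R) x y : bil m x (fun k => c * y k) = c * bil m x y.
Proof.
rewrite /bil mulr_sumr; apply: eq_bigr => k _; rewrite mulr_sumr.
by apply: eq_bigr => l _ /=; ring.
Qed.

Lemma bil_sym m x y : (forall k l, m k l = m l k) -> bil m x y = bil m y x.
Proof.
move=> sm; rewrite /bil exchange_big /=; apply: eq_bigr => k _; apply: eq_bigr => l _.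
by rewrite sm; ring.
Qed.

Section form.
Variables (r b : 'I_d -> 'I_d -> R) (t kappa S : R).
Hypothesis bsym : forall k l, b k l = b l k.
Hypothesis sect : forall x y,
  `|bil b x x + bil b y y + (bil r x y - bil r y x)| <= t * (bil r x x + bil r y y).
Hypothesis pos : forall x, 0 <= bil r x x.
Hypothesis t0 : 0 <= t.

(** Changing the sign of [x] changes the sign of the antisymmetric term only. *)
Let sect2 x y :
  `|bil b x x + bil b y y| + `|bil r x y - bil r y x| <= t * (bil r x x + bil r y y).
Proof.
have h1 := sect x y; have h2 := sect (fun k => -1 * x k) y.
move: h2; rewrite !(bilZl, bilZr); move: h1.
set u := bil b x x + bil b y y; set w := bil r x y - bil r y x.
rewrite (_ : -1 * (-1 * bil b x x) + bil b y y = u); last by rewrite /u; ring.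
rewrite (_ : -1 * bil r x y - -1 * bil r y x = - w); last by rewrite /w; ring.
rewrite (_ : -1 * (-1 * bil r x x) = bil r x x); last by ring.
rewrite !ler_norml => /andP[a1 a2] /andP[a3 a4].
by case: (ger0P u) => hu; case: (ger0P w) => hw; lra.
Qed.

Let beta_le x y : `|2 * bil b x y| <= t * (bil r x x + bil r y y).
Proof.
have h1 := sect (fun k => x k + y k) (fun k => 0 * y k).
have h2 := sect (fun k => x k + -1 * y k) (fun k => 0 * y k).
move: h1 h2; rewrite !(bilZl, bilZr, bilDl, bilDr).
rewrite (bil_sym y x bsym) !ler_norml => /andP[? ?] /andP[? ?].
by apply/andP; split; lra.
Qed.

Let sigma_le x y : `|bil r x y + bil r y x| <= bil r x x + bil r y y.
Proof.
have := pos (fun k => x k + y k); have := pos (fun k => x k + -1 * y k).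
rewrite !(bilZl, bilZr, bilDl, bilDr) ler_norml => ? ?.
by apply/andP; split; lra.
Qed.

Variable h : R.
Hypothesis h0 : 0 < h.
Let q := 1 + h ^+ 2.
(** In terms of [X = h xi], the real and imaginary parts [form_re] and
    [form_im] below are the symmetric forms at [X] and [eta] plus cross terms;
    the cross terms that are symmetric in [X] and [eta] have the coefficient
    [k0], and the antisymmetric one has the coefficient [S0]. *)
Let k0 := (q - 2) / (2 * h).
Let S0 := q / (2 * h).
Hypotheses (k0_le : `|k0| <= kappa) (S0_le : S0 <= S) (tk : t * kappa < 1).

Variables xi eta : 'I_d -> R.

(** Real and imaginary parts of
    [\sum_(k, l) (r + i b)_kl (xi + i eta)_k (h^2 xi - i eta)_l]. *)
Definition form_re : R :=
  h ^+ 2 * bil r xi xi + bil r eta eta - (h ^+ 2 * bil b eta xi - bil b xi eta).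
Definition form_im : R :=
  h ^+ 2 * bil b xi xi + bil b eta eta + (h ^+ 2 * bil r eta xi - bil r xi eta).

Let X k := h * xi k.
Let a := bil r X X + bil r eta eta.

Let a_ge0 : 0 <= a. Proof. by rewrite addr_ge0. Qed.

Let form_reE : form_re = a - k0 * (2 * bil b X eta).
Proof.
rewrite /form_re /a /k0 /q !(bilZl, bilZr) (bil_sym eta xi bsym); field.
by rewrite gt_eqF.
Qed.

Let form_imE : form_im = (bil b X X + bil b eta eta) + k0 * (bil r X eta + bil r eta X)
  + S0 * (bil r eta X - bil r X eta).
Proof. by rewrite /form_im /k0 /S0 /q !(bilZl, bilZr); field; rewrite gt_eqF. Qed.

Lemma form_re_ge : (1 - t * kappa) * a <= form_re.
Proof.
rewrite form_reE mulrBl mul1r lerD2l lerN2.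
apply: le_trans (ler_norm _) _; rewrite normrM.
have := beta_le X eta; rewrite -/a => hb.
rewrite [leRHS](_ : _ = kappa * (t * a)); last by ring.
by apply: ler_pM.
Qed.

Let core : `|form_im| <= kappa * a + (`|bil b X X + bil b eta eta| + S0 * `|bil r X eta - bil r eta X|).
Proof.
have S00 : 0 <= S0.
  by apply: divr_ge0; [rewrite addr_ge0// sqr_ge0|rewrite mulr_ge0// ltW].
rewrite form_imE (_ : _ + _ + _ = k0 * (bil r X eta + bil r eta X) +
   ((bil b X X + bil b eta eta) + S0 * (bil r eta X - bil r X eta))); last by ring.
apply: le_trans (ler_normD _ _) _; apply: lerD.
  by rewrite normrM; apply: ler_pM => //; exact: sigma_le.
rewrite (le_trans (ler_normD _ _))// lerD2l normrM ger0_norm//.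
by rewrite distrC.
Qed.

Lemma form_im_sym : bil r X eta = bil r eta X ->
  `|form_im| <= (t + kappa) / (1 - t * kappa) * form_re.
Proof.
move=> rs; have tk0 : 0 < 1 - t * kappa by rewrite subr_gt0.
have kap0 : 0 <= kappa by exact: le_trans k0_le.
apply: (@le_trans _ _ ((t + kappa) * a)).
  apply: le_trans core _; rewrite rs subrr normr0 mulr0 addr0 mulrDl addrC lerD2r.
  by have := sect2 X eta; rewrite rs subrr normr0 addr0.
rewrite mulrAC ler_pdivlMr// -mulrA; apply: ler_wpM2l; first by rewrite addr_ge0.
by rewrite mulrC; exact: form_re_ge.
Qed.

(** One copy of the antisymmetric term is estimated together with the symmetric
    one by [sect2], and the remaining [S - 1] copies by [sect2] alone. *)
Lemma form_im_gen : 1 <= S ->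
  `|form_im| <= ((2 * S - 1) * t + kappa) / (1 - t * kappa) * form_re.
Proof.
move=> S1; have tk0 : 0 < 1 - t * kappa by rewrite subr_gt0.
have kap0 : 0 <= kappa by exact: le_trans k0_le.
apply: (@le_trans _ _ (((2 * S - 1) * t + kappa) * a)).
  apply: le_trans core _.
  have h2 := sect2 X eta; rewrite -/a in h2.
  set u := `|_ + _| in h2 *; set w := `|_ - _| in h2 *.
  have u0 : 0 <= u by rewrite /u normr_ge0.
  have w0 : 0 <= w by rewrite /w normr_ge0.
  have hS : S0 * w <= S * w by rewrite ler_wpM2r.
  have hw : (S - 1) * w <= (S - 1) * (t * a).
    by apply: ler_wpM2l; [rewrite subr_ge0|lra].
  have hS2 : S * (t * a) <= (2 * S - 1) * (t * a).
    by apply: ler_wpM2r; [rewrite mulr_ge0|lra].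
  by rewrite mulrDl -mulrA; nra.
rewrite mulrAC ler_pdivlMr// -mulrA; apply: ler_wpM2l.
  by rewrite addr_ge0// mulr_ge0//; lra.
by rewrite mulrC; exact: form_re_ge.
Qed.

End form.

End sector_algebra.

Section exponents.
Context {R : realType}.
Variables (p theta : R).
Hypotheses (p1 : 1 < p) (theta0 : 0 <= theta) (theta1 : theta < pi / 2).
Hypothesis pt : `|1 - 2 / p| < cos theta.

Let phi := phi_of p.
Let t := tan theta.
Let kappa := cot phi.
Let S := (sin phi)^-1.

Let p0 : 0 < p. Proof. exact: lt_trans ltr01 p1. Qed.

Let abs_lt1 : `|1 - 2 / p| < 1.
Proof.
have h : 2 / p * p = 2 by rewrite divfK// gt_eqF.
have h2 : 0 < 2 / p by rewrite divr_gt0.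
have h3 : 2 / p < 2 by rewrite ltr_pdivrMr//; have := p1; lra.
by rewrite ltr_norml; apply/andP; split; lra.
Qed.

Let abs_in : -1 <= `|1 - 2 / p| <= 1.
Proof. by apply/andP; split; [exact: le_trans (lerN10 _) (normr_ge0 _)|exact: ltW]. Qed.

Lemma cos_phi : cos phi = `|1 - 2 / p|.
Proof. by rewrite /phi /phi_of acosK. Qed.

Lemma sin_phi_gt0 : 0 < sin phi.
Proof.
rewrite /phi /phi_of sin_acos// sqrtr_gt0 subr_gt0.
by rewrite expr_lt1.
Qed.

Let cos_theta_gt0 : 0 < cos theta.
Proof. by apply: cos_gt0_pihalf; rewrite theta1 andbT (lt_le_trans _ theta0)// oppr_lt0 divr_gt0// pi_gt0. Qed.

Let sin_theta_ge0 : 0 <= sin theta.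
Proof.
apply: sin_ge0_pi; rewrite theta0/=.
by rewrite (le_trans (ltW theta1))// ler_pdivrMr// ler_peMr ?ler1n// pi_ge0.
Qed.

Lemma tan_theta_ge0 : 0 <= t.
Proof. by rewrite /t /tan divr_ge0// ltW. Qed.

Lemma kappa_ge0 : 0 <= kappa.
Proof. by rewrite /kappa /cot cos_phi divr_ge0// ltW// sin_phi_gt0. Qed.

Lemma S_sqr : S ^+ 2 = 1 + kappa ^+ 2.
Proof.
have s0 : sin phi != 0 by rewrite gt_eqF// sin_phi_gt0.
have := cos2Dsin2 phi; rewrite /kappa /cot /S; move: (cos phi) (sin phi) s0 => c s s0 cs.
apply: (@mulIf _ (s ^+ 2)); first by rewrite sqrf_eq0.
by rewrite mulrDl mul1r -!exprMn divfK// mulVf// expr1n addrC cs.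
Qed.

Lemma S_ge1 : 1 <= S.
Proof.
rewrite -(@ler_pXn2r _ 2) ?nnegrE//; last by rewrite invr_ge0 ltW// sin_phi_gt0.
by rewrite expr1n S_sqr lerDl sqr_ge0.
Qed.

Lemma kappa_sqr : kappa ^+ 2 = (p - 2) ^+ 2 / (4 * (p - 1)).
Proof.
have s0 : sin phi != 0 by rewrite gt_eqF// sin_phi_gt0.
have cs := cos2Dsin2 phi; have c2 : cos phi ^+ 2 = (1 - 2 / p) ^+ 2.
  by rewrite cos_phi real_normK// num_real.
have s2 : sin phi ^+ 2 = 4 * (p - 1) / p ^+ 2.
  have -> : sin phi ^+ 2 = 1 - (1 - 2 / p) ^+ 2 by rewrite -c2 -cs; ring.
  by field; rewrite gt_eqF.
rewrite /kappa /cot expr_div_n c2 s2; field.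
by rewrite (gt_eqF p0) subr_eq0 gt_eqF.
Qed.

Lemma tan_kappa_lt1 : t * kappa < 1.
Proof.
have sp := sin_phi_gt0.
rewrite /t /kappa /tan /cot mulrACA -invfM ltr_pdivrMr ?mulr_gt0// mul1r.
have c1 : cos phi < cos theta by rewrite cos_phi.
have c0 : 0 <= cos phi by rewrite cos_phi.
have ss : sin theta <= sin phi.
  rewrite -(@ler_pXn2r _ 2) ?nnegrE//; last exact: ltW.
  have := cos2Dsin2 theta; have := cos2Dsin2 phi.
  have : cos phi ^+ 2 <= cos theta ^+ 2 by rewrite ler_pXn2r ?nnegrE// ltW.
  by lra.
apply: (@le_lt_trans _ _ (sin phi * cos phi)); first exact: ler_wpM2r.
by rewrite mulrC ltr_pM2r.
Qed.

Lemma tan_sum_kappa : tan (pi / 2 - phi + theta) = (t + kappa) / (1 - t * kappa).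
Proof.
have s0 : sin phi != 0 by rewrite gt_eqF// sin_phi_gt0.
have c1 : cos (pi / 2 - phi) = sin phi.
  by rewrite -(opprK (_ - _)) cosN opprB cosBpihalf.
have s1 : sin (pi / 2 - phi) = cos phi.
  by rewrite -(opprK (_ - _)) sinN opprB sinBpihalf opprK.
rewrite tanD ?c1 ?(gt_eqF cos_theta_gt0)//.
have -> : tan (pi / 2 - phi) = kappa by rewrite /tan s1 c1.
by rewrite [kappa + _]addrC [kappa * _]mulrC.
Qed.

Variable tau : R.
Hypothesis tau01 : 0 <= tau <= 1.
Let h := Num.sqrt (1 + (p - 2) * tau).

Let h2_gt0 : 0 < 1 + (p - 2) * tau.
Proof.
have pp : 0 < p - 1 by rewrite subr_gt0.
have /andP[a b] := tau01; have hm : 0 <= (p - 1) * tau by rewrite mulr_ge0// ltW.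
rewrite (_ : 1 + _ = (1 - tau) + (p - 1) * tau); last by ring.
have [->|tau0] := eqVneq tau 1; first by rewrite subrr add0r mulr1.
by rewrite ltr_wpDr// subr_gt0 lt_neqAle tau0.
Qed.

Lemma h_sqr : h ^+ 2 = 1 + (p - 2) * tau.
Proof. by rewrite sqr_sqrtr// ltW. Qed.

Lemma h_gt0 : 0 < h. Proof. by rewrite sqrtr_gt0. Qed.

(** The left-hand side increases with [tau], and equality holds at [tau = 1]. *)
Lemma k0_le_kappa : `|(1 + h ^+ 2 - 2) / (2 * h)| <= kappa.
Proof.
have h0 := h_gt0; have hn : h != 0 by rewrite gt_eqF.
rewrite -(@ler_pXn2r _ 2) ?nnegrE ?kappa_ge0// real_normK ?num_real//.
rewrite kappa_sqr expr_div_n exprMn h_sqr.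
rewrite ler_pdivrMr ?mulr_gt0//.
rewrite mulrAC ler_pdivlMr; last by rewrite mulr_gt0// subr_gt0.
have /andP[ta tb] := tau01.
have q1 : 0 <= (1 - tau) * (1 + (p - 1) * tau) by rewrite mulr_ge0 ?subr_ge0// addr_ge0// mulr_ge0// subr_ge0 ltW.
have q2 : 0 <= (p - 2) ^+ 2 by exact: sqr_ge0.
have := mulr_ge0 q2 q1.
lra.
Qed.

Lemma S0_le_S : (1 + h ^+ 2) / (2 * h) <= S.
Proof.
have h0 := h_gt0; have hn : h != 0 by rewrite gt_eqF.
rewrite -(@ler_pXn2r _ 2) ?nnegrE//; last 2 first.
- by rewrite divr_ge0// ?addr_ge0 ?sqr_ge0 ?mulr_ge0// ltW.
- exact: le_trans ler01 S_ge1.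
rewrite S_sqr (_ : ((1 + h ^+ 2) / (2 * h)) ^+ 2 = 1 + ((1 + h ^+ 2 - 2) / (2 * h)) ^+ 2); last first.
  by move: hn; move: h => g gn; field.
have := k0_le_kappa; rewrite lerD2l -(@ler_pXn2r _ 2) ?nnegrE ?kappa_ge0//.
by rewrite real_normK// num_real.
Qed.

End exponents.

(** * The regularised power *)

Section regularized_power.
Context {R : realType}.
Variables (p e : R).
Hypothesis p1 : 1 < p.
Hypothesis pe : (2 <= p /\ e = 0) \/ (p < 2 /\ 0 < e).
Implicit Types (a b s t y : R).

Let al := (p - 2) / 2.

Let e0 : 0 <= e. Proof. by case: pe => -[_]; [move=> ->|exact: ltW]. Qed.

Definition psi s : R := (s + e) `^ al.
(** For [z = a + i b], the real part of [z (|z|^2 + e)^((p-2)/2)]; its imaginary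
    part is [gs b a]. *)
Definition gs a b : R := a * psi (a ^+ 2 + b ^+ 2).
(** Derivative of [gs a b] along a curve with velocity [(a', b')]. *)
Definition dgs a b a' b' : R := psi (a ^+ 2 + b ^+ 2) * a' +
  (p - 2) * (a ^+ 2 + b ^+ 2 + e) `^ (al - 1) * (a * a' + b * b') * a.

Let sq_ge0 a b : 0 <= a ^+ 2 + b ^+ 2. Proof. by rewrite addr_ge0 ?sqr_ge0. Qed.

Lemma psi_ge0 s : 0 <= psi s. Proof. exact: powR_ge0. Qed.

Let sqr_powR t : 0 <= t -> (t ^+ 2) `^ al = t `^ (p - 2).
Proof.
move=> t0; rewrite -(@powR_mulrn _ t 2)// -powRrM; congr (_ `^ _).
by rewrite /al; field.
Qed.

Let sum_sq_le a b t : `|a| <= t -> `|b| <= t -> a ^+ 2 + b ^+ 2 <= 2 * t ^+ 2.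
Proof. rewrite !ler_norml => /andP[? ?] /andP[? ?]; nra. Qed.

Let ge2_psi a b t : 2 <= p -> e = 0 -> `|a| <= t -> `|b| <= t ->
  psi (a ^+ 2 + b ^+ 2) <= 2 `^ al * t `^ (p - 2).
Proof.
move=> p2 ez ha hb; have t0 : 0 <= t by exact: le_trans (normr_ge0 a) ha.
have al0 : 0 <= al by rewrite divr_ge0// subr_ge0.
rewrite /psi ez addr0 -sqr_powR// -powRM//; last exact: sqr_ge0.
by apply: ge0_ler_powR => //; rewrite ?nnegrE ?sq_ge0 ?mulr_ge0 ?sqr_ge0//; exact: sum_sq_le.
Qed.

Let powR_le_neg x y (r : R) : r <= 0 -> 0 < x -> x <= y -> y `^ r <= x `^ r.
Proof.
move=> r0 x0 xy; have y0 := lt_le_trans x0 xy.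
by rewrite /powR !gt_eqF// ler_expR ler_wnM2l// ler_ln.
Qed.

(** The constant must not depend on [e], which will tend to 0. *)
Lemma gs_bound a b t : `|a| <= t -> `|b| <= t ->
  `|gs a b| <= (1 + 2 `^ al) * t `^ (p - 1).
Proof.
move=> ha hb; have t0 : 0 <= t by exact: le_trans (normr_ge0 a) ha.
have pp : 0 < p - 1 by rewrite subr_gt0.
rewrite normrM (ger0_norm (psi_ge0 _)); case: pe => -[p2 ez].
  apply: (@le_trans _ _ (t * (2 `^ al * t `^ (p - 2)))).
    by apply: ler_pM; rewrite ?psi_ge0// ge2_psi.
  rewrite mulrCA (_ : p - 2 = (p - 1) - 1); last by ring.
  by rewrite mulr_powRB1// ler_wpM2r ?powR_ge0// lerDr.
rewrite mulrDl mul1r -[leLHS]addr0; apply: lerD; last by rewrite mulr_ge0 ?powR_ge0.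
have [->|a0] := eqVneq a 0; first by rewrite normr0 mul0r powR_ge0.
have a20 : 0 < a ^+ 2 by rewrite exprn_even_gt0.
apply: (@le_trans _ _ (`|a| * (`|a| `^ (p - 2)))).
  apply: ler_wpM2l => //; rewrite -sqr_powR// /psi real_normK ?num_real//.
  apply: powR_le_neg => //; last by rewrite -addrA lerDl addr_ge0 ?sqr_ge0.
  by rewrite /al ler_pdivrMr// mul0r subr_le0 ltW.
rewrite (_ : p - 2 = (p - 1) - 1); last by ring.
rewrite mulr_powRB1//; apply: ge0_ler_powR; rewrite ?nnegrE//; exact: ltW.
Qed.

Lemma mul_gs_bound a b t y : `|a| <= t -> `|b| <= t -> `|y| <= t ->
  `|y * gs a b| <= (1 + 2 `^ al) * t `^ p.
Proof.
move=> ha hb hy; have t0 : 0 <= t by exact: le_trans (normr_ge0 a) ha.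
rewrite normrM -(mulr_powRB1 t0 (lt_trans ltr01 p1)).
by rewrite mulrCA; apply: ler_pM => //; exact: gs_bound.
Qed.

Let dgs_le a b a' b' t : `|a'| <= t -> `|b'| <= t ->
  `|dgs a b a' b'| <= (1 + 2 * `|p - 2|) * (psi (a ^+ 2 + b ^+ 2) * t).
Proof.
move=> ha hb; have t0 : 0 <= t by exact: le_trans (normr_ge0 a') ha.
rewrite mulrDl mul1r (le_trans (ler_normD _ _))//; apply: lerD.
  by rewrite normrM (ger0_norm (psi_ge0 _)) ler_wpM2l// psi_ge0.
set s := a ^+ 2 + b ^+ 2.
have h1 : `|(a * a' + b * b') * a| <= 2 * (s * t).
  have h : `|a * a' + b * b'| <= (`|a| + `|b|) * t.
    by rewrite mulrDl (le_trans (ler_normD _ _))// lerD// normrM ler_wpM2l.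
  rewrite normrM (le_trans (ler_wpM2r (normr_ge0 _) h))// mulrAC mulrA.
  apply: ler_wpM2r => //; rewrite /s.
  rewrite -(@real_normK _ a) ?num_real// -(@real_normK _ b) ?num_real//.
  have := sqr_ge0 (`|a| - `|b|); have := sqr_ge0 `|b|; have := sqr_ge0 `|a|; nra.
have h2 : (s + e) `^ (al - 1) * s <= psi s.
  have s0 : 0 <= s by exact: sq_ge0.
  have [se|se] := eqVneq (s + e) 0.
    have -> : s = 0 by apply/eqP; rewrite eq_le s0 andbT; move: e0; lra.
    by rewrite mulr0 psi_ge0.
  apply: (@le_trans _ _ ((s + e) `^ (al - 1) * (s + e))).
    by rewrite ler_wpM2l ?powR_ge0// lerDl.
  have -> : (s + e) `^ (al - 1) * (s + e) = (s + e) `^ (al - 1) * (s + e) `^ 1 by rewrite powRr1//; exact: addr_ge0.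
  by rewrite -powRD ?subrK// se implybT.
rewrite -mulrA !normrM (ger0_norm (powR_ge0 _ _)) -normrM.
rewrite [leRHS](_ : _ = `|p - 2| * (2 * (psi s * t))); last by ring.
rewrite -mulrA ler_wpM2l//.
apply: (le_trans (ler_wpM2l (powR_ge0 _ _) h1)).
by rewrite mulrCA ler_pM2l// mulrA ler_wpM2r.
Qed.

(** If [p < 2], the derivative is bounded by [t] times a power of [e], and the
    missing power of [t] comes from [|y| <= B^(2-p) t^(p-1)]. *)
Lemma mul_dgs_bound (B : R) : exists2 k, 0 <= k & forall a b a' b' t y,
  `|a| <= t -> `|b| <= t -> `|a'| <= t -> `|b'| <= t -> `|y| <= t -> `|y| <= B ->
  `|y * dgs a b a' b'| <= k * t `^ p.
Proof.
have pp : 0 < p - 1 by rewrite subr_gt0.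
have p0 : 0 < p by exact: lt_trans ltr01 p1.
case: pe => -[p2 ez].
  exists ((1 + 2 * `|p - 2|) * 2 `^ al).
    by rewrite mulr_ge0 ?powR_ge0// addr_ge0// mulr_ge0.
  move=> a b a' b' t y ha hb ha' hb' hy hB.
  have t0 : 0 <= t by exact: le_trans (normr_ge0 a) ha.
  apply: (@le_trans _ _ (t * ((1 + 2 * `|p - 2|) * (2 `^ al * t `^ (p - 2) * t)))).
    rewrite normrM; apply: ler_pM => //; apply: le_trans (dgs_le _ _ ha' hb') _.
    rewrite ler_wpM2l//.
    by rewrite ler_wpM2r// ge2_psi.
  rewrite (_ : _ * (_ * _) = (1 + 2 * `|p - 2|) * 2 `^ al * (t * (t * t `^ (p - 2)))); last by ring.
  rewrite (_ : p - 2 = (p - 1) - 1); last by ring.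
  by rewrite !mulr_powRB1.
exists ((1 + 2 * `|p - 2|) * e `^ al * `|B| `^ (2 - p)).
  by rewrite !mulr_ge0 ?powR_ge0// addr_ge0// mulr_ge0.
move=> a b a' b' t y ha hb ha' hb' hy hB.
have t0 : 0 <= t by exact: le_trans (normr_ge0 a) ha.
have hy2 : `|y| <= `|B| `^ (2 - p) * t `^ (p - 1).
  have -> : `|y| = `|y| `^ (2 - p) * `|y| `^ (p - 1).
    rewrite -powRD (_ : 2 - p + (p - 1) = 1); try ring; first by rewrite powRr1.
    by rewrite oner_eq0.
  apply: ler_pM; rewrite ?powR_ge0//; apply: ge0_ler_powR; rewrite ?nnegrE//.
  - by rewrite subr_ge0 ltW.
  - exact: le_trans (ler_norm _).
  - exact: ltW.
have hpsi : psi (a ^+ 2 + b ^+ 2) <= e `^ al.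
  apply: powR_le_neg => //; last by rewrite lerDr.
  by rewrite /al ler_pdivrMr// mul0r subr_le0 ltW.
apply: (@le_trans _ _ ((`|B| `^ (2 - p) * t `^ (p - 1)) * ((1 + 2 * `|p - 2|) * (e `^ al * t)))).
  rewrite normrM; apply: ler_pM => //; apply: le_trans (dgs_le _ _ ha' hb') _.
  rewrite ler_wpM2l//.
  by rewrite ler_wpM2r.
by rewrite -[in leRHS](mulr_powRB1 t0 p0) le_eqVlt; apply/orP; left; apply/eqP; ring.
Qed.

Let zero_case a b : ~ 0 < a ^+ 2 + b ^+ 2 + e -> [/\ a = 0, b = 0, e = 0 & 0 <= al].
Proof.
move=> h; have h1 : a ^+ 2 + b ^+ 2 + e <= 0 by rewrite leNgt; apply/negP.
have a2 := sqr_ge0 a; have b2 := sqr_ge0 b.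
have ez : e = 0 by have := e0; lra.
split => //.
- by apply/eqP; rewrite -sqrf_eq0; apply/eqP; have := e0; lra.
- by apply/eqP; rewrite -sqrf_eq0; apply/eqP; have := e0; lra.
- case: pe => -[p2 q]; first by rewrite divr_ge0// subr_ge0.
  by move: q; rewrite ez ltxx.
Qed.

Section filters.
Context {U : Type} {F : set_system U} {FF : Filter F}.

Let cvg_powR (r x : R) (f : U -> R) : 0 < x -> f j @[j --> F] --> x ->
  f j `^ r @[j --> F] --> x `^ r.
Proof.
move=> x0; apply: (@continuous_cvg _ _ _ _ _ f (fun t : R => t `^ r)).
apply: differentiable_continuous; apply/derivable1_diffP.
by apply: derivable_powR; rewrite in_itv/= x0.
Qed.

Let continuous_powR0 (r : R) : 0 <= r -> forall (f : U -> R), (forall j, 0 <= f j) ->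
  f j @[j --> F] --> (0 : R) -> f j `^ r @[j --> F] --> (0 `^ r : R).
Proof.
rewrite le_eqVlt => /predU1P[<-|r0] f f0 hf.
  by rewrite powRr0; under eq_fun do rewrite powRr0; exact: cvg_cst.
rewrite powR0 ?gt_eqF//; apply/cvgrPdist_le => /= d d0.
have d1 : 0 < d `^ r^-1 by rewrite powR_gt0.
move/cvgrPdist_le : hf => /(_ _ d1); apply: filterS => j.
rewrite !sub0r !normrN !ger0_norm ?powR_ge0// => h.
have -> : d = (d `^ r^-1) `^ r by rewrite -powRrM mulVf ?powRr1 ?ltW// gt_eqF.
by apply: ge0_ler_powR; rewrite ?nnegrE ?powR_ge0//; exact: ltW.
Qed.

Let cvg_sq (a b : U -> R) (A B : R) : a j @[j --> F] --> A -> b j @[j --> F] --> B ->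
  a j ^+ 2 + b j ^+ 2 @[j --> F] --> A ^+ 2 + B ^+ 2.
Proof.
move=> ha hb; under eq_fun do rewrite !expr2; rewrite !expr2.
by apply: cvgD; exact: cvgM.
Qed.

Lemma psi_cvg (a b : U -> R) (A B : R) : a j @[j --> F] --> A -> b j @[j --> F] --> B ->
  psi (a j ^+ 2 + b j ^+ 2) @[j --> F] --> psi (A ^+ 2 + B ^+ 2).
Proof.
move=> ha hb; have hs : a j ^+ 2 + b j ^+ 2 + e @[j --> F] --> A ^+ 2 + B ^+ 2 + e.
  by apply: cvgD; [exact: cvg_sq|exact: cvg_cst].
have [s0|/zero_case[az bz ez al0]] := pselect (0 < A ^+ 2 + B ^+ 2 + e).
  by apply: cvg_powR s0 hs.
rewrite /psi; move: hs; rewrite az bz ez expr0n /= !addr0 => hs.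
by apply: continuous_powR0 => // j; rewrite addr0.
Qed.

Lemma gs_cvg (a b : U -> R) (A B : R) : a j @[j --> F] --> A -> b j @[j --> F] --> B ->
  gs (a j) (b j) @[j --> F] --> gs A B.
Proof. by move=> ha hb; apply: cvgM => //; exact: psi_cvg. Qed.

(** The delicate point is a limit at 0 with [e = 0]: the second term of [dgs] is
    at most a multiple of [psi] times the velocity, and [psi] tends to 0 unless
    [p = 2], in which case that term vanishes. *)
Lemma dgs_cvg (a b a' b' : U -> R) (A B A' B' : R) :
  a j @[j --> F] --> A -> b j @[j --> F] --> B ->
  a' j @[j --> F] --> A' -> b' j @[j --> F] --> B' ->
  dgs (a j) (b j) (a' j) (b' j) @[j --> F] --> dgs A B A' B'.
Proof.
move=> ha hb ha' hb'.
have [s0|/zero_case[az bz ez al0]] := pselect (0 < A ^+ 2 + B ^+ 2 + e).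
  have hs : a j ^+ 2 + b j ^+ 2 + e @[j --> F] --> A ^+ 2 + B ^+ 2 + e.
  by apply: cvgD; [exact: cvg_sq|exact: cvg_cst].
  apply: cvgD; first by apply: cvgM => //; exact: psi_cvg.
  apply: cvgM => //; apply: cvgM; last by apply: cvgD; exact: cvgM.
  apply: cvgM; first exact: cvg_cst.
  by apply: cvg_powR s0 hs.
have hpsi : psi (a j ^+ 2 + b j ^+ 2) @[j --> F] --> psi (A ^+ 2 + B ^+ 2) by exact: psi_cvg.
rewrite /dgs; apply: cvgD; first exact: cvgM.
rewrite az mulr0.
have [q2|q2] := eqVneq p 2.
  rewrite (_ : (fun j : U => _) = fun=> 0); first exact: cvg_cst.
  by apply/funext => j; rewrite (_ : p - 2 = 0) ?mul0r// q2 subrr.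
have psi0 : psi (A ^+ 2 + B ^+ 2) = 0.
  rewrite /psi az bz ez expr0n /= !addr0 powR0// /al mulf_neq0 ?invr_eq0//.
  by rewrite subr_eq0.
rewrite psi0 in hpsi.
pose bnd j := (1 + 2 * `|p - 2|) * (psi (a j ^+ 2 + b j ^+ 2) * (`|a' j| + `|b' j|)).
have hbnd : (bnd j + psi (a j ^+ 2 + b j ^+ 2) * `|a' j|) @[j --> F] --> (0 : R).
  rewrite -[X in _ --> X](_ : (1 + 2 * `|p - 2|) * (0 * (`|A'| + `|B'|)) + 0 * `|A'| = 0); last first.
    by rewrite !mul0r mulr0 addr0.
  have na : `|a' j| @[j --> F] --> `|A'| by exact: cvg_norm.
  have nb : `|b' j| @[j --> F] --> `|B'| by exact: cvg_norm.
  by apply: cvgD; [apply: cvgMr|]; apply: cvgM => //; exact: cvgD.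
apply/cvgrPdist_le => /= d d0; move/cvgrPdist_le : hbnd => /(_ _ d0); apply: filterS => j.
rewrite !sub0r !normrN; apply: le_trans.
rewrite [leRHS]ger0_norm; last first.
  by rewrite addr_ge0// !mulr_ge0 ?psi_ge0// addr_ge0// mulr_ge0.
set u := psi _ * _; set x := _ * a j.
have -> : x = dgs (a j) (b j) (a' j) (b' j) - psi (a j ^+ 2 + b j ^+ 2) * a' j.
  by rewrite /x /dgs [RHS]addrC addKr.
rewrite (le_trans (ler_normB _ _))//; apply: lerD.
  by apply: dgs_le; rewrite ?lerDl ?lerDr.
by rewrite normrM (ger0_norm (psi_ge0 _)).
Qed.

End filters.

(** At a zero with [e = 0] the power may fail to be differentiable, but the
    difference quotient is [A t / t] times a continuous function. *)
Let is_derive_gs1 (A B : R -> R) (A' B' : R) :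
  is_derive (0 : R) (1 : R) A A' -> is_derive (0 : R) (1 : R) B B' ->
  is_derive (0 : R) (1 : R) (fun t : R => gs (A t) (B t)) (dgs (A 0) (B 0) A' B').
Proof.
move=> DA DB; pose s (t : R) : R := A t ^+ 2 + B t ^+ 2 + e.
have Ds : is_derive (0 : R) (1 : R) s (2 * (A 0 * A' + B 0 * B')).
  have h := is_deriveD (is_deriveD (is_deriveM DA DA) (is_deriveM DB DB)) (is_derive_cst e (0 : R) (1 : R)).
  rewrite (_ : s = A * A + B * B + cst e); last first.
    by apply/funext => y; rewrite /s !expr2.
  by apply: (is_derive_eq h); rewrite /GRing.scale/=; ring.
have [s0|/zero_case[az bz ez al0]] := pselect (0 < A 0 ^+ 2 + B 0 ^+ 2 + e).
  have dp : is_derive (s 0) (1 : R) (fun x : R => x `^ al) (al * s 0 `^ (al - 1)).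
    exact: is_derive1_powR.
  have := is_deriveM DA (is_derive1_comp dp Ds) => h.
  by apply: (is_derive_eq h); rewrite /GRing.scale/= /dgs /psi /s /al; field.
have cA : A h @[h --> 0^'] --> A 0.
  apply: cvg_within_filter; apply: differentiable_continuous; apply/derivable1_diffP; by case: DA.
have cB : B h @[h --> 0^'] --> B 0.
  apply: cvg_within_filter; apply: differentiable_continuous; apply/derivable1_diffP; by case: DB.
have cpsi : psi (A h ^+ 2 + B h ^+ 2) @[h --> 0^'] --> psi (0 ^+ 2 + B 0 ^+ 2).
  by have := psi_cvg cA cB; rewrite az; apply.
have cA' : h^-1 * A h @[h --> 0^'] --> A'.
  have [hA <-] := DA; rewrite /derive.
  move: hA; rewrite /derivable.
  rewrite (_ : (fun h : R => h^-1 *: (A (h *: 1 + 0) - A 0)) = (fun h : R => h^-1 * A h)) //.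
  by apply/funext => h; rewrite az subr0 addr0 /GRing.scale/= mulr1.
have cg : (fun h : R => h^-1 *: (gs (A (h *: 1 + 0)) (B (h *: 1 + 0)) - gs (A 0) (B 0))) @ 0^' -->
   dgs (A 0) (B 0) A' B'.
  rewrite /dgs az !mulr0 addr0 mulrC.
  rewrite (_ : (fun h : R => _) = (fun h : R => h^-1 * A h * psi (A h ^+ 2 + B h ^+ 2))).
    exact: cvgM cA' cpsi.
  by apply/funext => h; rewrite /gs mul0r subr0 !addr0 /GRing.scale/= mulr1 mulrA.
split; first by rewrite /derivable; apply/cvg_ex; exists (dgs (A 0) (B 0) A' B').
by rewrite /derive; apply: cvg_lim.
Qed.

Section derivative.
Context {n : nat}.
Local Notation T := 'rV[R]_n.
Variables (a b : T -> R) (l : 'I_n).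
Hypotheses (da : forall x : T, derivable a x (delta_mx 0 l))
           (db : forall x : T, derivable b x (delta_mx 0 l)).

Let line_derive (f : T -> R) (x v : T) (D : R) :
  is_derive (0 : R) (1 : R) (fun t : R => f (x + t *: v)) D -> is_derive x v f D.
Proof.
have e1 : (fun h : R => h^-1 *: (f (h *: v + x) - f x)) =
   (fun h : R => h^-1 *: (f (x + (h *: 1 + 0) *: v) - f (x + 0 *: v))).
  by apply/funext => h; rewrite scaler1 addr0 scale0r addr0 [_ *: _ + x]addrC.
by move=> [h1 h2]; split; rewrite /derivable /derive e1.
Qed.

Lemma is_derive_gs (x : T) : is_derive x (delta_mx 0 l : T) (fun y : T => gs (a y) (b y))
  (dgs (a x) (b x) (partial l a x) (partial l b x)).
Proof.
apply: line_derive.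
have Dl (f : T -> R) : (forall x : T, derivable f x (delta_mx 0 l)) ->
    is_derive (0 : R) (1 : R) (fun t : R => f (x + t *: delta_mx 0 l)) (partial l f x).
  move=> df; have := @derivable_line _ _ f x (delta_mx 0 l) 0 (df _).
  by rewrite scale0r addr0.
have := is_derive_gs1 (Dl a da) (Dl b db).
by rewrite scale0r addr0.
Qed.

Lemma partial_gs : partial l (fun y : T => gs (a y) (b y)) =
  (fun x : T => dgs (a x) (b x) (partial l a x) (partial l b x)).
Proof. by apply/funext => x; rewrite /partial (@derive_val _ _ _ _ _ _ _ (is_derive_gs x)). Qed.

End derivative.

Section measurability.
Context d (T : measurableType d).
Implicit Types f g : T -> R.

Lemma measurable_gs f g : measurable_fun setT f -> measurable_fun setT g ->
  measurable_fun setT (fun x : T => gs (f x) (g x)).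
Proof.
move=> mf mg; apply: measurable_funM => //.
apply: (measurableT_comp (@measurable_powR _ _)).
by apply: measurable_funD => //; apply: measurable_funD; exact: measurable_funX.
Qed.

Lemma measurable_dgs f g f' g' : measurable_fun setT f -> measurable_fun setT g ->
  measurable_fun setT f' -> measurable_fun setT g' ->
  measurable_fun setT (fun x : T => dgs (f x) (g x) (f' x) (g' x)).
Proof.
move=> mf mg mf' mg'.
have ms : measurable_fun setT (fun x : T => f x ^+ 2 + g x ^+ 2 + e).
  by apply: measurable_funD => //; apply: measurable_funD; exact: measurable_funX.
apply: measurable_funD.
  by apply: measurable_funM => //; exact: (measurableT_comp (@measurable_powR _ _)).
apply: measurable_funM => //; apply: measurable_funM.
  by apply: measurable_funM => //; exact: (measurableT_comp (@measurable_powR _ _)).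
by apply: measurable_funD; exact: measurable_funM.
Qed.

End measurability.

End regularized_power.

(** * The flux tested against a power *)

Section tested_flux.
Context {R : realType} {n : nat}.
Local Notation T := 'rV[R]_n.
Local Notation mu := (@lebesgue_rV R n).
Variables (p e c : R) (D : set T) (l : 'I_n).
Hypotheses (p1 : 1 < p) (pe : (2 <= p /\ e = 0) \/ (p < 2 /\ 0 < e)).
Hypotheses (c0 : 0 < c) (oD : open D).
Variables (I : eqType) (s : seq I) (v v' : I -> T -> R).
Hypothesis sv : forall i, strong D l (v i) (v' i).

Let X : T -> R := cutX c v s.
Let X' : T -> R := dcutX c v v' s.

(** The sum of [flux1] and [flux2] is the derivative of [r * (v i * X * g)], with
    [X] the cutoff, [flux2] being the part where [g] is differentiated. *)
Definition flux1 (r r' : T -> R) i (g : T -> R) : T -> R := fun x =>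
  r' x * (v i x * X x * g x) + r x * (v' i x * X x * g x) + r x * (v i x * X' x * g x).

Definition flux2 (r : T -> R) i (dg : T -> R) : T -> R := fun x =>
  r x * (v i x * X x * dg x).

Let mD : measurable D. Proof. exact: open_measurable_rV. Qed.

Let mv i : measurable_fun setT (v i). Proof. by have [[]] := sv i. Qed.
Let mv' i : measurable_fun setT (v' i). Proof. by have [_ []] := sv i. Qed.
Let sX : strong D l X X'. Proof. exact: strong_cutX. Qed.
Let mX : measurable_fun setT X. Proof. by have [[]] := sX. Qed.
Let mX' : measurable_fun setT X'. Proof. by have [_ []] := sX. Qed.

Lemma measurable_flux1 (r r' h : T -> R) i : measurable_fun setT r ->
  measurable_fun setT r' -> measurable_fun setT h -> measurable_fun setT (flux1 r r' i h).
Proof.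
move=> mr mr' mh; apply: measurable_funD; first apply: measurable_funD;
  by apply: measurable_funM => //; apply: measurable_funM => //; apply: measurable_funM.
Qed.

Section test.
Variables (A B : T -> R).
Hypotheses (tA : test_function D A) (tB : test_function D B).

Let g : T -> R := fun x => gs p e (A x) (B x).
Let dg : T -> R := fun x => dgs p e (A x) (B x) (partial l A x) (partial l B x).

Let supp : set T := fsupport A `|` fsupport B.

Let supp_out x : ~ supp x -> [/\ A x = 0, B x = 0, partial l A x = 0 & partial l B x = 0].
Proof.
move=> /not_orP[nA nB].
have [_ [_ [_ _ pA]]] := test_strong D l tA; have [_ [_ [_ _ pB]]] := test_strong D l tB.
by rewrite (fsupport_out nA) (fsupport_out nB) pA ?pB.
Qed.

Let strong_gs : exists M, strong D l g dg /\ bounded_fun_by M g.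
Proof.
have [sA [MA [hA hA' _]]] := test_strong D l tA.
have [sB [MB [hB hB' _]]] := test_strong D l tB.
(* at least 1, so that [mul_dgs_bound] applies with [y = 1] *)
pose t := Num.max 1 (Num.max MA MB).
have hAt x : `|A x| <= t by rewrite !le_max hA !orbT.
have hBt x : `|B x| <= t by rewrite !le_max hB !orbT.
have hA't x : `|partial l A x| <= t by rewrite !le_max hA' !orbT.
have hB't x : `|partial l B x| <= t by rewrite !le_max hB' !orbT.
have [k k0 hk] := mul_dgs_bound p1 pe 1.
exists ((1 + 2 `^ ((p - 2) / 2)) * t `^ (p - 1)); split; last first.
  by move=> x; exact: gs_bound.
have d f : test_function D f -> forall x : T, derivable f x (delta_mx 0 l).
  by move=> [sf _ _] x; apply/diff_derivable; exact: smooth_differentiable.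
rewrite (_ : dg = partial l g); last by rewrite partial_gs//; exact: d.
apply: (@strong_lipschitz _ _ _ _ _ ((1 + 2 `^ ((p - 2) / 2)) * t `^ (p - 1)) (k * t `^ p)).
- by apply: measurable_gs; apply: smooth_measurable; [case: tA|case: tB].
- by move=> x; have [] := is_derive_gs pe (d _ tA) (d _ tB) x.
- by move=> x; exact: gs_bound.
- move=> x; rewrite partial_gs//; try exact: d.
  have := hk _ _ _ _ _ 1 (hAt x) (hBt x) (hA't x) (hB't x).
  by rewrite normr1 mul1r; apply => //; rewrite le_max lexx.
Qed.

(** The product [v i * X] is bounded, so that the calculus of strong derivatives
    applies, and the test functions provide the compact support. *)
Lemma flux_test (r r' : T -> R) i (M : R) : i \in s -> strong D l r r' -> bounded_fun_by M r ->
  mu.-integrable D (EFin \o (fun x : T => flux1 r r' i g x + flux2 r i dg x)) /\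
  \int[mu]_(x in D) (flux1 r r' i g x + flux2 r i dg x) = 0.
Proof.
move=> si sr rM; have [N [sg gN]] := strong_gs.
have cK : compact supp by apply: compactU; [case: tA|case: tB].
have KD : supp `<=` D by move=> x []; [case: tA => _ _; apply|case: tB => _ _; apply].
pose B1 := Num.max M c^-1; pose B2 := Num.max (B1 * B1) N.
have sy := strong_mul_cutX c0 sv si.
have s1 := strongM sr sy (M := B1) _ _.
have s2 : strong D l (fun x : T => r x * (v i x * X x))
    (fun x : T => r' x * (v i x * X x) + r x * (v' i x * X x + v i x * X' x)).
  by apply: s1 => x; rewrite le_max ?rM// (mul_cutX_bound v c0 x si) orbT.
have s3 := strongM s2 sg (M := B2) _ _.
have s4 : strong D l (fun x : T => r x * (v i x * X x) * g x)
    (fun x : T => flux1 r r' i g x + flux2 r i dg x).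
  rewrite (_ : (fun x : T => flux1 r r' i g x + _) = (fun x : T => (r' x * (v i x * X x) +
    r x * (v' i x * X x + v i x * X' x)) * g x + r x * (v i x * X x) * dg x)); last first.
    by apply/funext => x; rewrite /flux1 /flux2; ring.
  apply: s3 => x; rewrite le_max ?gN ?orbT//; apply/orP; left.
  rewrite normrM; apply: ler_pM => //; rewrite le_max ?rM//.
  by rewrite (mul_cutX_bound v c0 x si) orbT.
have out x : ~ supp x -> g x = 0 /\ dg x = 0.
  by move=> /supp_out[h1 h2 h3 h4]; rewrite /g /dg h1 h2 h3 h4 /gs /dgs !(mulr0, mul0r) addr0.
have f0 x : ~ supp x -> flux1 r r' i g x + flux2 r i dg x = 0.
  by move=> /out[h1 h2]; rewrite /flux1 /flux2 h1 h2 !mulr0 !addr0.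
split.
  apply: (@integrable_supp _ _ _ supp) => //; first exact: compact_measurable_rV.
  by case: s4 => _ [_ h] _; exact: h.
apply: (strong_integral0 oD cK KD s4) => //.
by move=> x /out[-> _]; rewrite mulr0.
Qed.

End test.

Section limit.
Variables (a b a' b' m : T -> R) (A B : nat -> T -> R).
Hypotheses (ma : measurable_fun setT a) (mb : measurable_fun setT b).
Hypotheses (ma' : measurable_fun setT a') (mb' : measurable_fun setT b').
Hypotheses (tA : forall j, test_function D (A j)) (tB : forall j, test_function D (B j)).
Hypothesis mI : mu.-integrable D (EFin \o (fun x : T => m x `^ p)).
Hypothesis hm : forall x, D x ->
  [/\ `|a x| <= m x, `|b x| <= m x, `|a' x| <= m x & `|b' x| <= m x].
Hypothesis hv : forall x, D x -> \sum_(i <- s) `|v' i x| <= m x.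
Hypothesis hv0 : forall i x, D x -> `|v i x| <= m x.
Hypothesis hv1 : forall i x, D x -> `|v' i x| <= m x.
Hypothesis AB : {ae mu, forall x, D x ->
  (forall j, [/\ `|A j x| <= m x, `|B j x| <= m x, `|partial l (A j) x| <= m x &
     `|partial l (B j) x| <= m x]) /\
  [/\ A j x @[j --> \oo] --> a x, B j x @[j --> \oo] --> b x,
      partial l (A j) x @[j --> \oo] --> a' x & partial l (B j) x @[j --> \oo] --> b' x]}.

Lemma flux1_bound (r r' : T -> R) i (M x y : R) (w : T) : D w -> i \in s ->
  bounded_fun_by M r -> bounded_fun_by M r' -> `|x| <= m w -> `|y| <= m w ->
  `|flux1 r r' i (fun _ => gs p e x y) w| <= (M * 3 * (1 + 2 `^ ((p - 2) / 2))) * m w `^ p.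
Proof.
move=> Dw si rM r'M hx hy; have M0 : 0 <= M by exact: le_trans (rM 0).
have key (q u : R) : `|q| <= M -> `|u| <= m w ->
    `|q * (u * gs p e x y)| <= M * ((1 + 2 `^ ((p - 2) / 2)) * m w `^ p).
  by move=> hq hu; rewrite normrM; apply: ler_pM => //; exact: mul_gs_bound.
have X1 u : `|u| <= m w -> `|u * X w| <= m w.
  by move=> hu; rewrite normrM -[leRHS]mulr1; apply: ler_pM => //; exact: norm_cutX.
rewrite [leRHS](_ : _ = M * ((1 + 2 `^ ((p - 2) / 2)) * m w `^ p) +
  M * ((1 + 2 `^ ((p - 2) / 2)) * m w `^ p) + M * ((1 + 2 `^ ((p - 2) / 2)) * m w `^ p)); last by ring.
rewrite /flux1 !(le_trans (ler_normD _ _))//; apply: lerD; last first.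
  by apply: key => //; apply: le_trans (hv Dw); exact: mul_dcutX_bound.
by rewrite !(le_trans (ler_normD _ _))//; apply: lerD; apply: key => //; apply: X1; auto.
Qed.

Lemma flux2_bound (M : R) : exists2 k, 0 <= k & forall (r : T -> R) i (x y x' y' : R) (w : T),
  D w -> i \in s -> bounded_fun_by M r ->
  `|x| <= m w -> `|y| <= m w -> `|x'| <= m w -> `|y'| <= m w ->
  `|flux2 r i (fun _ => dgs p e x y x' y') w| <= k * m w `^ p.
Proof.
have [k k0 hk] := mul_dgs_bound p1 pe c^-1.
exists (`|M| * k); first by rewrite mulr_ge0.
move=> r i x y x' y' w Dw si rM hx hy hx' hy'.
rewrite /flux2 normrM -[leRHS]mulrA; apply: ler_pM => //.
  exact: le_trans (rM w) (ler_norm _).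
apply: hk => //; last exact: mul_cutX_bound.
by rewrite normrM -[leRHS]mulr1; apply: ler_pM => //; [exact: hv0|exact: norm_cutX].
Qed.

Lemma flux_integral0 (r r' : T -> R) i (M : R) : i \in s -> strong D l r r' ->
  bounded_fun_by M r -> bounded_fun_by M r' ->
  let g x := gs p e (a x) (b x) in
  let dg x := dgs p e (a x) (b x) (a' x) (b' x) in
  [/\ mu.-integrable D (EFin \o flux1 r r' i g), mu.-integrable D (EFin \o flux2 r i dg) &
  \int[mu]_(x in D) (flux1 r r' i g x + flux2 r i dg x) = 0].
Proof.
move=> si sr rM r'M g dg.
have [[mr _] [mr' _] _] := sr.
have [k k0 hk] := flux2_bound M.
pose k1 := M * 3 * (1 + 2 `^ ((p - 2) / 2)).
have M0 : 0 <= M by exact: le_trans (rM 0).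
have k10 : 0 <= k1 by rewrite !mulr_ge0// addr_ge0// powR_ge0.
have mf1 h : measurable_fun setT h -> measurable_fun setT (flux1 r r' i h).
  exact: measurable_flux1.
have mf2 h : measurable_fun setT h -> measurable_fun setT (flux2 r i h).
  by move=> mh; apply: measurable_funM => //; apply: measurable_funM => //; apply: measurable_funM.
have mg : measurable_fun setT g by exact: measurable_gs.
have mdg : measurable_fun setT dg by exact: measurable_dgs.
have dom (h : T -> R) (q : R) : measurable_fun setT h -> 0 <= q -> (forall x, D x -> `|h x| <= q * m x `^ p) ->
    mu.-integrable D (EFin \o h).
  move=> mh q0 hh; apply: (@le_integrable _ _ _ mu D mD _ (fun x : T => q%:E * (m x `^ p)%:E)%E).
  - by apply: measurable_funTS; exact/measurable_EFinP.
  - by move=> x Dx; rewrite /= lee_fin (le_trans (hh x Dx))// ler_norm.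
  - exact: integrableZl.
have i1 : mu.-integrable D (EFin \o flux1 r r' i g).
  by apply: (dom _ k1) => //; [exact: mf1|move=> x Dx; have [? ? _ _] := hm Dx; exact: flux1_bound].
have i2 : mu.-integrable D (EFin \o flux2 r i dg).
  by apply: (dom _ k) => //; [exact: mf2|move=> x Dx; have [? ? ? ?] := hm Dx; exact: hk].
split => //.
pose G j x := flux1 r r' i (fun x => gs p e (A j x) (B j x)) x +
  flux2 r i (fun x => dgs p e (A j x) (B j x) (partial l (A j) x) (partial l (B j) x)) x.
have mG j : measurable_fun setT (G j).
  have mt f : test_function D f -> measurable_fun setT f /\ measurable_fun setT (partial l f).
    by move=> [sf _ _]; split; apply: smooth_measurable => //; exact: smooth_partial.
  have [mA mA'] := mt _ (tA j); have [mB mB'] := mt _ (tB j).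
  by apply: measurable_funD; [apply: mf1; exact: measurable_gs|apply: mf2; exact: measurable_dgs].
have mH : measurable_fun setT (fun x : T => flux1 r r' i g x + flux2 r i dg x).
  by apply: measurable_funD; [exact: mf1|exact: mf2].
apply: (@Rintegral_lim0 _ _ _ G) => //.
- by move=> j; have [] := flux_test (tA j) (tB j) si sr rM.
- by have := integrableD mD i1 i2.
- by move=> j; have [] := flux_test (tA j) (tB j) si sr rM.
apply: (@L1to0_dct _ _ _ _ _ _ (fun x => 2 * ((k1 + k) * m x `^ p))) => //.
- by move=> j; exact: measurable_funB.
- rewrite (_ : _ \o _ = (fun x : T => (2 * (k1 + k))%:E * (m x `^ p)%:E)%E); first exact: integrableZl.
  by apply/funext => x; rewrite /= -EFinM mulrA.
- apply: filterS AB => x h Dx; have [_ [ca cb ca' cb']] := h Dx.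
  have cg := gs_cvg pe ca cb; have cdg := dgs_cvg pe ca cb ca' cb'.
  apply/subr_cvg0; apply: cvgD; last by apply: cvgMr; apply: cvgMr; exact: cdg.
  by apply: cvgD; first apply: cvgD; apply: cvgMr; apply: cvgMr; exact: cg.
- apply: filterS AB => x h j Dx; have [h1 _] := h Dx; have [? ? ? ?] := h1 j.
  have [? ? ? ?] := hm Dx.
  rewrite (le_trans (ler_normB _ _))// (_ : 2 * _ = (k1 * m x `^ p + k * m x `^ p) + (k1 * m x `^ p + k * m x `^ p)); last by ring.
  by apply: lerD; rewrite (le_trans (ler_normD _ _))//; apply: lerD; by [exact: flux1_bound|exact: hk].
Qed.

End limit.

End tested_flux.

(** * Removal of the cutoff *)

Section vanishing_cutoff.
Context {R : realType} {n : nat}.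
Local Notation T := 'rV[R]_n.
Local Notation mu := (@lebesgue_rV R n).
Implicit Types (D : set T) (f g : T -> R).

Lemma Rintegral_lim_le0 D (G : nat -> T -> R) g : measurable D -> measurable_fun setT g ->
  (forall N, mu.-integrable D (EFin \o G N)) -> mu.-integrable D (EFin \o g) ->
  (forall N, \int[mu]_(x in D) G N x <= 0) -> L1to0 mu D (fun (N : nat) (x : T) => G N x - g x) ->
  \int[mu]_(x in D) g x <= 0.
Proof.
move=> mD mg iG ig G0 [mF hF]; apply/ler_addgt0Pr => d d0; rewrite add0r.
have [N hN] := filter_ex (hF _ d0).
have iGg : mu.-integrable D (EFin \o (fun x : T => G N x - g x)).
  by have := integrableB mD (iG N) ig.
have h : `|\int[mu]_(x in D) (G N x - g x)| <= d.
  rewrite -lee_fin; apply: le_trans hN.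
  rewrite /N1 EFin_normr_Rintegral//; apply: le_abse_integral => //.
  by apply/measurable_EFinP; apply: measurable_funTS; exact: mF.
move: h; rewrite RintegralB// ler_norml => /andP[h _]; have := G0 N; lra.
Qed.

Definition null_integral D f := mu.-integrable D (EFin \o f) /\ \int[mu]_(x in D) f x = 0.

Lemma integrable_sumR (J : Type) (s : seq J) (F : J -> T -> R) D : measurable D ->
  (forall i, mu.-integrable D (EFin \o F i)) ->
  mu.-integrable D (EFin \o (fun x : T => \sum_(i <- s) F i x)).
Proof.
move=> mD iF; elim: s => [|i s ih].
  rewrite (_ : _ \o _ = cst 0%E); first exact: integrable0.
  by apply/funext => x; rewrite /= big_nil.
rewrite (_ : _ \o _ = (EFin \o F i) \+ (EFin \o (fun x : T => \sum_(i <- s) F i x)%R))%E.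
  exact: integrableD.
by apply/funext => x; rewrite /= big_cons.
Qed.

Lemma null_integralD D f g : measurable D -> null_integral D f -> null_integral D g ->
  null_integral D (fun x : T => f x + g x).
Proof.
move=> mD [if_ f0] [ig g0]; split; first by have := integrableD mD if_ ig.
by rewrite RintegralD// f0 g0 addr0.
Qed.

Lemma null_integralN D f : measurable D -> null_integral D f ->
  null_integral D (fun x : T => - f x).
Proof.
move=> mD [if_ f0]; split; last by rewrite RintegralN// f0 oppr0.
by rewrite (_ : _ \o _ = \- (EFin \o f))%E//; exact: integrableN.
Qed.

Lemma null_integral_sum (J : Type) (s : seq J) (F : J -> T -> R) D : measurable D ->
  (forall i, null_integral D (F i)) -> null_integral D (fun x : T => \sum_(i <- s) F i x).
Proof.
move=> mD iF; elim: s => [|i s ih].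
  rewrite (_ : (fun x : T => _) = cst 0); last by apply/funext => x; rewrite big_nil.
  split; last by rewrite Rintegral_cst ?mul0r.
  by rewrite (_ : _ \o _ = cst 0%E)//; exact: integrable0.
rewrite (_ : (fun x : T => _) = (fun x : T => F i x + \sum_(i <- s) F i x)); last first.
  by apply/funext => x; rewrite big_cons.
exact: null_integralD.
Qed.

Lemma L1to0_sum (J : Type) (s : seq J) (F : J -> nat -> T -> R) D : measurable D ->
  (forall i, L1to0 mu D (F i)) -> L1to0 mu D (fun N (x : T) => \sum_(i <- s) F i N x).
Proof.
move=> mD hF; elim: s => [|i s ih].
  rewrite (_ : (fun _ => _) = (fun _ _ => 0)); last first.
    by apply/funext => N; apply/funext => x; rewrite big_nil.
  split => // e e0; apply: nearW => j.
  rewrite /N1 (eq_integral (cst 0%E)) ?integral0 ?lee_fin ?ltW// => x _.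
  by rewrite normr0.
rewrite (_ : (fun _ => _) = (fun N x => F i N x + \sum_(i <- s) F i N x)); last first.
  by apply/funext => N; apply/funext => x; rewrite big_cons.
exact: L1to0D.
Qed.

Lemma cvg_norm_le (f : nat -> R) (y K : R) : (forall j, `|f j| <= K) ->
  f j @[j --> \oo] --> y -> `|y| <= K.
Proof.
move=> fK /cvgrPdist_le hf; apply/ler_addgt0Pr => d d0.
have [j hj] := filter_ex (hf _ d0).
rewrite -[y](subrK (f j)) addrC (le_trans (ler_normD _ _))//.
exact: lerD.
Qed.

End vanishing_cutoff.

Section dissipativity.
Context {R : realType} {n : nat}.
Local Notation T := 'rV[R]_n.
Local Notation mu := (@lebesgue_rV R n).

(** The power [|z|^(p-2) z] is regularised only for [p < 2]. *)
Definition reg (p : R) (N : nat) : R := if 2 <= p then 0 else N.+1%:R^-1.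

Lemma regP (p : R) N : (2 <= p /\ reg p N = 0) \/ (p < 2 /\ 0 < reg p N).
Proof. by rewrite /reg; case: leP => h; [left|right; rewrite invr_gt0]. Qed.

Lemma gs_reg_cvg (p a b : R) : gs p (reg p N) a b @[N --> \oo] --> gs p 0 a b.
Proof.
have [->|a0] := eqVneq a 0.
  by rewrite /gs mul0r; under eq_fun do rewrite mul0r; exact: cvg_cst.
rewrite /gs; apply: cvgMr; rewrite /psi /reg.
case: (boolP (2 <= p)) => _; first exact: cvg_cst.
have s0 : 0 < a ^+ 2 + b ^+ 2 + 0.
  by rewrite addr0 ltr_wpDr ?sqr_ge0// exprn_even_gt0.
apply: (@continuous_cvg _ _ _ _ _ (fun N : nat => a ^+ 2 + b ^+ 2 + N.+1%:R^-1)
  (fun t : R => t `^ ((p - 2) / 2))).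
  apply: differentiable_continuous; apply/derivable1_diffP.
  by apply: derivable_powR; rewrite in_itv/= s0.
by apply: cvgD; [exact: cvg_cst|exact: cvg_harmonic].
Qed.

Definition flux0 (r r' v v' g : T -> R) : T -> R := fun x =>
  (r' x * v x + r x * v' x) * g x.

Variables (p M : R) (D : set T) (r b r' b' : 'I_n -> 'I_n -> T -> R).
Variables (al be : 'I_n -> T -> R) (al' be' : 'I_n -> 'I_n -> T -> R).
Variables (u w m : T -> R) (A B : nat -> T -> R).
Hypotheses (p1 : 1 < p) (oD : open D).
Hypotheses (sr : forall k l, strong D l (r k l) (r' k l))
           (sb : forall k l, strong D l (b k l) (b' k l)).
Hypotheses (rM : forall k l, bounded_fun_by M (r k l)) (bM : forall k l, bounded_fun_by M (b k l))
  (r'M : forall k l, bounded_fun_by M (r' k l)) (b'M : forall k l, bounded_fun_by M (b' k l)).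
Hypotheses (sal : forall l k, strong D l (al k) (al' l k))
           (sbe : forall l k, strong D l (be k) (be' l k)).
Hypotheses (mfu : measurable_fun setT u) (mfw : measurable_fun setT w).
Hypotheses (tA : forall j, test_function D (A j)) (tB : forall j, test_function D (B j)).
Hypothesis mI : mu.-integrable D (EFin \o (fun x : T => m x `^ p)).
Hypothesis hm : forall x, D x -> `|u x| <= m x /\ `|w x| <= m x.
Hypothesis hm1 : forall x k, D x -> `|al k x| <= m x /\ `|be k x| <= m x.
Hypothesis hm2 : forall x l, D x -> \sum_k (`|al' l k x| + `|be' l k x|) <= m x.
Hypothesis AB : {ae mu, forall x, D x ->
  (forall j, [/\ `|A j x| <= m x, `|B j x| <= m x &
     forall l, `|partial l (A j) x| <= m x /\ `|partial l (B j) x| <= m x]) /\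
  [/\ A j x @[j --> \oo] --> u x, B j x @[j --> \oo] --> w x &
    forall l, partial l (A j) x @[j --> \oo] --> al l x /\
      partial l (B j) x @[j --> \oo] --> be l x]}.

Let v (i : 'I_n * bool) : T -> R := if i.2 then al i.1 else be i.1.
Let v' l (i : 'I_n * bool) : T -> R := if i.2 then al' l i.1 else be' l i.1.
Let s : seq ('I_n * bool) := enum {: 'I_n * bool}.

Let si i : i \in s. Proof. by rewrite mem_enum. Qed.
Let mD : measurable D. Proof. exact: open_measurable_rV. Qed.

Let sv l i : strong D l (v i) (v' l i).
Proof. by case: i => k [|] /=; [exact: sal|exact: sbe]. Qed.

Let hv l x : D x -> \sum_(i <- s) `|v' l i x| <= m x.
Proof.
move=> Dx; apply: le_trans (hm2 l Dx).
rewrite /s big_enum /= -(pair_bigA _ (fun k t => `|v' l (k, t) x|))/=.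
by apply: ler_sum => k _; rewrite big_bool.
Qed.

Let hv0 i x : D x -> `|v i x| <= m x.
Proof. by case: i => k [|] Dx /=; have [? ?] := hm1 k Dx. Qed.

Let hv1 l i x : D x -> `|v' l i x| <= m x.
Proof.
move=> Dx; apply: le_trans (hv l Dx); rewrite (big_rem i)//= lerDl.
by apply: sumr_ge0.
Qed.

Let cN N : R := N.+1%:R^-1.
Let cN0 N : 0 < cN N. Proof. by rewrite invr_gt0. Qed.

Let mal k : measurable_fun setT (al k). Proof. by have [[]] := sal k k. Qed.
Let mbe k : measurable_fun setT (be k). Proof. by have [[]] := sbe k k. Qed.

Let g1 N x := gs p (reg p N) (u x) (w x).
Let g2 N x := gs p (reg p N) (w x) (u x).
Let d1 N l x := dgs p (reg p N) (u x) (w x) (al l x) (be l x).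
Let d2 N l x := dgs p (reg p N) (w x) (u x) (be l x) (al l x).

Let F1 N (r r' : T -> R) l i g := flux1 (cN N) s v (v' l) r r' i g.
Let F2 N (r : T -> R) i dg := flux2 (cN N) s v r i dg.

Let ok1 N (q q' : T -> R) l i : strong D l q q' -> bounded_fun_by M q -> bounded_fun_by M q' ->
  [/\ mu.-integrable D (EFin \o F1 N q q' l i (g1 N)), mu.-integrable D (EFin \o F2 N q i (d1 N l)) &
  \int[mu]_(x in D) (F1 N q q' l i (g1 N) x + F2 N q i (d1 N l) x) = 0].
Proof.
move=> sq qM q'M.
apply: (@flux_integral0 R n p (reg p N) (cN N) D l p1 (regP p N) (cN0 N) oD _ s v (v' l) (sv l)
  u w (al l) (be l) m A B) => //.
- by move=> x Dx; have [? ?] := hm Dx; have [? ?] := hm1 l Dx.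
- exact: hv.
- by move=> j x; exact: hv1.
- apply: filterS AB => x h Dx; have [h1 [h2 h3 h4]] := h Dx; split.
    by move=> j; have [? ? h5] := h1 j; have [? ?] := h5 l.
  by have [? ?] := h4 l.
Qed.

Let ok2 N (q q' : T -> R) l i : strong D l q q' -> bounded_fun_by M q -> bounded_fun_by M q' ->
  [/\ mu.-integrable D (EFin \o F1 N q q' l i (g2 N)), mu.-integrable D (EFin \o F2 N q i (d2 N l)) &
  \int[mu]_(x in D) (F1 N q q' l i (g2 N) x + F2 N q i (d2 N l) x) = 0].
Proof.
move=> sq qM q'M.
apply: (@flux_integral0 R n p (reg p N) (cN N) D l p1 (regP p N) (cN0 N) oD _ s v (v' l) (sv l)
  w u (be l) (al l) m B A) => //.
- by move=> x Dx; have [? ?] := hm Dx; have [? ?] := hm1 l Dx.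
- exact: hv.
- by move=> j x; exact: hv1.
- apply: filterS AB => x h Dx; have [h1 [h2 h3 h4]] := h Dx; split.
    by move=> j; have [? ? h5] := h1 j; have [? ?] := h5 l.
  by have [? ?] := h4 l.
Qed.

Let H1 N k l x := (F1 N (r k l) (r' k l) l (k, true) (g1 N) x - F1 N (b k l) (b' k l) l (k, false) (g1 N) x)
  + (F1 N (r k l) (r' k l) l (k, false) (g2 N) x + F1 N (b k l) (b' k l) l (k, true) (g2 N) x).
Let H2 N k l x := (F2 N (r k l) (k, true) (d1 N l) x - F2 N (b k l) (k, false) (d1 N l) x)
  + (F2 N (r k l) (k, false) (d2 N l) x + F2 N (b k l) (k, true) (d2 N l) x).
(** Real part of [d_l (c_kl v_k) conj g], with [c = r + i b], [v = al + i be]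
    and [g = gs p 0 u w + i gs p 0 w u]. *)
Definition flux_density k l x : R := (flux0 (r k l) (r' k l) (al k) (al' l k) (fun x => gs p 0 (u x) (w x)) x -
    flux0 (b k l) (b' k l) (be k) (be' l k) (fun x => gs p 0 (u x) (w x)) x)
  + (flux0 (r k l) (r' k l) (be k) (be' l k) (fun x => gs p 0 (w x) (u x)) x +
    flux0 (b k l) (b' k l) (al k) (al' l k) (fun x => gs p 0 (w x) (u x)) x).

Let iDB f g h q : mu.-integrable D (EFin \o f) -> mu.-integrable D (EFin \o g) ->
  mu.-integrable D (EFin \o h) -> mu.-integrable D (EFin \o q) ->
  mu.-integrable D (EFin \o (fun x : T => (f x - g x) + (h x + q x))).
Proof.
move=> i1 i2 i3 i4; have j1 := integrableB mD i1 i2; have j2 := integrableD mD i3 i4.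
by have := integrableD mD j1 j2.
Qed.

Let iH1 N k l : mu.-integrable D (EFin \o H1 N k l).
Proof.
by apply: iDB;
  [have [] := ok1 N (k, true) (sr k l) (rM k l) (r'M k l)
  |have [] := ok1 N (k, false) (sb k l) (bM k l) (b'M k l)
  |have [] := ok2 N (k, false) (sr k l) (rM k l) (r'M k l)
  |have [] := ok2 N (k, true) (sb k l) (bM k l) (b'M k l)].
Qed.

Let iH2 N k l : mu.-integrable D (EFin \o H2 N k l).
Proof.
by apply: iDB;
  [have [] := ok1 N (k, true) (sr k l) (rM k l) (r'M k l)
  |have [] := ok1 N (k, false) (sb k l) (bM k l) (b'M k l)
  |have [] := ok2 N (k, false) (sr k l) (rM k l) (r'M k l)
  |have [] := ok2 N (k, true) (sb k l) (bM k l) (b'M k l)].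
Qed.

Let H12 N k l : null_integral D (fun x : T => H1 N k l x + H2 N k l x).
Proof.
pose Q q q' i x := F1 N q q' l i (g1 N) x + F2 N q i (d1 N l) x.
pose Q' q q' i x := F1 N q q' l i (g2 N) x + F2 N q i (d2 N l) x.
have z1 q q' i : strong D l q q' -> bounded_fun_by M q -> bounded_fun_by M q' ->
    null_integral D (Q q q' i).
  move=> h1 h2 h3; have [i1 i2 i0] := ok1 N i h1 h2 h3; split => //.
  by have := integrableD mD i1 i2.
have z2 q q' i : strong D l q q' -> bounded_fun_by M q -> bounded_fun_by M q' ->
    null_integral D (Q' q q' i).
  move=> h1 h2 h3; have [i1 i2 i0] := ok2 N i h1 h2 h3; split => //.
  by have := integrableD mD i1 i2.
rewrite (_ : (fun x : T => _) = (fun x : T =>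
  (Q (r k l) (r' k l) (k, true) x + (- Q (b k l) (b' k l) (k, false) x)) +
  (Q' (r k l) (r' k l) (k, false) x + Q' (b k l) (b' k l) (k, true) x))); last first.
  by apply/funext => x; rewrite /Q /Q' /H1 /H2; ring.
apply: null_integralD => //; apply: null_integralD => //.
- exact: z1.
- by apply: null_integralN => //; exact: z1.
- exact: z2.
- exact: z2.
Qed.

Hypothesis pos : forall e x, (2 <= p /\ e = 0) \/ (p < 2 /\ 0 < e) -> D x ->
  0 <= \sum_k \sum_l
   ((r k l x * al k x - b k l x * be k x) * dgs p e (u x) (w x) (al l x) (be l x) +
    (r k l x * be k x + b k l x * al k x) * dgs p e (w x) (u x) (be l x) (al l x)).

Let H2_ge0 N x : D x -> 0 <= \sum_k \sum_l H2 N k l x.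
Proof.
move=> Dx; rewrite (_ : \sum_k _ = cutX (cN N) v s x * \sum_k \sum_l
   ((r k l x * al k x - b k l x * be k x) * d1 N l x +
    (r k l x * be k x + b k l x * al k x) * d2 N l x)).
  by apply: mulr_ge0; [exact/ltW/cutX_gt0|exact: pos (regP p N) Dx].
rewrite mulr_sumr; apply: eq_bigr => k _; rewrite mulr_sumr; apply: eq_bigr => l _.
by rewrite /H2 /F2 /flux2 /v /=; ring.
Qed.

Let intH1 N : \int[mu]_(x in D) (\sum_k \sum_l H1 N k l x) <= 0.
Proof.
have i1 : mu.-integrable D (EFin \o (fun x : T => \sum_k \sum_l H1 N k l x)).
  by apply: integrable_sumR => // k; exact: integrable_sumR.
have i2 : mu.-integrable D (EFin \o (fun x : T => \sum_k \sum_l H2 N k l x)).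
  by apply: integrable_sumR => // k; exact: integrable_sumR.
have [_] : null_integral D (fun x : T => \sum_k \sum_l (H1 N k l x + H2 N k l x)).
  by apply: null_integral_sum => // k; exact: null_integral_sum.
rewrite (eq_Rintegral_in (g := fun x : T => \sum_k \sum_l H1 N k l x + \sum_k \sum_l H2 N k l x)); last first.
  move=> x _; rewrite -big_split; apply: eq_bigr => k _.
  by rewrite -big_split.
rewrite RintegralD// => /eqP; rewrite addr_eq0 => /eqP ->; rewrite oppr_le0.
by apply: Rintegral_ge0 => x; exact: H2_ge0.
Qed.

Let lim1 (q q' : T -> R) l i (a a' : T -> R) : strong D l q q' ->
  bounded_fun_by M q -> bounded_fun_by M q' ->
  measurable_fun setT a -> measurable_fun setT a' ->
  (forall x, D x -> `|a x| <= m x /\ `|a' x| <= m x) ->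
  L1to0 mu D (fun N x => F1 N q q' l i (fun x => gs p (reg p N) (a x) (a' x)) x -
    flux0 q q' (v i) (v' l i) (fun x => gs p 0 (a x) (a' x)) x) /\
  mu.-integrable D (EFin \o flux0 q q' (v i) (v' l i) (fun x => gs p 0 (a x) (a' x))).
Proof.
move=> sq qM q'M ma ma' ham.
have [[mq _] [mq' _] _] := sq; have [[mv _] [mv' _] _] := sv l i.
have M0 : 0 <= M by exact: le_trans (qM 0).
pose k1 := M * 3 * (1 + 2 `^ ((p - 2) / 2)).
pose g N x := gs p (reg p N) (a x) (a' x); pose g0 x := gs p 0 (a x) (a' x).
have m0 : measurable_fun setT (flux0 q q' (v i) (v' l i) g0).
  apply: measurable_funM; last exact: measurable_gs.
  by apply: measurable_funD; exact: measurable_funM.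
have m1 N : measurable_fun setT (F1 N q q' l i (g N)).
  by apply: (measurable_flux1 (cN0 N) s (sv l) i) => //; exact: measurable_gs.
have cv x : F1 N q q' l i (g N) x @[N --> \oo] --> flux0 q q' (v i) (v' l i) g0 x.
  have cg : g N x @[N --> \oo] --> g0 x by exact: gs_reg_cvg.
  have cX : cutX (cN N) v s x @[N --> \oo] --> (1 : R) by exact: cutX_cvg1.
  have cX' : dcutX (cN N) v (v' l) s x @[N --> \oo] --> (0 : R).
    have hc : cN N * \sum_(j <- s) `|v' l j x| @[N --> \oo] --> (0 : R).
      have := @cvgMl _ _ _ _ _ _ (\sum_(j <- s) `|v' l j x|) (@cvg_harmonic R).
      by rewrite mul0r; apply.
    apply/cvgrPdist_le => /= d d0; move/cvgrPdist_le : hc => /(_ _ d0); apply: filterS => N.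
    rewrite !sub0r !normrN => h; apply: le_trans (dcutX_bound v (v' l) (cN0 N) s x) _.
    exact: le_trans (ler_norm _) h.
  rewrite (_ : flux0 _ _ _ _ _ _ = q' x * (v i x * 1 * g0 x) + q x * (v' l i x * 1 * g0 x) +
     q x * (v i x * 0 * g0 x)); last by rewrite /flux0; ring.
  by apply: cvgD; first apply: cvgD; apply: cvgMr; apply: cvgM => //; exact: cvgMr.
have bd N x : D x -> `|F1 N q q' l i (g N) x| <= k1 * m x `^ p.
  move=> Dx; have [? ?] := ham x Dx.
  exact: (flux1_bound p1 (regP p N) (cN0 N) (@hv l) hv0 (@hv1 l)).
have bd0 x : D x -> `|flux0 q q' (v i) (v' l i) g0 x| <= k1 * m x `^ p.
  by move=> Dx; apply: cvg_norm_le (cv x) => N; exact: bd.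
have ik (c : R) : mu.-integrable D (EFin \o (fun x : T => c * m x `^ p)).
  by under [_ \o _]eq_fun do rewrite /= EFinM; exact: integrableZl.
split.
  apply: (@L1to0_dct _ _ _ _ _ _ (fun x => (k1 + k1) * m x `^ p)) => //.
  - by move=> N; apply: measurable_funB => //; exact: m1.
  - by apply: aeW => x _; apply/subr_cvg0; exact: cv.
  - apply: aeW => x N Dx; rewrite mulrDl (le_trans (ler_normB _ _))// lerD//; [exact: bd|exact: bd0].
apply: (le_integrable mD _ _ (ik k1)).
  by apply: measurable_funTS; exact/measurable_EFinP.
by move=> x Dx; rewrite /= lee_fin (le_trans (bd0 x Dx))// ler_norm.
Qed.

Let hm' x : D x -> `|w x| <= m x /\ `|u x| <= m x.
Proof. by move=> /hm[]. Qed.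

Lemma integrable_flux :
  mu.-integrable D (EFin \o (fun x : T => \sum_k \sum_l flux_density k l x)).
Proof.
apply: integrable_sumR => // k; apply: integrable_sumR => // l; apply: iDB.
  - by have [_] := lim1 (k, true) (sr k l) (rM k l) (r'M k l) mfu mfw hm.
  - by have [_] := lim1 (k, false) (sb k l) (bM k l) (b'M k l) mfu mfw hm.
  - by have [_] := lim1 (k, false) (sr k l) (rM k l) (r'M k l) mfw mfu hm'.
  - by have [_] := lim1 (k, true) (sb k l) (bM k l) (b'M k l) mfw mfu hm'.
Qed.

(** With the cutoff in place, the terms where [g] is differentiated add up to a
    nonnegative function, because the cutoff is positive; hence the others have
    a nonpositive integral, and they converge to [flux_density]. *)
Lemma integral_flux_le0 : \int[mu]_(x in D) (\sum_k \sum_l flux_density k l x) <= 0.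
Proof.
have hl : L1to0 mu D (fun N x => \sum_k \sum_l (H1 N k l x - flux_density k l x)).
  apply: L1to0_sum => // k; apply: L1to0_sum => // l.
  have [l1 _] := lim1 (k, true) (sr k l) (rM k l) (r'M k l) mfu mfw hm.
  have [l2 _] := lim1 (k, false) (sb k l) (bM k l) (b'M k l) mfu mfw hm.
  have [l3 _] := lim1 (k, false) (sr k l) (rM k l) (r'M k l) mfw mfu hm'.
  have [l4 _] := lim1 (k, true) (sb k l) (bM k l) (b'M k l) mfw mfu hm'.
  have := L1to0D mD (L1to0D mD l1 (L1to0Z (-1) mD l2)) (L1to0D mD l3 l4).
  rewrite (_ : (fun (j : nat) (x : T) => _) = (fun N x => H1 N k l x - flux_density k l x))//.
  by apply/funext => N; apply/funext => x; rewrite /H1 /flux_density /F1 /=; ring.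
have sumB N x : \sum_k \sum_l (H1 N k l x - flux_density k l x) =
    \sum_k \sum_l H1 N k l x - \sum_k \sum_l flux_density k l x.
  rewrite -sumrB; apply: eq_bigr => k _; exact: sumrB.
apply: (@Rintegral_lim_le0 _ _ _ (fun N x => \sum_k \sum_l H1 N k l x)) => //; last 2 first.
- exact: integrable_flux.
- by under eq_fun => N do under eq_fun => x do rewrite -sumB.
- have mf0 q q' k l t a a' : strong D l q q' -> measurable_fun setT a -> measurable_fun setT a' ->
     measurable_fun setT (flux0 q q' (v (k, t)) (v' l (k, t)) (fun x => gs p 0 (a x) (a' x))).
    move=> [[mq _] [mq' _] _] ma ma'; have [[mv _] [mv' _] _] := sv l (k, t).
    apply: measurable_funM; last exact: measurable_gs.
    by apply: measurable_funD; exact: measurable_funM.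
  apply: measurable_sum => k; apply: measurable_sum => l.
  apply: measurable_funD; [apply: measurable_funB|apply: measurable_funD].
  + exact: (@mf0 _ _ k l true).
  + exact: (@mf0 _ _ k l false).
  + exact: (@mf0 _ _ k l false).
  + exact: (@mf0 _ _ k l true).
- by move=> N; apply: integrable_sumR => // k; exact: integrable_sumR.
Qed.

End dissipativity.

(** * Functions with an integrable power *)

Section Lp_functions.
Context {R : realType} {n : nat}.
Local Notation T := 'rV[R]_n.
Local Notation mu := (@lebesgue_rV R n).
Implicit Types (D : set T) (f g h : T -> R) (p : R).

Definition Lp D p f := measurable_fun setT f /\
  mu.-integrable D (EFin \o (fun x : T => `|f x| `^ p)).

Let mpow p f : measurable_fun setT f -> measurable_fun setT (fun x : T => `|f x| `^ p).
Proof.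
move=> mf; apply: (measurableT_comp (@measurable_powR _ _)).
exact: measurableT_comp.
Qed.

Let powle p (a b : R) : 0 < p -> 0 <= a -> a <= b -> a `^ p <= b `^ p.
Proof.
by move=> p0 a0 ab; apply: ge0_ler_powR; rewrite ?nnegrE ?(ltW p0) ?(le_trans a0 ab).
Qed.

Lemma LpD D p f g : measurable D -> 0 < p -> Lp D p f -> Lp D p g ->
  Lp D p (fun x : T => f x + g x).
Proof.
move=> mD p0 [mf if_] [mg ig].
have mfg : measurable_fun setT (fun x : T => f x + g x) by exact: measurable_funD.
split => //.
have i2 : mu.-integrable D (fun x : T => (2 `^ p)%:E * ((`|f x| `^ p)%:E + (`|g x| `^ p)%:E))%E.
  by apply: integrableZl => //; exact: integrableD.
apply: (le_integrable mD _ _ i2).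
  by apply: measurable_funTS; apply/measurable_EFinP; exact: mpow.
move=> x Dx; rewrite -EFinD -EFinM /= lee_fin (ger0_norm (powR_ge0 _ _)) [leRHS]ger0_norm; last first.
  by rewrite mulr_ge0 ?powR_ge0// addr_ge0// powR_ge0.
have key a b : 0 <= a -> a <= b -> (a + b) `^ p <= 2 `^ p * (a `^ p + b `^ p).
  move=> a0 ab; have b0 := le_trans a0 ab.
  apply: (@le_trans _ _ ((2 * b) `^ p)).
    apply: powle => //; first exact: addr_ge0.
    by rewrite mulr2n mulrDl mul1r lerD2r.
  by rewrite powRM// ler_wpM2l ?powR_ge0// lerDr powR_ge0.
have h : `|f x + g x| `^ p <= (`|f x| + `|g x|) `^ p.
  by apply: powle => //; exact: ler_normD.
apply: (le_trans h); have [fg|/ltW fg] := leP `|f x| `|g x|; first exact: key.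
by rewrite addrC [X in _ * X]addrC; exact: key.
Qed.

Lemma Lp_norm D p f : Lp D p f -> Lp D p (fun x : T => `|f x|).
Proof.
move=> [mf if_]; split; first exact: measurableT_comp.
by under [_ \o _]eq_fun do rewrite /= normr_id.
Qed.

Lemma Lp_sum (J : Type) (s : seq J) (F : J -> T -> R) D p : measurable D -> 0 < p ->
  (forall i, Lp D p (F i)) -> Lp D p (fun x : T => \sum_(i <- s) F i x).
Proof.
move=> mD p0 hF; elim: s => [|i s ih].
  rewrite (_ : (fun x : T => _) = cst 0); last by apply/funext => x; rewrite big_nil.
  split; first exact: measurable_cst.
  rewrite (_ : _ \o _ = cst 0%E); first exact: integrable0.
  by apply/funext => x; rewrite /= normr0 powR0// gt_eqF.
rewrite (_ : (fun x : T => _) = (fun x : T => F i x + \sum_(i <- s) F i x)); last first.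
  by apply/funext => x; rewrite big_cons.
exact: LpD.
Qed.

(** The sum of the powers is integrable, hence finite almost everywhere: its
    root is the majorant, and its terms tend to 0. *)
Lemma Lp_majorant D p (f : nat -> T -> R) : measurable D -> 0 < p ->
  (forall j, measurable_fun setT (f j)) ->
  (forall j, (\int[mu]_(x in D) (`|f j x| `^ p)%:E <= (1 / (2 ^ j.+1)%:R)%:E)%E) ->
  exists h, [/\ Lp D p h, forall x, 0 <= h x &
    {ae mu, forall x, D x -> (forall j, `|f j x| <= h x) /\ f j x @[j --> \oo] --> (0 : R)}].
Proof.
move=> mD p0 mf fj.
pose W x := (\sum_(0 <= j <oo) (`|f j x| `^ p)%:E)%E.
have mW : measurable_fun setT W.
  have h0 k x : [set: T] x -> xpredT k -> (0 <= (`|f k x| `^ p)%:E)%E.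
    by move=> _ _; rewrite lee_fin powR_ge0.
  have h1 k : xpredT k -> measurable_fun setT (fun x : T => (`|f k x| `^ p)%:E).
    by move=> _; apply/measurable_EFinP; exact: mpow.
  exact: ge0_emeasurable_sum h0 h1.
have W0 x : (0 <= W x)%E by apply: nneseries_ge0 => j _ _; rewrite lee_fin powR_ge0.
have iW : mu.-integrable D W.
  apply/integrableP; split; first exact: measurable_funTS.
  under eq_integral => x _ do rewrite gee0_abs//.
  have m1 j : measurable_fun D (fun x : T => (`|f j x| `^ p)%:E).
    by apply: measurable_funTS; apply/measurable_EFinP; exact: mpow.
  rewrite (integral_nneseries _ mD m1); last by move=> j x _; rewrite lee_fin powR_ge0.
  apply: (@le_lt_trans _ _ 1%:E); last exact: ltry.
  apply: le_trans (@epsilon_trick0 R 1 xpredT ler01).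
  by apply: lee_nneseries => // j _ _; apply: integral_ge0 => x _; rewrite lee_fin powR_ge0.
pose h x := fine (W x) `^ p^-1.
have fW0 x : 0 <= fine (W x) by exact: fine_ge0.
have hp x : `|h x| `^ p = fine (W x).
  by rewrite ger0_norm ?powR_ge0// -powRrM mulVf ?powRr1// gt_eqF.
have aeW := integrable_ae mD iW.
have mfW : measurable_fun setT (fun x : T => fine (W x)) by exact: measurableT_comp.
exists h; split.
- split; first exact: (measurableT_comp (@measurable_powR _ _)).
  under [_ \o _]eq_fun do rewrite /= hp.
  apply: (le_integrable mD _ _ iW); first by apply: measurable_funTS; apply/measurable_EFinP.
  move=> x _ /=; rewrite gee0_abs// ger0_norm//.
  by have := W0 x; case: (W x) => //= _; exact: leey.
- by move=> x; exact: powR_ge0.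
- apply: filterS aeW => x fx Dx; have {}fx := fx Dx.
  have part k : \sum_(0 <= j < k) `|f j x| `^ p <= fine (W x).
    rewrite -lee_fin fineK// -sumEFin; apply: nneseries_lim_ge => j _ _.
    by rewrite lee_fin powR_ge0.
  have term j : `|f j x| `^ p <= fine (W x).
    apply: le_trans (part j.+1); rewrite big_nat_recr//= lerDr.
    by apply: sumr_ge0 => i _; exact: powR_ge0.
  have root (t y : R) : 0 <= t -> t `^ p <= y -> t <= y `^ p^-1.
    move=> t0 ty; rewrite -{1}(powRr1 t0) -(mulfV (lt0r_neq0 p0)) powRrM.
    by apply: powle; rewrite ?invr_gt0// powR_ge0.
  split; first by move=> j; exact: root.
  have c0 : (fun j => `|f j x| `^ p) @ \oo --> (0 : R).
    apply: cvg_series_cvg_0; apply: nondecreasing_is_cvgn.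
      by apply/nondecreasing_seqP => k; rewrite /series /= big_nat_recr//= lerDl powR_ge0.
    by exists (fine (W x)) => _ [k _ <-]; exact: part.
  apply/cvgrPdist_le => /= e e0; have ep : 0 < e `^ p by rewrite powR_gt0.
  move/cvgrPdist_le : c0 => /(_ _ ep); apply: filterS => j.
  rewrite !sub0r !normrN (ger0_norm (powR_ge0 _ _)) => hj.
  have -> : e = (e `^ p) `^ p^-1 by rewrite -powRrM mulfV ?powRr1 ?ltW// gt_eqF.
  exact: root.
Qed.

Local Open Scope complex_scope.

Lemma integral_cmodulus D p (u : T -> R[i]) : measurable D -> 0 < p ->
  (\int[mu]_(x in D) (cmodulus (u x) `^ p)%:E = LpNorm D p%:E u `^ p)%E.
Proof.
move=> mD p0; have pn := lt0r_neq0 p0.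
rewrite /LpNorm (poweR_Lnorm mu _ pn).
rewrite [LHS](integral_mkcond D).
apply: eq_integral => x _; rewrite /= !patchE; case: ifP => _.
  by rewrite ger0_norm ?cmodulus_ge0.
by rewrite normr0 powR0// gt_eqF.
Qed.

Let measurable_pow D p (u : T -> R[i]) : cmeasurable D u ->
  measurable_fun D (fun x : T => (cmodulus (u x) `^ p)%:E).
Proof.
move=> mu_; apply/measurable_EFinP; apply: (measurableT_comp (@measurable_powR _ _)).
exact: measurable_cmodulus.
Qed.

Lemma memLp_Lp D p (u : T -> R[i]) : measurable D -> 0 < p -> memLp D p%:E u ->
  Lp D p (re u \_ D) /\ Lp D p (im u \_ D).
Proof.
move=> mD p0 [mu_ hu]; have [mr mi] := mu_.
have iu : mu.-integrable D (fun x : T => (cmodulus (u x) `^ p)%:E).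
  apply/integrableP; split; first exact: measurable_pow.
  under eq_integral => x _ do rewrite gee0_abs ?lee_fin ?powR_ge0//.
  by rewrite integral_cmodulus//; exact: poweR_lty.
have main (g : T -> R) : measurable_fun setT (g \_ D) -> (forall x, `|g x| <= cmodulus (u x)) ->
    Lp D p (g \_ D).
  move=> mg hg; split => //; apply: (le_integrable mD _ _ iu).
    by apply: measurable_funTS; apply/measurable_EFinP; exact: mpow.
  move=> x Dx; rewrite /= patch_in// lee_fin !(ger0_norm (powR_ge0 _ _)).
  exact: powle.
split; apply: main; try exact/(measurable_patch _ mD).
  by move=> x; exact: normRe_le.
by move=> x; exact: normIm_le.
Qed.

Lemma LpNorm_lt_integral D p (u : T -> R[i]) (g : T -> R) (e : R) : measurable D -> 0 < p ->
  cmeasurable D u -> measurable_fun setT g ->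
  {ae mu, forall x, D x -> `|g x| <= cmodulus (u x)} -> 0 <= e ->
  (LpNorm D p%:E u <= e%:E)%E -> (\int[mu]_(x in D) (`|g x| `^ p)%:E <= (e `^ p)%:E)%E.
Proof.
move=> mD p0 mu_ mg gu e0 ue.
apply: (@le_trans _ _ (\int[mu]_(x in D) (cmodulus (u x) `^ p)%:E)%E).
  have m1 : measurable_fun D (fun x : T => (`|g x| `^ p)%:E).
    by apply: measurable_funTS; apply/measurable_EFinP; exact: mpow.
  apply: (ae_ge0_le_integral mD _ m1 _ (measurable_pow p mu_)).
  - by move=> x _; rewrite lee_fin powR_ge0.
  - by move=> x _; rewrite lee_fin powR_ge0.
  - apply: filterS gu => x h Dx; rewrite lee_fin.
    by apply: powle => //; exact: h.
rewrite integral_cmodulus// -poweR_EFin; apply: gt0_ler_poweR => //; first exact: ltW.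
  by rewrite in_itv/= leey andbT Lnorm_ge0.
by rewrite in_itv/= leey andbT lee_fin.
Qed.

End Lp_functions.

(** * Sobolev functions *)

Section sobolev_data.
Context {R : realType} {n : nat}.
Local Notation T := 'rV[R]_n.
Local Notation mu := (@lebesgue_rV R n).
Implicit Types (D : set T) (f g a b : T -> R) (u v w c : T -> R[i]) (k l : 'I_n) (p : R).
Local Open Scope complex_scope.

Lemma weak_partial_spec D k u v : is_weak_partial D k u v ->
  is_weak_partial D k u (weak_partial D k u).
Proof. exact: xgetI. Qed.

Lemma rweak_unique D l a b b' : open D -> rweak D l a b -> rweak D l a b' ->
  {ae mu, forall x, D x -> b x = b' x}.
Proof. by move=> oD h h'; apply: (strong_unique oD (rweak_strong oD h) (rweak_strong oD h')). Qed.

Lemma test_rweak D l f : open D -> test_function D f -> rweak D l f (partial l f).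
Proof.
move=> oD tf; have [sf [B [fB _ _]]] := test_strong D l tf.
exact: strong_rweak fB.
Qed.

Lemma cmeasurableM D u v : cmeasurable D u -> cmeasurable D v ->
  cmeasurable D (fun x : T => u x * v x).
Proof.
move=> [u1 u2] [v1 v2]; split.
  under eq_fun do rewrite ReM.
  by apply: measurable_funB; exact: measurable_funM.
under eq_fun do rewrite ImM.
by apply: measurable_funD; exact: measurable_funM.
Qed.

Lemma cmeasurable_patch D u : measurable D -> cmeasurable D u ->
  measurable_fun setT (re u \_ D) /\ measurable_fun setT (im u \_ D).
Proof. by move=> mD [h1 h2]; split; exact/(measurable_patch _ mD). Qed.

Lemma memLp_bounded D u : measurable D -> memLp D +oo%E u ->
  exists M : R, {ae mu, forall x, D x -> cmodulus (u x) <= M}.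
Proof.
move=> mD [_]; rewrite /LpNorm unlock; case: ifPn => [_ h|h _]; last first.
  exists 0; have T0 : mu setT = 0%E.
    by apply/eqP; rewrite eq_le measure_ge0 andbT leNgt.
  by exists setT; split.
have h1 := ess_sup_ge mu (abse \o (EFin \o ((cmodulus \o u) \_ D))).
move: h h1; set q := ess_sup _ _; case: q => [M| |] // _ h1.
  exists M; apply: filterS h1 => x + Dx; rewrite /= lee_fin patch_in//.
  exact: le_trans (ler_norm _).
by exists 0; apply: filterS h1 => x; rewrite leeNy_eq.
Qed.

(** The product rule is that of [rweakM] for the real and imaginary parts, and
    the representative chosen by [weak_partial] agrees with it up to a null
    set. *)
Lemma weak_partialM D l c v (r b r' b' : T -> R) (al be al' be' : T -> R) (M : R) : open D ->
  cmeasurable D c -> cmeasurable D v ->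
  rweak D l r r' -> rweak D l b b' -> rweak D l al al' -> rweak D l be be' ->
  bounded_fun_by M r -> bounded_fun_by M b -> bounded_fun_by M r' -> bounded_fun_by M b' ->
  {ae mu, forall x, D x -> re c x = r x /\ im c x = b x} ->
  (forall x, D x -> re v x = al x /\ im v x = be x) ->
  let P := weak_partial D l (fun x => c x * v x) in
  cmeasurable D P /\
  {ae mu, forall x, D x ->
    re P x = (r' x * al x + r x * al' x) - (b' x * be x + b x * be' x) /\
    im P x = (r' x * be x + r x * be' x) + (b' x * al x + b x * al' x)}.
Proof.
move=> oD mc mv wr wb wa we rM bM r'M b'M cE_ vE P; have mD := open_measurable_rV oD.
have e1 := rweak_lin (-1) oD (rweakM oD wr wa rM r'M) (rweakM oD wb we bM b'M).
have e2 := rweak_lin 1 oD (rweakM oD wr we rM r'M) (rweakM oD wb wa bM b'M).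
pose cv x := c x * v x.
have mcv : cmeasurable D cv by exact: cmeasurableM.
have [m1 m2] := cmeasurable_patch mD mcv.
move: e1 e2; set a1 := (fun x : T => r x * al x + _); set a1' := (fun x : T => _ + -1 * _).
set a2 := (fun x : T => r x * be x + _); set a2' := (fun x : T => _ + 1 * _) => e1 e2.
have ma1 : measurable_fun setT a1' by have [_ []] := e1.
have ma2 : measurable_fun setT a2' by have [_ []] := e2.
have ae1 : {ae mu, forall x, D x -> (re cv \_ D) x = a1 x}.
  apply: filterS cE_ => x h Dx; have [h1 h2] := h Dx; have [h3 h4] := vE x Dx.
  by rewrite patch_in// /re /cv ReM -!/(re _ _) -!/(im _ _) h1 h2 h3 h4 /a1 mulN1r.
have ae2 : {ae mu, forall x, D x -> (im cv \_ D) x = a2 x}.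
  apply: filterS cE_ => x h Dx; have [h1 h2] := h Dx; have [h3 h4] := vE x Dx.
  by rewrite patch_in// /im /cv ImM -!/(re _ _) -!/(im _ _) h1 h2 h3 h4 /a2 mul1r.
have same f : {ae mu, forall x, D x -> f x = f x} by exact: aeW.
have w1 : rweak D l (re cv \_ D) a1' by exact: ae_rweak e1 m1 ma1 ae1 (same _).
have w2 : rweak D l (im cv \_ D) a2' by exact: ae_rweak e2 m2 ma2 ae2 (same _).
pose Q x : R[i] := a1' x +i* a2' x.
have mp f : measurable_fun setT f -> measurable_fun setT (f \_ D).
  by move=> mf; apply: (measurable_restrictT f mD).1; exact: measurable_funTS.
have pe f : {ae mu, forall x, D x -> (f \_ D) x = f x}.
  by apply: aeW => x Dx; rewrite patch_in.
have : is_weak_partial D l cv Q.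
  apply/weak_partialP => //; split.
    exact: ae_rweak w1 m1 (mp _ ma1) (same _) (pe _).
  exact: ae_rweak w2 m2 (mp _ ma2) (same _) (pe _).
move=> /weak_partial_spec wP; have [_ [mP _] _] := wP; split; first exact: mP.
have [/(rweak_unique oD) u1 /(rweak_unique oD) u2] := (weak_partialP _ _ _ oD).1 wP.
apply: filterS2 (u1 _ w1) (u2 _ w2) => x h1 h2 Dx.
move: (h1 Dx) (h2 Dx); rewrite !patch_in// => -> ->.
by rewrite /a1' /a2' mulN1r mul1r.
Qed.

(** The approximants are chosen so close that [Lp_majorant] applies to the
    functions and to their derivatives. *)
Lemma sobolev0_approx D p u (al be : 'I_n -> T -> R) : open D -> 1 < p ->
  cmeasurable D u ->
  (forall l, rweak D l (re u \_ D) (al l)) -> (forall l, rweak D l (im u \_ D) (be l)) ->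
  sobolev0 D p%:E u ->
  exists A B (h : T -> R), [/\ forall j, test_function D (A j), forall j, test_function D (B j),
    Lp D p h, forall x, 0 <= h x &
    {ae mu, forall x, D x ->
      (forall j, [/\ `|A j x - re u x| <= h x, `|B j x - im u x| <= h x &
        forall l, `|partial l (A j) x - al l x| <= h x /\ `|partial l (B j) x - be l x| <= h x]) /\
      [/\ A j x @[j --> \oo] --> re u x, B j x @[j --> \oo] --> im u x &
        forall l, partial l (A j) x @[j --> \oo] --> al l x /\
          partial l (B j) x @[j --> \oo] --> be l x]}].
Proof.
move=> oD p1 mu_ wal wbe [_ happ]; have mD := open_measurable_rV oD.
have p0 : 0 < p := lt_trans ltr01 p1.
have [mru miu] := cmeasurable_patch mD mu_.
(* the p-th power of this bound is the one of [Lp_majorant] *)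
pose ej (j : nat) : R := (1 / (2 ^ j.+1)%:R) `^ p^-1.
have ej0 j : 0 < ej j by rewrite powR_gt0// divr_gt0// ltr0n expn_gt0.
have ejp j : ej j `^ p = 1 / (2 ^ j.+1)%:R.
  by rewrite /ej -powRrM mulVf ?powRr1 ?divr_ge0// gt_eqF.
have [W hW] := choice (fun j => let: ex_intro2 w h1 h2 := happ _ (ej0 j) in ex_intro _ w (conj h1 h2)).
pose A j := re (W j); pose B j := im (W j).
have tA j : test_function D (A j) by have [[]] := hW j.
have tB j : test_function D (B j) by have [[]] := hW j.
have mt f : test_function D f -> measurable_fun setT f /\ forall l, measurable_fun setT (partial l f).
  by move=> [sf _ _]; split=> [|l]; apply: smooth_measurable => //; exact: smooth_partial.
have norms j : (LpNorm D p%:E (u \- W j)%R <= (ej j)%:E)%E /\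
    forall l, (LpNorm D p%:E (weak_partial D l (u \- W j)%R) <= (ej j)%:E)%E.
  have [_ /ltW h] := hW j; have L0 w : (0 <= LpNorm D p%:E w)%E by exact: Lnorm_ge0.
  split=> [|l]; apply: le_trans h; rewrite /W1pNorm.
    by rewrite leeDl// sume_ge0.
  rewrite (bigD1 l)//= addeCA leeDl//.
  by rewrite adde_ge0// sume_ge0.
have muW j : cmeasurable D (u \- W j)%R.
  have [m1 _] := mt _ (tA j); have [m2 _] := mt _ (tB j); have [m3 m4] := mu_.
  by split; under eq_fun do rewrite /= ?ReD ?ImD ?ReN ?ImN; apply: measurable_funB => //;
    exact: measurable_funTS.
pose fA j x := A j x - (re u \_ D) x; pose fB j x := B j x - (im u \_ D) x.
pose dA l j x := partial l (A j) x - al l x; pose dB l j x := partial l (B j) x - be l x.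
have mal l : measurable_fun setT (al l) by have [_ []] := wal l.
have mbe l : measurable_fun setT (be l) by have [_ []] := wbe l.
have mfA j : measurable_fun setT (fA j) by apply: measurable_funB => //; have [] := mt _ (tA j).
have mfB j : measurable_fun setT (fB j) by apply: measurable_funB => //; have [] := mt _ (tB j).
have mdA l j : measurable_fun setT (dA l j).
  by apply: measurable_funB => //; have [_] := mt _ (tA j); apply.
have mdB l j : measurable_fun setT (dB l j).
  by apply: measurable_funB => //; have [_] := mt _ (tB j); apply.
have wd j l : is_weak_partial D l (u \- W j)%R (weak_partial D l (u \- W j)%R) /\
    {ae mu, forall x, D x -> complex.Re (weak_partial D l (u \- W j)%R x) = - dA l j x /\
      complex.Im (weak_partial D l (u \- W j)%R x) = - dB l j x}.
  have e1 := rweak_lin (-1) oD (wal l) (test_rweak l oD (tA j)).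
  have e2 := rweak_lin (-1) oD (wbe l) (test_rweak l oD (tB j)).
  have [m1 m2] := cmeasurable_patch mD (muW j).
  move: e1 e2; set a1 := (fun x : T => (re u \_ D) x + _); set a1' := (fun x : T => al l x + _).
  set a2 := (fun x : T => (im u \_ D) x + _); set a2' := (fun x : T => be l x + _) => e1 e2.
  have ma1 : measurable_fun setT a1' by have [_ []] := e1.
  have ma2 : measurable_fun setT a2' by have [_ []] := e2.
  have ae1 : {ae mu, forall x, D x -> (re (u \- W j)%R \_ D) x = a1 x}.
    by apply: aeW => x Dx; rewrite /a1 !patch_in// /re /= ReD ReN mulN1r.
  have ae2 : {ae mu, forall x, D x -> (im (u \- W j)%R \_ D) x = a2 x}.
    by apply: aeW => x Dx; rewrite /a2 !patch_in// /im /= ImD ImN mulN1r.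
  have same f : {ae mu, forall x, D x -> f x = f x} by exact: aeW.
  have w1 := ae_rweak oD e1 m1 ma1 ae1 (same _).
  have w2 := ae_rweak oD e2 m2 ma2 ae2 (same _).
  pose Q x : R[i] := a1' x +i* a2' x.
  have mp f : measurable_fun setT f -> measurable_fun setT (f \_ D).
    by move=> mf; apply: (measurable_restrictT f mD).1; exact: measurable_funTS.
  have pe f : {ae mu, forall x, D x -> (f \_ D) x = f x}.
    by apply: aeW => x Dx; rewrite patch_in.
  have wQ : is_weak_partial D l (u \- W j)%R Q.
    apply/weak_partialP => //; split.
      exact: ae_rweak w1 m1 (mp _ ma1) (same _) (pe _).
    exact: ae_rweak w2 m2 (mp _ ma2) (same _) (pe _).
  have wP := weak_partial_spec wQ; split => //.
  have [/(rweak_unique oD) u1 /(rweak_unique oD) u2] := (weak_partialP _ _ _ oD).1 wP.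
  apply: filterS2 (u1 _ w1) (u2 _ w2) => x h1 h2 Dx.
  move: (h1 Dx) (h2 Dx); rewrite !patch_in// /re /im => -> ->.
  by rewrite /a1' /a2' /dA /dB !mulN1r !opprB.
have bnd (f : nat -> T -> R) : (forall j, measurable_fun setT (f j)) ->
    (forall j, exists w, [/\ cmeasurable D w, (LpNorm D p%:E w <= (ej j)%:E)%E &
      {ae mu, forall x, D x -> `|f j x| <= cmodulus (w x)}]) ->
    exists h, [/\ Lp D p h, forall x, 0 <= h x &
    {ae mu, forall x, D x -> (forall j, `|f j x| <= h x) /\ f j x @[j --> \oo] --> (0 : R)}].
  move=> mf hf; apply: Lp_majorant => // j; have [w [mw nw fw]] := hf j.
  rewrite -ejp; apply: LpNorm_lt_integral nw => //; exact: ltW.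
have [hA [LA hA0 hA1]] : exists h, [/\ Lp D p h, forall x, 0 <= h x &
    {ae mu, forall x, D x -> (forall j, `|fA j x| <= h x) /\ fA j x @[j --> \oo] --> (0 : R)}].
  apply: bnd => // j; exists (u \- W j)%R; split => //; first by have [] := norms j.
  apply: aeW => x Dx; rewrite /fA patch_in// distrC.
  by have := normRe_le ((u \- W j)%R x); rewrite /= ReD ReN.
have [hB [LB hB0 hB1]] : exists h, [/\ Lp D p h, forall x, 0 <= h x &
    {ae mu, forall x, D x -> (forall j, `|fB j x| <= h x) /\ fB j x @[j --> \oo] --> (0 : R)}].
  apply: bnd => // j; exists (u \- W j)%R; split => //; first by have [] := norms j.
  apply: aeW => x Dx; rewrite /fB patch_in// distrC.
  by have := normIm_le ((u \- W j)%R x); rewrite /= ImD ImN.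
have hdAex l : exists h, [/\ Lp D p h, forall x, 0 <= h x &
    {ae mu, forall x, D x -> (forall j, `|dA l j x| <= h x) /\ dA l j x @[j --> \oo] --> (0 : R)}].
  apply: bnd => // j; exists (weak_partial D l (u \- W j)%R); have [[_ [mP _] _] h] := wd j l.
  split; [exact: mP|by have [_] := norms j; apply|].
  apply: filterS h => x h Dx; have [h1 _] := h Dx.
  by rewrite -normrN -h1; exact: normRe_le.
have hdBex l : exists h, [/\ Lp D p h, forall x, 0 <= h x &
    {ae mu, forall x, D x -> (forall j, `|dB l j x| <= h x) /\ dB l j x @[j --> \oo] --> (0 : R)}].
  apply: bnd => // j; exists (weak_partial D l (u \- W j)%R); have [[_ [mP _] _] h] := wd j l.
  split; [exact: mP|by have [_] := norms j; apply|].
  apply: filterS h => x h Dx; have [_ h1] := h Dx.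
  by rewrite -normrN -h1; exact: normIm_le.
have [hdA hdAP] := choice hdAex; have [hdB hdBP] := choice hdBex.
pose h x := hA x + (hB x + \sum_l (hdA l x + hdB l x)).
have hdA0 l x : 0 <= hdA l x by have [_ + _] := hdAP l; apply.
have hdB0 l x : 0 <= hdB l x by have [_ + _] := hdBP l; apply.
have hl l x : hdA l x + hdB l x <= \sum_l (hdA l x + hdB l x).
  by rewrite (bigD1 l)//= lerDl; apply: sumr_ge0 => k _; exact: addr_ge0.
have hs x : 0 <= \sum_l (hdA l x + hdB l x) by apply: sumr_ge0 => k _; exact: addr_ge0.
exists A, B, h; split => //.
- apply: LpD => //; apply: LpD => //; apply: Lp_sum => // l.
  by apply: LpD => //; [have [] := hdAP l|have [] := hdBP l].
- by move=> x; rewrite /h !addr_ge0.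
- have hdA1 : {ae mu, forall x l, D x -> (forall j, `|dA l j x| <= hdA l x) /\ dA l j x @[j --> \oo] --> (0 : R)}.
    by apply: filter_forall => l; have [_ _] := hdAP l.
  have hdB1 : {ae mu, forall x l, D x -> (forall j, `|dB l j x| <= hdB l x) /\ dB l j x @[j --> \oo] --> (0 : R)}.
    by apply: filter_forall => l; have [_ _] := hdBP l.
  apply: filterS2 (filterI hA1 hB1) (filterI hdA1 hdB1) => x [h1 h2] [h3 h4] Dx.
  have [b1 c1] := h1 Dx; have [b2 c2] := h2 Dx.
  split=> [j|]; split.
  + have := b1 j; rewrite /fA patch_in// => /le_trans; apply.
    by rewrite /h lerDl addr_ge0.
  + have := b2 j; rewrite /fB patch_in// => /le_trans; apply.
    by rewrite /h addrCA lerDl addr_ge0.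
  + move=> l; have [b3 _] := h3 l Dx; have [b4 _] := h4 l Dx.
    have hlx := hl l x; have := hA0 x; have := hB0 x; have := hdA0 l x; have := hdB0 l x.
    by rewrite /h => ? ? ? ?; split; [apply: le_trans (b3 j) _|apply: le_trans (b4 j) _]; lra.
  + by apply/subr_cvg0; move: c1; rewrite /fA patch_in.
  + by apply/subr_cvg0; move: c2; rewrite /fB patch_in.
  + move=> l; have [_ c3] := h3 l Dx; have [_ c4] := h4 l Dx.
    by split; apply/subr_cvg0.
Qed.

End sobolev_data.

(** * From the sector condition to the flux *)

Section flux_form.
Context {R : realType} {d : nat}.
Implicit Types (r b : 'I_d -> 'I_d -> R) (al be xi eta : 'I_d -> R) (p e u w h : R).

Lemma form_reE r b h xi eta : form_re r b h xi eta = \sum_k \sum_l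
  (r k l * (h ^+ 2 * (xi k * xi l) + eta k * eta l) -
   b k l * (h ^+ 2 * (eta k * xi l) - xi k * eta l)).
Proof.
rewrite /form_re /bil !mulr_sumr -big_split -!sumrB; apply: eq_bigr => k _ /=.
rewrite !mulr_sumr -big_split -!sumrB; apply: eq_bigr => l _ /=.
by ring.
Qed.

Lemma form_imE r b h xi eta : form_im r b h xi eta = \sum_k \sum_l
  (b k l * (h ^+ 2 * (xi k * xi l) + eta k * eta l) +
   r k l * (h ^+ 2 * (eta k * xi l) - xi k * eta l)).
Proof.
rewrite /form_im /bil !mulr_sumr -sumrB -!big_split; apply: eq_bigr => k _ /=.
rewrite !mulr_sumr -sumrB -!big_split; apply: eq_bigr => l _ /=.
by ring.
Qed.

Definition flux_re p e u w r b al be : R := \sum_k \sum_l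
  ((r k l * al k - b k l * be k) * dgs p e u w (al l) (be l) +
   (r k l * be k + b k l * al k) * dgs p e w u (be l) (al l)).

Definition flux_im p e u w r b al be : R := \sum_k \sum_l
  ((r k l * be k + b k l * al k) * dgs p e u w (al l) (be l) -
   (r k l * al k - b k l * be k) * dgs p e w u (be l) (al l)).

(** Write [z = u + i w], [v = al + i be] and [G_l] for the derivative of the
    power of [z] in the direction [v_l].  Then [|z|^2 v_k conj G_l] is the
    product of [conj z v_k = xi_k + i eta_k] and
    [z conj G_l = psi ((1 + (p - 2) tau) xi_l - i eta_l)], where
    [tau = |z|^2 / (|z|^2 + e)].  If [z = 0], then [G_l = psi(0) v_l], which has
    the same form with [tau = 0]. *)
Lemma flux_form p e u w r b al be : 1 < p -> 0 <= e -> exists tau xi eta (q N : R),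
  [/\ 0 <= tau <= 1, 0 <= q, 0 < N,
    N * flux_re p e u w r b al be = q * form_re r b (Num.sqrt (1 + (p - 2) * tau)) xi eta &
    N * flux_im p e u w r b al be = q * form_im r b (Num.sqrt (1 + (p - 2) * tau)) xi eta].
Proof.
move=> p1 e0.
have [s0|] := ltP 0 (u ^+ 2 + w ^+ 2); last first.
  move=> s0; have u2 := sqr_ge0 u; have w2 := sqr_ge0 w.
  have uz : u = 0 by apply/eqP; rewrite -sqrf_eq0; apply/eqP; lra.
  have wz : w = 0 by apply/eqP; rewrite -sqrf_eq0; apply/eqP; lra.
  have dE x y : dgs p e 0 0 x y = psi p e 0 * x.
    by rewrite /dgs !mulr0 addr0 expr0n /= addr0.
  exists 0, al, be, (psi p e 0), 1; split => //; first by rewrite lexx ler01.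
  - exact: psi_ge0.
  - rewrite form_reE mulr0 addr0 sqrtr1 expr1n mul1r mulr_sumr /flux_re; apply: eq_bigr => k _.
    by rewrite mulr_sumr; apply: eq_bigr => l _; rewrite uz wz !dE; ring.
  - rewrite form_imE mulr0 addr0 sqrtr1 expr1n mul1r mulr_sumr /flux_im; apply: eq_bigr => k _.
    by rewrite mulr_sumr; apply: eq_bigr => l _; rewrite uz wz !dE; ring.
pose s := u ^+ 2 + w ^+ 2.
have se0 : 0 < s + e by rewrite ltr_wpDr.
pose tau := s / (s + e).
have tau01 : 0 <= tau <= 1.
  by rewrite /tau divr_ge0 ?(ltW s0) ?(ltW se0)//= ler_pdivrMr// mul1r lerDl.
pose h := Num.sqrt (1 + (p - 2) * tau).
have h2 : h ^+ 2 = 1 + (p - 2) * tau by exact: h_sqr.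
pose q := psi p e s; pose kap0 := (p - 2) * (s + e) `^ ((p - 2) / 2 - 1).
have qk : q * h ^+ 2 = q + kap0 * s.
  have -> : q = (s + e) `^ ((p - 2) / 2 - 1) * (s + e).
    rewrite -[X in _ * X]powRr1 ?(ltW se0)// -powRD ?subrK//.
    by rewrite (gt_eqF se0) implybT.
  by rewrite h2 /kap0 /tau; field; rewrite gt_eqF.
pose xi k := u * al k + w * be k; pose eta k := u * be k - w * al k.
have d1E l : dgs p e u w (al l) (be l) = q * al l + kap0 * xi l * u by [].
have d2E l : dgs p e w u (be l) (al l) = q * be l + kap0 * xi l * w.
  by rewrite /dgs /q /kap0 /s (addrC (w ^+ 2)) (addrC (w * _)).
exists tau, xi, eta, q, s; split => //; first exact: psi_ge0.
- rewrite -/h form_reE !mulr_sumr /flux_re; apply: eq_bigr => k _.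
  rewrite !mulr_sumr; apply: eq_bigr => l _; rewrite d1E d2E.
  transitivity (r k l * ((q * h ^+ 2) * (xi k * xi l) + q * (eta k * eta l)) -
   b k l * ((q * h ^+ 2) * (eta k * xi l) - q * (xi k * eta l))); last by ring.
  by rewrite qk /xi /eta /s; ring.
- rewrite -/h form_imE !mulr_sumr /flux_im; apply: eq_bigr => k _.
  rewrite !mulr_sumr; apply: eq_bigr => l _; rewrite d1E d2E.
  transitivity (b k l * ((q * h ^+ 2) * (xi k * xi l) + q * (eta k * eta l)) +
   r k l * ((q * h ^+ 2) * (eta k * xi l) - q * (xi k * eta l))); last by ring.
  by rewrite qk /xi /eta /s; ring.
Qed.

Lemma flux_sector p e u w r b al be (K : R) : 1 < p -> 0 <= e ->
  (forall tau xi eta, 0 <= tau <= 1 ->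
    `|form_im r b (Num.sqrt (1 + (p - 2) * tau)) xi eta| <= K * form_re r b (Num.sqrt (1 + (p - 2) * tau)) xi eta) ->
  `|flux_im p e u w r b al be| <= K * flux_re p e u w r b al be.
Proof.
move=> p1 e0 hK.
have [tau [xi [eta [q [N [tau01 q0 N0 hre him]]]]]] := flux_form u w r b al be p1 e0.
rewrite -(ler_pM2l N0) mulrCA hre -[X in X * `|_|](gtr0_norm N0) -normrM him normrM (ger0_norm q0) mulrCA.
by rewrite ler_wpM2l//; exact: hK.
Qed.

End flux_form.

Section sector_condition.
Context {R : realType} {d : nat}.
Implicit Types (M : 'M[R[i]]_d) (x y : 'I_d -> R).
Local Open Scope complex_scope.

Let rr M (k l : 'I_d) : R := complex.Re (M k l).
Let bb M (k l : 'I_d) : R := complex.Im (M k l).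

Lemma sector_tan (theta : R) (z : R[i]) : 0 <= theta -> theta < pi / 2 -> sector theta z ->
  0 <= complex.Re z /\ `|complex.Im z| <= tan theta * complex.Re z.
Proof.
move=> t0 t1 [r [c [r0 ct ->]]] /=.
have pi0 := pi_gt0 R.
have cc : cos c = cos `|c| by case: (ger0P c) => // _; rewrite cosN.
have ss : `|sin c| = `|sin `|c| | by case: (ger0P c) => // _; rewrite sinN normrN.
have c0 : 0 <= `|c| by [].
have ct0 : 0 < cos theta by apply: cos_gt0_pihalf; apply/andP; split => //; lra.
have cp : 0 < cos `|c| by apply: cos_gt0_pihalf; apply/andP; split; lra.
have sp : 0 <= sin `|c| by apply: sin_ge0_pi; apply/andP; split => //; lra.
rewrite cc; split; first by rewrite mulr_ge0// ltW.
rewrite normrM (ger0_norm r0) ss (ger0_norm sp) mulrCA ler_wpM2l// /tan mulrAC.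
rewrite ler_pdivlMr// -subr_ge0 [sin `|c| * _]mulrC -sinB; apply: sin_ge0_pi; apply/andP; split; lra.
Qed.

Lemma hinner_re_im M x y :
  (forall k l, bb M k l = bb M l k) ->
  let z := hinner (M *m (\col_k (x k +i* y k))) (\col_k (x k +i* y k)) in
  complex.Re z = bil (rr M) x x + bil (rr M) y y /\
  complex.Im z = bil (bb M) x x + bil (bb M) y y + (bil (rr M) x y - bil (rr M) y x).
Proof.
move=> sym z.
have ReS (J : Type) (s : seq J) (F : J -> R[i]) : complex.Re (\sum_(j <- s) F j) = \sum_(j <- s) complex.Re (F j).
  by elim: s => [|i s ih]; rewrite ?big_nil// !big_cons ReD ih.
have ImS (J : Type) (s : seq J) (F : J -> R[i]) : complex.Im (\sum_(j <- s) F j) = \sum_(j <- s) complex.Im (F j).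
  by elim: s => [|i s ih]; rewrite ?big_nil// !big_cons ImD ih.
have zE : z = \sum_k \sum_l (M k l * (x l +i* y l)) * conjc (x k +i* y k).
  rewrite /z /hinner; apply: eq_bigr => k _; rewrite !mxE mulr_suml.
  by apply: eq_bigr => l _; rewrite !mxE.
split.
  have -> : bil (rr M) x x + bil (rr M) y y =
      bil (rr M) x x + bil (rr M) y y - (bil (bb M) x y - bil (bb M) y x).
    by rewrite (bil_sym x y sym) subrr subr0.
  rewrite zE ReS /bil -big_split -!sumrB; apply: eq_bigr => k _ /=.
  rewrite ReS -big_split -!sumrB; apply: eq_bigr => l _ /=.
  by rewrite /rr /bb !cE /=; ring.
rewrite zE ImS /bil -sumrB -!big_split; apply: eq_bigr => k _ /=.
rewrite ImS -sumrB -!big_split; apply: eq_bigr => l _ /=.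
by rewrite /rr /bb !cE /=; ring.
Qed.

Lemma antisym_eq0 (A : 'M[R]_d) : antisym A = 0 -> forall k l, A k l = A l k.
Proof.
move=> /matrixP h k l; have := h k l; rewrite !mxE => /eqP.
by rewrite mulf_eq0 invr_eq0 pnatr_eq0 /= subr_eq0 => /eqP.
Qed.

Variables (theta p : R) (M : 'M[R[i]]_d).
Hypotheses (p1 : 1 < p) (theta0 : 0 <= theta) (theta1 : theta < pi / 2).
Hypothesis pt : `|1 - 2 / p| < cos theta.
Hypothesis sectM : forall xi : 'cV[R[i]]_d, sector theta (hinner (M *m xi) xi).
Hypothesis symB : forall k l, bb M k l = bb M l k.

Let sect x y : `|bil (bb M) x x + bil (bb M) y y + (bil (rr M) x y - bil (rr M) y x)| <=
  tan theta * (bil (rr M) x x + bil (rr M) y y).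
Proof.
have [<- <-] := hinner_re_im x y symB.
by have [] := sector_tan theta0 theta1 (sectM (\col_k (x k +i* y k))).
Qed.

Let pos x : 0 <= bil (rr M) x x.
Proof.
have [h _] := hinner_re_im x (fun k => 0 * x k) symB.
have [+ _] := sector_tan theta0 theta1 (sectM (\col_k (x k +i* (0 * x k)))).
by rewrite h bilZl mul0r addr0.
Qed.

Lemma form_sector_sym tau xi eta : 0 <= tau <= 1 -> (forall k l, rr M k l = rr M l k) ->
  `|form_im (rr M) (bb M) (Num.sqrt (1 + (p - 2) * tau)) xi eta| <= tan (pi / 2 - phi_of p + theta) * form_re (rr M) (bb M) (Num.sqrt (1 + (p - 2) * tau)) xi eta.
Proof.
move=> tau01 symR; rewrite tan_sum_kappa//.
apply: (form_im_sym symB sect pos (tan_theta_ge0 theta0 theta1) (h_gt0 p1 tau01)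
  (k0_le_kappa p1 tau01)).
  exact: tan_kappa_lt1.
exact: bil_sym.
Qed.

Lemma form_sector tau xi eta : 0 <= tau <= 1 ->
  `|form_im (rr M) (bb M) (Num.sqrt (1 + (p - 2) * tau)) xi eta| <=
  ((2 / sin (phi_of p) - 1) * tan theta + cot (phi_of p)) / (1 - tan theta * cot (phi_of p)) *
    form_re (rr M) (bb M) (Num.sqrt (1 + (p - 2) * tau)) xi eta.
Proof.
move=> tau01.
apply: (form_im_gen symB sect pos (tan_theta_ge0 theta0 theta1) (h_gt0 p1 tau01)
  (k0_le_kappa p1 tau01) (S0_le_S p1 tau01)).
  exact: tan_kappa_lt1.
exact: S_ge1.
Qed.

End sector_condition.

(** * Coefficients and gradient *)

Section assembly.
Context {R : realType} {n : nat}.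
Local Notation T := 'rV[R]_n.
Local Notation mu := (@lebesgue_rV R n).
Implicit Types (D : set T) (f g a b : T -> R) (u v w c : T -> R[i]) (k l : 'I_n) (p : R).
Local Open Scope complex_scope.

Lemma rweak_lin2 D l a a' b b' (s t : R) : open D -> rweak D l a a' -> rweak D l b b' ->
  rweak D l (fun x : T => s * a x + t * b x) (fun x : T => s * a' x + t * b' x).
Proof.
move=> oD wa wb; have h := rweak_lin t oD (rweak_lin (s - 1) oD wa wa) wb.
have e f : (fun x : T => s * f x) = (fun x : T => f x + (s - 1) * f x).
  by apply/funext => x; ring.
have e2 f g : (fun x : T => s * f x + t * g x) = (fun x : T => f x + (s - 1) * f x + t * g x).
  by apply/funext => x; ring.
by rewrite !e2.
Qed.

Lemma ae_Lp D p f g : measurable D -> Lp D p f -> measurable_fun setT g ->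
  {ae mu, forall x, D x -> g x = f x} -> Lp D p g.
Proof.
move=> mD [mf /integrableP[_ if_]] mg gf; split => //.
have mp (h : T -> R) : measurable_fun setT h -> measurable_fun D (fun x : T => (`|h x| `^ p)%:E).
  move=> mh; apply: measurable_funTS; apply/measurable_EFinP.
  by apply: (measurableT_comp (@measurable_powR _ _)); exact: measurableT_comp.
apply/integrableP; split; first exact: mp.
apply: le_lt_trans if_; rewrite le_eqVlt; apply/orP; left; apply/eqP.
apply: ae_eq_integral => //; try (apply: measurableT_comp => //; exact: mp).
by apply: filterS gf => x h Dx; rewrite /= h.
Qed.

(** The coefficients and their derivatives are bounded almost everywhere.
    Replacing the whole matrix by 0 on the exceptional set makes them bounded
    everywhere and preserves the sector condition. *)
Lemma coefficient_data D (C : T -> 'M[R[i]]_n) : open D ->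
  (forall k l, sobolev D 1 +oo%E (fun x => C x k l)) ->
  exists (r b r' b' : 'I_n -> 'I_n -> T -> R) (M : R),
  [/\ forall k l, rweak D l (r k l) (r' k l) /\ rweak D l (b k l) (b' k l),
    forall k l, [/\ bounded_fun_by M (r k l), bounded_fun_by M (b k l),
      bounded_fun_by M (r' k l) & bounded_fun_by M (b' k l)],
    {ae mu, forall x, D x -> forall k l,
      r k l x = complex.Re (C x k l) /\ b k l x = complex.Im (C x k l)} &
    forall x, D x ->
      (forall k l, r k l x = complex.Re (C x k l) /\ b k l x = complex.Im (C x k l)) \/
      (forall k l, r k l x = 0 /\ b k l x = 0)].
Proof.
move=> oD hC; have mD := open_measurable_rV oD.
have [c' hc'] := choice (fun i : 'I_n * 'I_n => let: ex_intro2 v h1 h2 := (hC i.1 i.2).2 i.2 in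
  ex_intro _ v (conj h1 h2.1)).
pose c (i : 'I_n * 'I_n) x := C x i.1 i.2.
have lC i : memLp D +oo%E (c i) by have [] := hC i.1 i.2.
have lc' i : memLp D +oo%E (c' i) by have [] := hc' i.
have [N1 hN1] := choice (fun i => memLp_bounded mD (lC i)).
have [N2 hN2] := choice (fun i => memLp_bounded mD (lc' i)).
pose tot x := \sum_i (cmodulus (c i x) + cmodulus (c' i x)).
pose M := \sum_i (N1 i + N2 i).
pose E := D `&` [set x | (tot \_ D) x <= M].
have mtot : measurable_fun setT (tot \_ D).
  apply/(measurable_patch _ mD); apply: measurable_sum => i; apply: measurable_funD.
    by apply: measurable_cmodulus; have [] := lC i.
  by apply: measurable_cmodulus; have [] := lc' i.
have mE : measurable E.
  apply: measurableI => //; rewrite -[X in measurable X]setTI.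
  rewrite (_ : [set x | _] = (tot \_ D) @^-1` `]-oo, M]); last first.
    by apply/seteqP; split => x /=; rewrite in_itv.
  exact: mtot.
have ED : E `<=` D by move=> x [].
have aeE : {ae mu, forall x, D x -> E x}.
  have h1 : {ae mu, forall x i, D x -> cmodulus (c i x) <= N1 i}.
    by apply: filter_forall.
  have h2 : {ae mu, forall x i, D x -> cmodulus (c' i x) <= N2 i}.
    by apply: filter_forall.
  apply: filterS2 h1 h2 => x h1 h2 Dx; split => //=; rewrite patch_in//.
  by apply: ler_sum => i _; apply: lerD; [exact: h1|exact: h2].
have Eb i x : E x -> cmodulus (c i x) <= M /\ cmodulus (c' i x) <= M.
  move=> [Dx /=]; rewrite patch_in// /tot (bigD1 i)//= => h.
  have rest : 0 <= \sum_(j | j != i) (cmodulus (c j x) + cmodulus (c' j x)).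
    by apply: sumr_ge0 => j _; rewrite addr_ge0 ?cmodulus_ge0.
  by have := cmodulus_ge0 (c i x); have := cmodulus_ge0 (c' i x); split; lra.
have M0 x : E x -> 0 <= M.
  move=> [Dx /=]; rewrite patch_in//; apply: le_trans.
  by apply: sumr_ge0 => j _; rewrite addr_ge0 ?cmodulus_ge0.
have bE f : (forall x, E x -> `|f x| <= M) -> bounded_fun_by (Num.max 0 M) (f \_ E).
  move=> hf x; rewrite le_max; have [xE|xE] := pselect (E x).
    by rewrite patch_in// hf ?orbT.
  by rewrite patch_out// normr0 lexx.
have mpE f : measurable_fun setT (f \_ D) -> measurable_fun setT (f \_ E).
  move=> mf; apply/(measurable_patch _ mE); apply: measurable_funS ED _ => //.
  exact/(measurable_patch _ mD).
have aepE f : {ae mu, forall x, D x -> (f \_ E) x = (f \_ D) x}.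
  by apply: filterS aeE => x h Dx; rewrite !patch_in//; exact: h.
(* [M] may be negative if [E] is empty *)
exists (fun k l => re (c (k, l)) \_ E), (fun k l => im (c (k, l)) \_ E),
  (fun k l => re (c' (k, l)) \_ E), (fun k l => im (c' (k, l)) \_ E), (Num.max 0 M).
have mcs i : [/\ measurable_fun setT (re (c i) \_ D), measurable_fun setT (im (c i) \_ D),
    measurable_fun setT (re (c' i) \_ D) & measurable_fun setT (im (c' i) \_ D)].
  have [[h1 h2] _] := lC i; have [[h3 h4] _] := lc' i.
  by split; exact/(measurable_patch _ mD).
split.
- move=> k l; have [w _] := hc' (k, l); have [w1 w2] := (weak_partialP _ _ _ oD).1 w.
  have [m1 m2 m3 m4] := mcs (k, l).
  split; first by apply: ae_rweak w1 _ _ (aepE _) (aepE _) => //; exact: mpE.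
  by apply: ae_rweak w2 _ _ (aepE _) (aepE _) => //; exact: mpE.
- move=> k l; split; apply: bE => x /(Eb (k, l))[h1 h2].
  + exact: le_trans (normRe_le _) h1.
  + exact: le_trans (normIm_le _) h1.
  + exact: le_trans (normRe_le _) h2.
  + exact: le_trans (normIm_le _) h2.
- by apply: filterS aeE => x h Dx k l; rewrite !patch_in//; exact: h.
- move=> x Dx; have [xE|xE] := pselect (E x); [left|right] => k l.
    by rewrite !patch_in.
  by rewrite !patch_out.
Qed.

(** The second derivatives are given as derivatives of some weak gradient;
    uniqueness transfers them to the one chosen by [weak_partial]. *)
Lemma gradient_data D p u : open D -> 1 < p -> sobolev D 2 p%:E u ->
  let al k := re (weak_partial D k u) \_ D in
  let be k := im (weak_partial D k u) \_ D in
  exists al' be' : 'I_n -> 'I_n -> T -> R,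
  [/\ forall k, is_weak_partial D k u (weak_partial D k u),
    forall k, Lp D p (al k) /\ Lp D p (be k),
    forall l k, rweak D l (al k) (al' l k) /\ rweak D l (be k) (be' l k) &
    forall l k, Lp D p (al' l k) /\ Lp D p (be' l k)].
Proof.
move=> oD p1 [_ hu] al be; have mD := open_measurable_rV oD.
have p0 : 0 < p := lt_trans ltr01 p1.
have [v hv] := choice (fun k => let: ex_intro2 v h1 h2 := hu k in ex_intro _ v (conj h1 h2)).
have [w hw] := choice (fun i : 'I_n * 'I_n =>
  let: ex_intro2 w h1 h2 := (hv i.1).2.2 i.2 in ex_intro _ w (conj h1 h2.1)).
have wu k : is_weak_partial D k u (weak_partial D k u).
  by have [/weak_partial_spec h _] := hv k.
have mwu k : measurable_fun setT (al k) /\ measurable_fun setT (be k).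
  by have [_ [h _] _] := wu k; exact: cmeasurable_patch.
have vE k : {ae mu, forall x, D x -> al k x = (re (v k) \_ D) x} /\
    {ae mu, forall x, D x -> be k x = (im (v k) \_ D) x}.
  have [h1 _] := hv k.
  have [w1 w2] := (weak_partialP _ _ _ oD).1 h1; have [w3 w4] := (weak_partialP _ _ _ oD).1 (wu k).
  by split; [exact: (rweak_unique oD w3 w1)|exact: (rweak_unique oD w4 w2)].
exists (fun l k => re (w (k, l)) \_ D), (fun l k => im (w (k, l)) \_ D); split => //.
- move=> k; have [_ [lv _]] := hv k; have [L1 L2] := memLp_Lp mD p0 lv.
  have [m1 m2] := mwu k; have [e1 e2] := vE k.
  by split; [exact: ae_Lp L1 m1 e1|exact: ae_Lp L2 m2 e2].
- move=> l k; have [h _] := hw (k, l); have [w1 w2] := (weak_partialP _ _ _ oD).1 h.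
  have [m1 m2] := mwu k; have [e1 e2] := vE k.
  have same f : {ae mu, forall x, D x -> f x = f x} by exact: aeW.
  have [_ [mw _] _] := h; have [m3 m4] := cmeasurable_patch mD mw.
  by split; [exact: ae_rweak w1 m1 m3 e1 (same _)|exact: ae_rweak w2 m2 m4 e2 (same _)].
- by move=> l k; have [_ lw] := hw (k, l); exact: memLp_Lp.
Qed.

Lemma dual_funE p u x : 
  complex.Re (dual_fun p u x) = gs p 0 (complex.Re (u x)) (complex.Im (u x)) /\
  complex.Im (dual_fun p u x) = gs p 0 (complex.Im (u x)) (complex.Re (u x)).
Proof.
have psiE : psi p 0 (complex.Re (u x) ^+ 2 + complex.Im (u x) ^+ 2) = cmodulus (u x) `^ (p - 2).
  rewrite /psi addr0 -cmodulus_sqr -(@powR_mulrn _ (cmodulus (u x)) 2) ?cmodulus_ge0//.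
  by rewrite -powRrM; congr (_ `^ _); field.
rewrite /gs (addrC (complex.Im _ ^+ 2)) psiE /dual_fun indicE.
have [u0|u0] := eqVneq (u x) 0.
  by rewrite u0 mulr0 mul0r /= !mul0r.
by rewrite mem_set//= ReZr ImZr ReZl ImZl !mulr1 mulrC [_ * complex.Im _]mulrC.
Qed.

End assembly.

(** * The sector estimate *)

Section main.
Context {R : realType} {d : nat}.
Local Notation T := 'rV[R]_d.
Local Notation mu := (@lebesgue_rV R d).
Local Open Scope complex_scope.

(** The claim is [0 <= Re ((K + i sigma) z)] for [sigma = 1] and [sigma = -1].
    The factor [K + i sigma] is absorbed in the coefficients, for which
    [integral_flux_le0] applies; as the integrals depend linearly on the factor,
    the factors 1 and [i] identify the real and imaginary parts of [z]. *)
Lemma Ap_dissipative (Omega : set T) (p : R) (C : T -> 'M[R[i]]_d) (u : T -> R[i]) (K : R) :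
  open Omega -> 1 < p ->
  (forall k l : 'I_d, sobolev Omega 1 +oo%E (fun x => C x k l)) ->
  (forall x, Omega x -> forall tau xi eta, 0 <= tau <= 1 ->
    `|form_im (fun k l => complex.Re (C x k l)) (fun k l => complex.Im (C x k l))
      (Num.sqrt (1 + (p - 2) * tau)) xi eta| <=
    K * form_re (fun k l => complex.Re (C x k l)) (fun k l => complex.Im (C x k l))
      (Num.sqrt (1 + (p - 2) * tau)) xi eta) ->
  Ap_domain Omega p u ->
  let z := cpairing Omega (Ap Omega C u) (dual_fun p u) in
  `|complex.Im z| <= K * complex.Re z.
Proof.
move=> oD p1 hC hK [u2 u0]; have mD := open_measurable_rV oD.
have p0 : 0 < p := lt_trans ltr01 p1.
have [r [b [r' [b' [M [wrb bnd aeC Cx]]]]]] := coefficient_data oD hC.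
have [al' [be' [wu Lab wab Lab']]] := gradient_data oD p1 u2.
set al := (fun k => re (weak_partial Omega k u) \_ Omega) in Lab wab.
set be := (fun k => im (weak_partial Omega k u) \_ Omega) in Lab wab.
have [[mu_ _] _] := u2.
have [Lu Lw] := memLp_Lp mD p0 u2.1.
pose ua := re u \_ Omega; pose uw := im u \_ Omega.
have [mua _] := Lu; have [muw _] := Lw.
have wu_ k : rweak Omega k ua (al k) /\ rweak Omega k uw (be k).
  exact: ((weak_partialP _ _ _ oD).1 (wu k)).
have [A [B [h [tA tB Lh h0 AB]]]] := sobolev0_approx oD p1 mu_
  (fun l => (wu_ l).1) (fun l => (wu_ l).2) u0.
pose m x := (`|ua x| + `|uw x|) + (\sum_k (`|al k x| + `|be k x|) +
  (\sum_l \sum_k (`|al' l k x| + `|be' l k x|) + h x)).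
have Lm : Lp Omega p m.
  apply: LpD => //; first by apply: LpD => //; exact: Lp_norm.
  apply: LpD => //; first apply: Lp_sum => // k.
    by have [? ?] := Lab k; apply: LpD => //; exact: Lp_norm.
  apply: LpD => //; apply: Lp_sum => // l; apply: Lp_sum => // k.
  by have [? ?] := Lab' l k; apply: LpD => //; exact: Lp_norm.
have s1 x : 0 <= \sum_k (`|al k x| + `|be k x|) by apply: sumr_ge0 => k _; exact: addr_ge0.
have s2 x l : 0 <= \sum_k (`|al' l k x| + `|be' l k x|) by apply: sumr_ge0 => k _; exact: addr_ge0.
have s3 x : 0 <= \sum_l \sum_k (`|al' l k x| + `|be' l k x|) by apply: sumr_ge0 => l _; exact: s2.
have m0 x : 0 <= m x by rewrite /m !addr_ge0.
have mI : mu.-integrable Omega (EFin \o (fun x : T => m x `^ p)).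
  case: Lm => _; rewrite (_ : (fun x : T => `|m x| `^ p) = (fun x : T => m x `^ p))//.
  by apply/funext => x; rewrite ger0_norm.
have alx x k : `|al k x| + `|be k x| <= \sum_k (`|al k x| + `|be k x|).
  by rewrite [leRHS](bigD1 k)//= lerDl; apply: sumr_ge0 => j _; exact: addr_ge0.
have hm x : Omega x -> `|ua x| + h x <= m x /\ `|uw x| + h x <= m x.
  move=> _; rewrite /m; have := normr_ge0 (ua x); have := normr_ge0 (uw x).
  by have := s1 x; have := s3 x; split; lra.
have hm1 x k : Omega x -> `|al k x| + h x <= m x /\ `|be k x| + h x <= m x.
  move=> _; rewrite /m; have := normr_ge0 (ua x); have := normr_ge0 (uw x).
  have := alx x k; have := normr_ge0 (al k x); have := normr_ge0 (be k x); have := s3 x.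
  by split; lra.
have hm2 x l : Omega x -> \sum_k (`|al' l k x| + `|be' l k x|) <= m x.
  move=> _; have : \sum_k (`|al' l k x| + `|be' l k x|) <= \sum_l \sum_k (`|al' l k x| + `|be' l k x|).
    by rewrite [leRHS](bigD1 l)//= lerDl; apply: sumr_ge0 => j _; exact: s2.
  rewrite /m; have := normr_ge0 (ua x); have := normr_ge0 (uw x).
  by have := s1 x; have := h0 x; lra.
have AB' : {ae mu, forall x, Omega x ->
  (forall j, [/\ `|A j x| <= m x, `|B j x| <= m x &
     forall l, `|partial l (A j) x| <= m x /\ `|partial l (B j) x| <= m x]) /\
  [/\ A j x @[j --> \oo] --> ua x, B j x @[j --> \oo] --> uw x &
    forall l, partial l (A j) x @[j --> \oo] --> al l x /\
      partial l (B j) x @[j --> \oo] --> be l x]}.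
  apply: filterS AB => x hx Dx; have [h1 h2] := hx Dx.
  have near_le (f g : R) : `|f - g| <= h x -> `|g| + h x <= m x -> `|f| <= m x.
    move=> fg gm; rewrite -(subrK g f) addrC (le_trans (ler_normD _ _))//.
    by apply: le_trans gm; rewrite lerD2l.
  split; last by rewrite /ua /uw !patch_in.
  move=> j; have [h3 h4 h5] := h1 j; have [q1 q2] := hm x Dx; split.
  - by apply: near_le q1; rewrite /ua patch_in.
  - by apply: near_le q2; rewrite /uw patch_in.
  - by move=> l; have [h6 h7] := h5 l; have [q3 q4] := hm1 x l Dx; split;
      [exact: near_le h6 q3|exact: near_le h7 q4].
pose g1 x := gs p 0 (ua x) (uw x); pose g2 x := gs p 0 (uw x) (ua x).
pose E1 k l x := (r' k l x * al k x + r k l x * al' l k x) - (b' k l x * be k x + b k l x * be' l k x).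
pose E2 k l x := (r' k l x * be k x + r k l x * be' l k x) + (b' k l x * al k x + b k l x * al' l k x).
(* minus the real part of [(kappa + i sigma) A_p u conj g], up to a null set *)
pose F (kappa sigma : R) x := \sum_k \sum_l ((kappa * E1 k l x - sigma * E2 k l x) * g1 x +
  (kappa * E2 k l x + sigma * E1 k l x) * g2 x).
have main (kappa sigma : R) : mu.-integrable Omega (EFin \o F kappa sigma) /\
  ((forall e x, (2 <= p /\ e = 0) \/ (p < 2 /\ 0 < e) -> Omega x ->
     0 <= kappa * flux_re p e (ua x) (uw x) (fun k l => r k l x) (fun k l => b k l x) (al^~ x) (be^~ x) -
       sigma * flux_im p e (ua x) (uw x) (fun k l => r k l x) (fun k l => b k l x) (al^~ x) (be^~ x)) ->
   \int[mu]_(x in Omega) F kappa sigma x <= 0).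
  pose rr k l x := kappa * r k l x + - sigma * b k l x.
  pose rr' k l x := kappa * r' k l x + - sigma * b' k l x.
  pose bb k l x := kappa * b k l x + sigma * r k l x.
  pose bb' k l x := kappa * b' k l x + sigma * r' k l x.
  have sr k l : strong Omega l (rr k l) (rr' k l).
    by have [w1 w2] := wrb k l; apply: rweak_strong => //; exact: rweak_lin2.
  have sb k l : strong Omega l (bb k l) (bb' k l).
    by have [w1 w2] := wrb k l; apply: rweak_strong => //; exact: rweak_lin2.
  pose N := `|kappa| * M + `|sigma| * M.
  have lin (s t x y : R) : `|s| <= `|kappa| -> `|t| <= `|sigma| -> `|x| <= M -> `|y| <= M ->
      `|s * x + t * y| <= N.
    move=> hs ht hx hy; rewrite (le_trans (ler_normD _ _))//.
    by apply: lerD; rewrite normrM; apply: ler_pM.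
  have rM k l : bounded_fun_by N (rr k l).
    by move=> x; have [? ? ? ?] := bnd k l; apply: lin; rewrite ?normrN.
  have bM k l : bounded_fun_by N (bb k l).
    by move=> x; have [? ? ? ?] := bnd k l; apply: lin.
  have r'M k l : bounded_fun_by N (rr' k l).
    by move=> x; have [? ? ? ?] := bnd k l; apply: lin; rewrite ?normrN.
  have b'M k l : bounded_fun_by N (bb' k l).
    by move=> x; have [? ? ? ?] := bnd k l; apply: lin.
  have sal l k : strong Omega l (al k) (al' l k) by apply: rweak_strong => //; have [] := wab l k.
  have sbe l k : strong Omega l (be k) (be' l k) by apply: rweak_strong => //; have [] := wab l k.
  have fm x : Omega x -> `|ua x| <= m x /\ `|uw x| <= m x.
    by move=> Dx; have [q1 q2] := hm x Dx; have := h0 x; split; lra.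
  have fm1 x k : Omega x -> `|al k x| <= m x /\ `|be k x| <= m x.
    by move=> Dx; have [q1 q2] := hm1 x k Dx; have := h0 x; split; lra.
  have FE x : F kappa sigma x = \sum_k \sum_l flux_density p rr bb rr' bb' al be al' be' ua uw k l x.
    apply: eq_bigr => k _; apply: eq_bigr => l _.
    by rewrite /flux_density /flux0 /rr /rr' /bb /bb' /E1 /E2 -/(g1 x) -/(g2 x); ring.
  have -> : F kappa sigma = (fun x : T => \sum_k \sum_l flux_density p rr bb rr' bb' al be al' be' ua uw k l x).
    exact/funext.
  split; first exact: (integrable_flux p1 oD sr sb rM bM r'M b'M sal sbe mua muw mI fm fm1 hm2).
  move=> pos; apply: (integral_flux_le0 p1 oD sr sb rM bM r'M b'M sal sbe mua muw tA tB mI fm fm1 hm2 AB').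
  move=> e x pe Dx; have := pos e x pe Dx.
  congr (_ <= _); rewrite /flux_re /flux_im !mulr_sumr -sumrB; apply: eq_bigr => k _.
  by rewrite !mulr_sumr -sumrB; apply: eq_bigr => l _; rewrite /rr /bb; ring.
have mC k l : cmeasurable Omega (fun x => C x k l) by have [[]] := hC k l.
have P k l : let P := weak_partial Omega l (fun y => C y k l * weak_partial Omega k u y) in
  cmeasurable Omega P /\ {ae mu, forall x, Omega x -> re P x = E1 k l x /\ im P x = E2 k l x}.
  have [w1 w2] := wrb k l; have [w3 w4] := wab l k; have [b1 b2 b3 b4] := bnd k l.
  have [_ [mv _] _] := wu k.
  apply: (weak_partialM oD (mC k l) mv w1 w2 w3 w4 b1 b2 b3 b4).
    by apply: filterS aeC => x hx Dx; have [-> ->] := hx Dx k l.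
  by move=> x Dx; rewrite /al /be !patch_in.
pose P_ k l := weak_partial Omega l (fun y => C y k l * weak_partial Omega k u y).
have ReS (J : Type) (s : seq J) (G : J -> R[i]) : complex.Re (\sum_(j <- s) G j) = \sum_(j <- s) complex.Re (G j).
  by elim: s => [|i s ih]; rewrite ?big_nil// !big_cons ReD ih.
have ImS (J : Type) (s : seq J) (G : J -> R[i]) : complex.Im (\sum_(j <- s) G j) = \sum_(j <- s) complex.Im (G j).
  by elim: s => [|i s ih]; rewrite ?big_nil// !big_cons ImD ih.
have aeP : {ae mu, forall x, forall k l, Omega x -> re (P_ k l) x = E1 k l x /\ im (P_ k l) x = E2 k l x}.
  by apply: filter_forall => k; apply: filter_forall => l; have [_] := P k l.
pose z := cpairing Omega (Ap Omega C u) (dual_fun p u).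
pose f x := complex.Re (Ap Omega C u x * conjc (dual_fun p u x)).
pose g x := complex.Im (Ap Omega C u x * conjc (dual_fun p u x)).
pose SR x := \sum_k \sum_l re (P_ k l) x; pose SI x := \sum_k \sum_l im (P_ k l) x.
have ApE x : complex.Re (Ap Omega C u x) = - SR x /\ complex.Im (Ap Omega C u x) = - SI x.
  rewrite /Ap ReN ImN ReS ImS /SR /SI; split; congr (- _); apply: eq_bigr => k _.
    by rewrite ReS.
  by rewrite ImS.
have gu x : Omega x -> complex.Re (dual_fun p u x) = g1 x /\ complex.Im (dual_fun p u x) = g2 x.
  by move=> Dx; have [-> ->] := dual_funE p u x; rewrite /g1 /g2 /ua /uw !patch_in.
have fE x : Omega x -> f x = - \sum_k \sum_l (re (P_ k l) x * g1 x + im (P_ k l) x * g2 x).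
  move=> Dx; have [d1 d2] := gu x Dx; have [a1 a2] := ApE x.
  rewrite /f ReM ReJ ImJ d1 d2 a1 a2 (_ : \sum_k _ = SR x * g1 x + SI x * g2 x); first by ring.
  rewrite !mulr_suml -big_split; apply: eq_bigr => k _ /=.
  by rewrite !mulr_suml -big_split.
have gE x : Omega x -> g x = - \sum_k \sum_l (im (P_ k l) x * g1 x - re (P_ k l) x * g2 x).
  move=> Dx; have [d1 d2] := gu x Dx; have [a1 a2] := ApE x.
  rewrite /g ImM ReJ ImJ d1 d2 a1 a2 (_ : \sum_k _ = SI x * g1 x - SR x * g2 x); first by ring.
  rewrite !mulr_suml -sumrB; apply: eq_bigr => k _ /=.
  by rewrite !mulr_suml -sumrB.
have mg1 : measurable_fun setT g1 by exact: measurable_gs.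
have mg2 : measurable_fun setT g2 by exact: measurable_gs.
have mP k l : measurable_fun Omega (re (P_ k l)) /\ measurable_fun Omega (im (P_ k l)).
  by have [] := P k l.
have int_ae (q : T -> R) (kappa sigma : R) : mu.-integrable Omega (EFin \o F kappa sigma) ->
    measurable_fun Omega q -> {ae mu, forall x, Omega x -> q x = - F kappa sigma x} ->
    \int[mu]_(x in Omega) q x = - \int[mu]_(x in Omega) F kappa sigma x.
  move=> iF mq qF; rewrite -RintegralN//; congr fine; apply: ae_eq_integral => //.
  - exact/measurable_EFinP.
  - have /integrableP[/measurable_EFinP mF _] := iF; apply/measurable_EFinP.
    exact: measurableT_comp.
  - by apply: filterS qF => x hx Dx; rewrite hx.
have Rez : complex.Re z = - \int[mu]_(x in Omega) F 1 0 x.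
  have [i1 _] := main 1 0; apply: int_ae => //.
    apply: eq_measurable_fun (_ : measurable_fun Omega (fun x => - \sum_k \sum_l (re (P_ k l) x * g1 x + im (P_ k l) x * g2 x))).
      by move=> x; rewrite inE => Dx; rewrite -fE.
    apply: measurableT_comp => //; apply: measurable_sum => k; apply: measurable_sum => l.
    by have [m1 m2] := mP k l; apply: measurable_funD; apply: measurable_funM => //; exact: measurable_funTS.
  apply: filterS aeP => x hx Dx; rewrite -/(f x) fE//; congr (- _).
  apply: eq_bigr => k _; apply: eq_bigr => l _; have [-> ->] := hx k l Dx.
  by rewrite !mul1r !mul0r subr0 addr0.
have Imz : complex.Im z = \int[mu]_(x in Omega) F 0 1 x.
  (* the imaginary part is the real part of [- i z] *)
  have [i1 _] := main 0 (-1).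
  have -> : \int[mu]_(x in Omega) F 0 1 x = - \int[mu]_(x in Omega) F 0 (-1) x.
    rewrite -RintegralN//; apply: eq_Rintegral => x _; rewrite -sumrN; apply: eq_bigr => k _.
    by rewrite -sumrN; apply: eq_bigr => l _; ring.
  apply: int_ae => //.
    apply: eq_measurable_fun (_ : measurable_fun Omega (fun x => - \sum_k \sum_l (im (P_ k l) x * g1 x - re (P_ k l) x * g2 x))).
      by move=> x; rewrite inE => Dx; rewrite -gE.
    apply: measurableT_comp => //; apply: measurable_sum => k; apply: measurable_sum => l.
    by have [m1 m2] := mP k l; apply: measurable_funB; apply: measurable_funM => //; exact: measurable_funTS.
  apply: filterS aeP => x hx Dx; rewrite -/(g x) gE//; congr (- _).
  apply: eq_bigr => k _; apply: eq_bigr => l _; have [-> ->] := hx k l Dx.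
  by ring.
have split_F (sigma : R) : \int[mu]_(x in Omega) F K sigma x =
    K * \int[mu]_(x in Omega) F 1 0 x + sigma * \int[mu]_(x in Omega) F 0 1 x.
  have [i1 _] := main 1 0; have [i2 _] := main 0 1.
  rewrite -!RintegralZl// -RintegralD//; first last.
  - by under [_ \o _]eq_fun do rewrite /= EFinM; exact: integrableZl.
  - by under [_ \o _]eq_fun do rewrite /= EFinM; exact: integrableZl.
  apply: eq_Rintegral => x _; rewrite !mulr_sumr -big_split; apply: eq_bigr => k _ /=.
  by rewrite !mulr_sumr -big_split; apply: eq_bigr => l _ /=; ring.
have sgn (sigma : R) : `|sigma| = 1 -> \int[mu]_(x in Omega) F K sigma x <= 0.
  move=> s1_; have [_] := main K sigma; apply => e x pe Dx.
  have e0 : 0 <= e by case: pe => -[_]; [move=> ->|exact: ltW].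
  have key : `|flux_im p e (ua x) (uw x) (fun k l => r k l x) (fun k l => b k l x) (al^~ x) (be^~ x)| <=
    K * flux_re p e (ua x) (uw x) (fun k l => r k l x) (fun k l => b k l x) (al^~ x) (be^~ x).
    apply: flux_sector => // tau xi eta tau01.
    have [hx|hx] := Cx x Dx.
      have -> : (fun k l => r k l x) = (fun k l => complex.Re (C x k l)).
        by apply/funext => k; apply/funext => l; have [] := hx k l.
      have -> : (fun k l => b k l x) = (fun k l => complex.Im (C x k l)).
        by apply/funext => k; apply/funext => l; have [] := hx k l.
      exact: hK.
    rewrite form_imE form_reE !big1 ?normr0 ?mulr0// => k _; rewrite big1// => l _;
      by have [-> ->] := hx k l; ring.
  rewrite subr_ge0; apply: le_trans key.
  by rewrite -[leRHS]mul1r -s1_ -normrM ler_norm.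
change (`|complex.Im z| <= K * complex.Re z); rewrite Rez Imz; have := sgn 1 (normr1 _); have := sgn (-1) (normrN1 _).
by rewrite !split_F ler_norml => q1 q2; apply/andP; split; lra.
Qed.

End main.

Local Open Scope complex_scope.
Local Open Scope ring_scope.

Theorem theorem1p2 (R : realType) (d : nat) (Omega : set 'rV[R]_d)
    (theta p : R) (C : 'rV[R]_d -> 'M[R[i]]_d) :
  (0 < d)%N ->
  open Omega -> lipschitz_boundary Omega ->
  0 <= theta -> theta < pi / 2 -> 1 < p ->
  (forall k l : 'I_d, sobolev Omega 1 +oo%E (fun x => C x k l)) ->
  (forall x, Omega x -> forall xi : 'cV[R[i]]_d,
     sector theta (hinner (C x *m xi) xi)) ->
  `|1 - 2 / p| < cos theta ->
  (forall x, Omega x -> Ba C x = 0) ->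
  forall u : 'rV[R]_d -> R[i], Ap_domain Omega p u ->
    let z := cpairing Omega (Ap Omega C u) (dual_fun p u) in
    `|complex.Im z| <= sector_const Omega C theta p * complex.Re z.
Proof.
move=> _ oD _ t0 t1 p1 hC hs pt hB u hu; apply: Ap_dissipative => // x Dx tau xi eta tau01.
have symB k l : complex.Im (C x k l) = complex.Im (C x l k).
  by have := antisym_eq0 (hB x Dx) k l; rewrite !mxE.
rewrite /sector_const; case: ifPn => [/asboolP hR|_].
  apply: form_sector_sym => // [|k l]; first exact: hs.
  by have := antisym_eq0 (hR x Dx) k l; rewrite !mxE.
by apply: form_sector => //; exact: hs.
Qed.
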